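(* Let $\mathfrak g$ be one of $sl(\infty)$, $o(\infty)$, $sp(\infty)$. For each integer $r\ge 0$, the $\mathfrak g$-module $T^{\leq r}$ is injective in the category of absolute weight $\mathfrak g$-modules and in the category $\mathbb T_{\mathfrak g}$.
   Context: The ground field is $\mathbb C$. The Lie algebra $\mathfrak g$ is one of $sl(\infty)=\varinjlim sl(n)$, $o(\infty)=\varinjlim o(n)$, $sp(\infty)=\varinjlim sp(2n)$ (left upper corner inclusions), with a fixed exhaustion $\mathfrak g=\varinjlim \mathfrak g_n$, where $\mathfrak g_n=sl(n)$; $\mathfrak g_n=o(2n)$ or $o(2n+1)$; $\mathfrak g_n=sp(2n)$, respectively. $V=\varinjlim V_n$ is the natural representation ($V_n$ is the natural representation of $\mathfrak g_n$) and $V_*=\varinjlim V_n^*$ is the conatural representation. An element of $\mathfrak g$ is semisimple if it is semisimple in some $\mathfrak g_n$; a subalgebra is toral if it consists of semisimple elements. A splitting Cartan subalgebra is a maximal toral subalgebra $\mathfrak h\subset\mathfrak g$ such that $\mathfrak g$ is the direct sum of its $\mathfrak h$-weight spaces. A $\mathfrak g$-module is an $\mathfrak h$-weight module if it is the direct sum of its $\mathfrak h$-weight spaces, and an absolute weight module if it is an $\mathfrak h$-weight module for every splitting Cartan subalgebra $\mathfrak h$ of $\mathfrak g$. The category of absolute weight modules is the full subcategory of $\mathfrak g$-modules whose objects are the absolute weight modules. $\mathbb T_{\mathfrak g}$ is the full subcategory of $\mathfrak g$-modules whose objects are the absolute weight modules of finite length. For $\mathfrak g=sl(\infty)$: $T^{p,q}:=V^{\otimes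 p}\otimes(V_* )^{\otimes q}$ and $T^{\leq r}:=\bigoplus_{p+q\leq r}T^{p,q}$. For $\mathfrak g=o(\infty),sp(\infty)$: $T^p:=V^{\otimes p}$ and $T^{\leq r}:=\bigoplus_{p\leq r}T^p$. *)

(* Defs.v *)
From HB Require Import structures.
From mathcomp Require Import all_boot all_order all_algebra.
From mathcomp Require Import boolp classical_sets functions cardinality fsbigop.
From mathcomp Require Import reals complex.
From mathcomp Require Import ring.

Set Implicit Arguments.
Unset Strict Implicit.
Unset Printing Implicit Defensive.
Import Order.TTheory GRing.Theory Num.Theory.
Local Open Scope classical_set_scope.
Local Open Scope ring_scope.

HB.mixin Record isLieAlgebra (K : fieldType) L of GRing.Lmodule K L := {
  bracket : L -> L -> L;
  bracket_linearl : forall z, linear (bracket^~ z);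
  bracket_linearr : forall x, linear (bracket x);
  bracketxx : forall x, bracket x x = 0;
  bracket_jacobi : forall x y z,
    bracket x (bracket y z) + bracket y (bracket z x)
      + bracket z (bracket x y) = 0
}.

#[short(type="lieAlgType")]
HB.structure Definition LieAlgebra (K : fieldType) :=
  {L of isLieAlgebra K L & GRing.Lmodule K L}.

HB.mixin Record isLieModule (K : fieldType) (L : lieAlgType K) M
    of GRing.Lmodule K M := {
  lact : L -> M -> M;
  lact_linearl : forall m, linear (lact^~ m);
  lact_linearr : forall x, linear (lact x);
  lact_bracket : forall x y m,
    lact (bracket x y) m = lact x (lact y m) - lact y (lact x m)
}.

#[short(type="lieModType")]
HB.structure Definition LieModule (K : fieldType) (L : lieAlgType K) :=
  {M of isLieModule K L M & GRing.Lmodule K M}.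

Section LieModules.
Variables (K : fieldType) (L : lieAlgType K).

Record lie_hom (M N : lieModType L) := LieHom {
  lie_hom_fun :> {linear M -> N};
  lie_homP : forall x m, lie_hom_fun (lact x m) = lact x (lie_hom_fun m)
}.

(* A full subcategory of the category of L-modules is given by a predicate
   [P] on objects. *)
Definition monomorphism_in (P : lieModType L -> Prop) (M N : lieModType L)
    (f : lie_hom M N) :=
  forall (A : lieModType L) (u v : lie_hom A M), P A ->
    (forall a, f (u a) = f (v a)) -> forall a, u a = v a.

Definition injective_object_in (P : lieModType L -> Prop)
    (I : lieModType L) :=
  P I /\
  forall (M N : lieModType L) (f : lie_hom M N), P M -> P N ->
    monomorphism_in P f ->
    forall u : lie_hom M I, exists v : lie_hom N I,
      forall m, v (f m) = u m.

Definition submodule (M : lieModType L) (W : set M) :=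
  [/\ W 0, forall (a : K) u v, W u -> W v -> W (a *: u + v)
    & forall x u, W u -> W (lact x u)].

(* Existence of a composition series: a finite chain of submodules from [0]
   to [M] that admits no proper refinement. *)
Definition finite_length (M : lieModType L) :=
  exists (n : nat) (W : nat -> set M),
    [/\ W 0%N = [set 0], W n = setT,
        forall i, (i <= n)%N -> submodule (W i)
      & forall i, (i < n)%N -> W i `<` W i.+1 /\
          forall U, submodule U -> W i `<=` U -> U `<=` W i.+1 ->
            U = W i \/ U = W i.+1].

Definition subalgebra (h : set L) :=
  [/\ h 0, forall (a : K) x y, h x -> h y -> h (a *: x + y)
    & forall x y, h x -> h y -> h (bracket x y)].

(* [V] is the internal direct sum of its subspaces [W i], for [i] in [D]. *)
Definition is_direct_sum (V : lmodType K) (I : choiceType) (D : set I)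
    (W : I -> set V) :=
  forall v : V, exists! f : I -> V,
    [/\ finite_set [set i | f i <> 0], forall i, f i <> 0 -> D i,
        forall i, D i -> W i (f i) & v = \sum_(i \in D) f i].

Definition dual_space (h : set L) : set (h -> K) :=
  [set lam | forall (a : K) (x y z : h),
     set_val z = a *: set_val x + set_val y -> lam z = a * lam x + lam y].

Definition weight_space (h : set L) (M : lieModType L) (lam : h -> K) : set M :=
  [set m | forall x : h, lact (set_val x) m = lam x *: m].

Definition weight_module (h : set L) (M : lieModType L) :=
  is_direct_sum (@dual_space h) (@weight_space h M).

Definition adjoint : Type := L.
HB.instance Definition _ := GRing.Lmodule.on adjoint.


Fact adjoint_bracket (x y m : adjoint) :
  bracket (bracket x y) m =
  bracket x (bracket y m) - bracket y (bracket x m) :> adjoint.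
Proof.
have anti (u v : L) : bracket u v = - bracket v u.
  have addl (a b c : L) : bracket (a + b) c = bracket a c + bracket b c.
    by have := bracket_linearl c 1 a b; rewrite !scale1r.
  have addr (a b c : L) : bracket c (a + b) = bracket c a + bracket c b.
    by have := bracket_linearr c 1 a b; rewrite !scale1r.
  have := bracketxx (u + v); rewrite addl !addr !bracketxx add0r addr0.
  by move/eqP; rewrite addr_eq0 => /eqP.
have oppr (u v : L) : bracket u (- v) = - bracket u v.
  have := bracket_linearr u (-1) v 0; rewrite !scaleN1r addr0 => ->.
  by have := bracket_linearr u (-1) 0 0; rewrite scaler0 addr0 scaleN1r addNr
    => ->; rewrite addr0.
have := bracket_jacobi x y m; rewrite [bracket m x]anti [bracket m _]anti oppr.
by move/eqP; rewrite subr_eq0 => /eqP.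
Qed.

HB.instance Definition _ := isLieModule.Build K L adjoint
  (@bracket_linearl K L) (@bracket_linearr K L) adjoint_bracket.

End LieModules.

Arguments dual_space {K L} h.
Arguments weight_space {K L} h M lam.
Arguments weight_module {K L} h M.

(* For a finite index type, the direct sum is the full product. *)
Section FiniteDirectSum.
Variables (K : fieldType) (L : lieAlgType K) (I : finType).
Variable M : I -> lieModType L.

Definition dsum : Type := forall i, M i.

HB.instance Definition _ := Choice.on dsum.

Let add (u v : dsum) : dsum := fun i => u i + v i.
Let opp (u : dsum) : dsum := fun i => - u i.
Let scale (a : K) (u : dsum) : dsum := fun i => a *: u i.
Let act (x : L) (u : dsum) : dsum := fun i => lact x (u i).

Fact dsum_addA : associative add.
Proof. by move=> u v w; apply: functional_extensionality_dep => i; exact: addrA. Qed.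
Fact dsum_addC : commutative add.
Proof. by move=> u v; apply: functional_extensionality_dep => i; exact: addrC. Qed.
Fact dsum_add0 : left_id (fun i => 0 : M i) add.
Proof. by move=> u; apply: functional_extensionality_dep => i; exact: add0r. Qed.
Fact dsum_addN : left_inverse (fun i => 0 : M i) opp add.
Proof. by move=> u; apply: functional_extensionality_dep => i; exact: addNr. Qed.

HB.instance Definition _ :=
  GRing.isZmodule.Build dsum dsum_addA dsum_addC dsum_add0 dsum_addN.

Fact dsum_scaleA a b v : scale a (scale b v) = scale (a * b) v.
Proof. by apply: functional_extensionality_dep => i; exact: scalerA. Qed.
Fact dsum_scale1 : left_id 1 scale.
Proof. by move=> u; apply: functional_extensionality_dep => i; exact: scale1r. Qed.
Fact dsum_scaleDr : right_distributive scale +%R.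
Proof. by move=> a u v; apply: functional_extensionality_dep => i; exact: scalerDr. Qed.
Fact dsum_scaleDl v : {morph scale^~ v : a b / a + b}.
Proof. by move=> a b; apply: functional_extensionality_dep => i; exact: scalerDl. Qed.

HB.instance Definition _ := GRing.Zmodule_isLmodule.Build K dsum
  dsum_scaleA dsum_scale1 dsum_scaleDr dsum_scaleDl.

Fact dsum_actl m : linear (act^~ m).
Proof. by move=> a x y; apply: functional_extensionality_dep => i; exact: lact_linearl. Qed.
Fact dsum_actr x : linear (act x).
Proof. by move=> a u v; apply: functional_extensionality_dep => i; exact: lact_linearr. Qed.
Fact dsum_act_bracket x y m :
  act (bracket x y) m = act x (act y m) - act y (act x m).
Proof. by apply: functional_extensionality_dep => i; exact: lact_bracket. Qed.

HB.instance Definition _ :=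
  isLieModule.Build K L dsum dsum_actl dsum_actr dsum_act_bracket.

End FiniteDirectSum.

(* The four exhaustions: sl(n), o(2n), o(2n+1), sp(2n).  The two orthogonal
   ones have the same union, o(oo). *)
Variant series := SL | Oeven | Oodd | SP.

Definition mx_size (t : series) (n : nat) : nat :=
  match t with SL => n | Oeven | SP => n.*2 | Oodd => n.*2.+1 end.

Section Finitary.
Variable F : fieldType.
Implicit Types (t : series) (X Y Z : nat -> nat -> F).

(* Gram matrices of the forms preserved by o(oo) and sp(oo): the standard
   symmetric form, and the alternating form whose matrix is block diagonal with
   blocks [0 1; -1 0].  For these forms the inclusions of g_n in g_n.+1 are the
   upper left corner inclusions. *)
Definition form t (i j : nat) : F :=
  match t with
  | SP => if ~~ odd i && (j == i.+1) then 1
          else if odd i && (i == j.+1) then -1 else 0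
  | _ => (i == j)%:R
  end.

Definition form_mx t n : 'M[F]_n := \matrix_(i < n, j < n) form t i j.

(* [in_fin t n] is g_n, with [n] the size of the matrices *)
Definition in_fin t n (A : 'M[F]_n) : bool :=
  match t with
  | SL => \tr A == 0
  | _ => A^T *m form_mx t n + form_mx t n *m A == 0
  end.

Definition corner n (A : 'M[F]_n) : nat -> nat -> F := fun i j =>
  match insub i, insub j with Some i', Some j' => A i' j' | _, _ => 0 end.

Definition in_inf t X : Prop :=
  exists n (A : 'M[F]_(mx_size t n)), in_fin t A /\ X = corner A.

Definition mulinf X Y : nat -> nat -> F :=
  fun i j => \sum_(k \in [set: nat]) X i k * Y k j.

Definition bounded n X := forall i j, (n <= i)%N || (n <= j)%N -> X i j = 0.

Lemma cornerE n (A : 'M[F]_n) (i j : 'I_n) : corner A i j = A i j.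
Proof. by rewrite /corner !valK. Qed.

Lemma corner_bounded n (A : 'M[F]_n) : bounded n (corner A).
Proof.
move=> i j; rewrite /corner; case: insubP => // i' lti _.
case: insubP => // j' ltj _.
by rewrite leqNgt lti leqNgt ltj.
Qed.

Lemma boundedW n m X : (n <= m)%N -> bounded n X -> bounded m X.
Proof.
move=> nm bX i j /orP[mi|mj]; apply: bX; first by rewrite (leq_trans nm mi).
by rewrite (leq_trans nm mj) orbT.
Qed.

Lemma corner_linear n a (A B : 'M[F]_n) :
  corner (a *: A + B) = (a *: (corner A : nat -> nat -> F^o) + corner B).
Proof.
apply/funext => i; apply/funext => j.
change (corner (a *: A + B) i j = a * corner A i j + corner B i j).
rewrite /corner; case: insubP => [i' _ _|_]; last by rewrite mulr0 addr0.
by case: insubP => [j' _ _|_]; rewrite ?mulr0 ?addr0 // !mxE.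
Qed.

Lemma corner_mxE n X : bounded n X -> corner (\matrix_(i < n, j < n) X i j) = X.
Proof.
move=> bX; apply/funext => i; apply/funext => j.
case: (leqP n i) => [ni|ltin]; first by rewrite corner_bounded ?bX ?ni.
case: (leqP n j) => [nj|ltjn]; first by rewrite corner_bounded ?bX ?nj ?orbT.
by rewrite (cornerE _ (Ordinal ltin) (Ordinal ltjn)) mxE.
Qed.

Lemma sum_bounded n (f : nat -> F) : (forall k, (n <= k)%N -> f k = 0) ->
  \sum_(k \in [set: nat]) f k = \sum_(k < n) f k.
Proof.
move=> f0; rewrite fsbig_ord; apply/esym/fsbig_widen => // k.
by case=> _ /= /negP; rewrite -leqNgt => /f0.
Qed.

Lemma mulinf_corner n (A B : 'M[F]_n) :
  mulinf (corner A) (corner B) = corner (A *m B).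
Proof.
rewrite -[RHS](corner_mxE (corner_bounded (A *m B))).
rewrite -[mulinf _ _](@corner_mxE n); last first.
  move=> i j ij; rewrite /mulinf (@sum_bounded n) => [|k nk].
    apply: big1 => k _; case/orP: ij => [ni|nj].
      by rewrite corner_bounded ?ni // mul0r.
    by rewrite [X in _ * X]corner_bounded ?nj ?orbT // mulr0.
  by rewrite corner_bounded ?nk ?orbT // mul0r.
congr corner; apply/matrixP => i j; rewrite !mxE cornerE mxE /mulinf.
rewrite (@sum_bounded n) => [|k nk].
  by apply: eq_bigr => k _; rewrite !cornerE.
by rewrite corner_bounded ?nk ?orbT // mul0r.
Qed.

Lemma mx_sizeW t n m : (n <= m)%N -> (mx_size t n <= mx_size t m)%N.
Proof. by case: t => //= nm; rewrite ?ltnS leq_double. Qed.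

Lemma form_cut t n i j : t <> SL -> (i < mx_size t n)%N ->
  (mx_size t n <= j)%N -> form t i j = 0 /\ form t j i = 0.
Proof.
case: t => //= _ ltin nj; first 2 last.
- have ij : (j == i.+1) -> ~~ odd i -> False.
    move=> /eqP jE ni; have : i.+1 == n.*2.
      by rewrite eqn_leq ltin -jE nj.
    by move/eqP/(congr1 odd); rewrite /= odd_double ni.
  have ji : (i == j.+1) = false.
    by apply/eqP => iE; move: ltin; rewrite iE ltnNge (leq_trans nj).
  rewrite ji andbF andbF; split.
    by case: ifP => // /andP[ni /ij]; move/(_ ni).
  by case: ifP => // /andP[oj /eqP jE]; case: ij; [exact/eqP|move: oj; rewrite jE].
- by rewrite [j == i]eq_sym; case: eqP => // ijE; move: ltin; rewrite ijE ltnNge nj.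
- by rewrite [j == i]eq_sym; case: eqP => // ijE; move: ltin; rewrite ijE ltnNge nj.
Qed.

Lemma in_fin_preserves t n (A : 'M[F]_(mx_size t n)) : t <> SL ->
  in_fin t A <-> forall i j : nat,
    \sum_(k \in [set: nat]) corner A k i * form t k j
      + \sum_(k \in [set: nat]) form t i k * corner A k j = 0.
Proof.
move=> tSL; set N := mx_size t n in A *.
have -> : in_fin t A = (A^T *m form_mx t N + form_mx t N *m A == 0).
  by case: (t) tSL.
have sumE i j : \sum_(k \in [set: nat]) corner A k i * form t k j
      + \sum_(k \in [set: nat]) form t i k * corner A k j =
    \sum_(k < N) corner A k i * form t k j
      + \sum_(k < N) form t i k * corner A k j.
  rewrite !(@sum_bounded N) // => k Nk; rewrite corner_bounded ?Nk //.
  - by rewrite mulr0.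
  - by rewrite mul0r.
split=> [/eqP A0 i j|A0]; last first.
  apply/eqP/matrixP => i j; have := A0 i j; rewrite sumE !mxE; apply: etrans.
  by congr (_ + _); apply: eq_bigr => k _; rewrite !mxE cornerE.
rewrite sumE; case: (leqP N i) => [Ni|ltiN].
  rewrite !big1 ?addr0 // => k _.
    by have [_ ->] := form_cut tSL (ltn_ord k) Ni; rewrite mul0r.
  by rewrite corner_bounded ?Ni ?orbT // mul0r.
case: (leqP N j) => [Nj|ltjN].
  rewrite !big1 ?addr0 // => k _.
    by rewrite corner_bounded ?Nj ?orbT // mulr0.
  by have [-> _] := form_cut tSL (ltn_ord k) Nj; rewrite mulr0.
have /matrixP/(_ (Ordinal ltiN) (Ordinal ltjN)) := A0; rewrite !mxE; apply: etrans.
by congr (_ + _); apply: eq_bigr => k _; rewrite !mxE -cornerE.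
Qed.

Lemma in_finW t n m (A : 'M[F]_(mx_size t n)) : (n <= m)%N -> in_fin t A ->
  exists2 B : 'M[F]_(mx_size t m), in_fin t B & corner B = corner A.
Proof.
move=> nm Ain; pose B := \matrix_(i < mx_size t m, j < mx_size t m) corner A i j.
have BA : corner B = corner A.
  by apply/corner_mxE/(boundedW (mx_sizeW t nm))/corner_bounded.
exists B => //; have [tSL|tSL] := pselect (t = SL); last first.
  by apply/in_fin_preserves => //; rewrite BA; apply/in_fin_preserves.
have trE k (C : 'M[F]_k) : \tr C = \sum_(i \in [set: nat]) corner C i i.
  rewrite (@sum_bounded k) => [|i ki]; last by rewrite corner_bounded ?ki.
  by apply: eq_bigr => i _; rewrite cornerE.
have inE k (C : 'M[F]_k) : in_fin t C = (\tr C == 0) by rewrite tSL.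
by move: Ain; rewrite !inE !trE BA.
Qed.

Lemma in_fin_linear t n a (A B : 'M[F]_n) :
  in_fin t A -> in_fin t B -> in_fin t (a *: A + B).
Proof.
have lin : A^T *m form_mx t n + form_mx t n *m A = 0 ->
    B^T *m form_mx t n + form_mx t n *m B = 0 ->
  (a *: A + B)^T *m form_mx t n + form_mx t n *m (a *: A + B) = 0.
  move=> A0 B0; rewrite linearP /= mulmxDl mulmxDr -scalemxAl -scalemxAr.
  by rewrite addrACA -scalerDr A0 B0 scaler0 addr0.
case: (t) lin => /= lin /eqP A0 /eqP B0; apply/eqP; try exact: lin.
by rewrite linearP /= A0 B0 mulr0 addr0.
Qed.

Lemma in_fin_bracket t n (A B : 'M[F]_n) :
  in_fin t A -> in_fin t B -> in_fin t (A *m B - B *m A).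
Proof.
have br : A^T *m form_mx t n + form_mx t n *m A = 0 ->
    B^T *m form_mx t n + form_mx t n *m B = 0 ->
  (A *m B - B *m A)^T *m form_mx t n + form_mx t n *m (A *m B - B *m A) = 0.
  move=> /eqP; rewrite addr_eq0 => /eqP A0.
  move=> /eqP; rewrite addr_eq0 => /eqP B0.
  rewrite linearB /= !trmx_mul mulmxBl -!mulmxA A0 B0 !mulmxN !mulmxA A0 B0.
  rewrite !mulNmx !opprK mulmxBr !mulmxA.
  by rewrite -opprB addNr.
case: (t) br => /= br /eqP A0 /eqP B0; apply/eqP; try exact: br.
by rewrite linearB /= mxtrace_mulC subrr.
Qed.

Lemma in_inf2 t X Y : in_inf t X -> in_inf t Y ->
  exists n (A B : 'M[F]_(mx_size t n)),
    [/\ in_fin t A, in_fin t B, X = corner A & Y = corner B].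
Proof.
move=> [n [A [Ain ->]]] [m [B [Bin ->]]].
have [A' A'in <-] := in_finW (leq_maxl n m) Ain.
have [B' B'in <-] := in_finW (leq_maxr n m) Bin.
by exists (maxn n m), A', B'.
Qed.

Definition in_infb t : {pred (nat -> nat -> F^o)} := fun X => `[< in_inf t X >].

Fact in_infb_submod t : submod_closed (in_infb t).
Proof.
split.
  apply/asboolP; exists 0%N, 0; split.
    by case: t; rewrite /in_fin ?linear0 ?trmx0 ?mul0mx ?mulmx0 ?addr0.
  apply/funext => i; apply/funext => j; rewrite /corner.
  by case: insubP => // i' _ _; case: insubP => // j' _ _; rewrite mxE.
move=> a X Y /asboolP Xin /asboolP Yin; apply/asboolP.
have [n [A [B [Ain Bin -> ->]]]] := in_inf2 Xin Yin.
by exists n, (a *: A + B); split; [exact: in_fin_linear|rewrite corner_linear].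
Qed.

HB.instance Definition _ t :=
  GRing.isSubmodClosed.Build F (nat -> nat -> F^o) (in_infb t) (in_infb_submod t).

Record ginf t := Ginf {
  gval :> nat -> nat -> F^o;
  gvalP : gval \in in_infb t
}.

HB.instance Definition _ t := [isSub of ginf t for @gval t].
HB.instance Definition _ t := [Choice of ginf t by <:].
HB.instance Definition _ t := [SubChoice_isSubLmodule of ginf t by <:].

Fact ginf_common t (x y : ginf t) : exists n (A B : 'M[F]_(mx_size t n)),
  [/\ in_fin t A, in_fin t B, gval x = corner A & gval y = corner B].
Proof.
have /asboolP Xin := gvalP x; have /asboolP Yin := gvalP y.
exact: in_inf2 Xin Yin.
Qed.

Fact ginf_common3 t (x y z : ginf t) : exists n (A B C : 'M[F]_(mx_size t n)),
  [/\ gval x = corner A, gval y = corner B & gval z = corner C].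
Proof.
have [n [A [B [Ain Bin xA yB]]]] := ginf_common x y.
have /asboolP Zin := gvalP z.
have [m [C [D [Cin Din -> _]]]] := in_inf2 Zin Zin.
have [A' _ A'E] := in_finW (leq_maxl n m) Ain.
have [B' _ B'E] := in_finW (leq_maxl n m) Bin.
have [C' _ C'E] := in_finW (leq_maxr n m) Cin.
by exists (maxn n m), A', B', C'; rewrite xA yB A'E B'E C'E.
Qed.

Definition commutator X Y : nat -> nat -> F^o :=
  fun i j => mulinf X Y i j - mulinf Y X i j.

Lemma commutator_corner n (A B : 'M[F]_n) :
  commutator (corner A) (corner B) = corner (A *m B - B *m A).
Proof.
rewrite /commutator !mulinf_corner.
have -> : A *m B - B *m A = (-1) *: (B *m A) + A *m B by rewrite scaleN1r addrC.
rewrite corner_linear scaleN1r; apply/funext => i; apply/funext => j.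
by rewrite addrC.
Qed.

Fact gbracket_subproof t (x y : ginf t) : commutator x y \in in_infb t.
Proof.
have [n [A [B [Ain Bin -> ->]]]] := ginf_common x y.
apply/asboolP; exists n, (A *m B - B *m A).
by rewrite commutator_corner; split => //; exact: in_fin_bracket.
Qed.

Definition gbracket t (x y : ginf t) : ginf t := Ginf (gbracket_subproof x y).

Fact gbracket_linearl t (z : ginf t) : linear (@gbracket t ^~ z).
Proof.
move=> a x y; apply: val_inj => /=.
have [n [A [B [C [xA yB zC]]]]] := ginf_common3 x y z.
rewrite xA yB zC -corner_linear !commutator_corner -corner_linear.
congr corner; rewrite mulmxDl mulmxDr -scalemxAl -scalemxAr.
by rewrite scalerBr opprD addrACA.
Qed.

Fact gbracket_linearr t (z : ginf t) : linear (gbracket z).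
Proof.
move=> a x y; apply: val_inj => /=.
have [n [A [B [C [xA yB zC]]]]] := ginf_common3 x y z.
rewrite xA yB zC -corner_linear !commutator_corner -corner_linear.
congr corner; rewrite mulmxDl mulmxDr -scalemxAl -scalemxAr.
by rewrite scalerBr opprD addrACA.
Qed.

Fact gbracketxx t (x : ginf t) : gbracket x x = 0.
Proof.
by apply: val_inj; apply/funext => i; apply/funext => j; exact: subrr.
Qed.

Fact gbracket_jacobi t (x y z : ginf t) :
  gbracket x (gbracket y z) + gbracket y (gbracket z x)
    + gbracket z (gbracket x y) = 0.
Proof.
apply: val_inj => /=.
have [n [A [B [C [-> -> ->]]]]] := ginf_common3 x y z.
have cornerD (D E : 'M[F]_(mx_size t n)) :
    (corner D : nat -> nat -> F^o) + corner E = corner (D + E).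
  by rewrite -[D in RHS]scale1r corner_linear scale1r.
rewrite !commutator_corner !cornerD; apply/funext => i; apply/funext => j.
have -> : (A *m (B *m C - C *m B) - (B *m C - C *m B) *m A
  + (B *m (C *m A - A *m C) - (C *m A - A *m C) *m B)
  + (C *m (A *m B - B *m A) - (A *m B - B *m A) *m C)) = 0.
  rewrite !mulmxBl !mulmxBr !mulmxA !opprB.
  apply/matrixP => k l; rewrite !mxE; ring.
rewrite /corner; case: insubP => // i' _ _; case: insubP => // j' _ _.
by rewrite mxE.
Qed.

HB.instance Definition _ t := isLieAlgebra.Build F (ginf t)
  (@gbracket_linearl t) (@gbracket_linearr t) (@gbracketxx t)
  (@gbracket_jacobi t).

(* An infinite matrix acts on (coordinate) column vectors. *)
Definition vact X (v : nat -> F) : nat -> F :=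
  fun i => \sum_(k \in [set: nat]) X i k * v k.

(* [vact (dualinf X)] is the contragredient action on V_*, in the coordinates
   of the basis dual to the standard basis of V (see [pairing_dualinf]). *)
Definition dualinf X : nat -> nat -> F := fun i j => - X j i.

Section Tensor.
Variables p q : nat.

(* The components of a tensor of V^(x)p (x) V_*^(x)q in the basis of the
   e_i1 (x) ... (x) e_ip (x) e*_j1 (x) ... (x) e*_jq are indexed by functions
   from the slots ['I_p + 'I_q] to [nat]. *)
Notation slot := ('I_p + 'I_q)%type.
Notation multi_index := {ffun slot -> nat}.

Definition upd (I : multi_index) (s : slot) (l : nat) : multi_index :=
  [ffun s' => if s' == s then l else I s'].

Definition slot_mx X (s : slot) : nat -> nat -> F :=
  match s with inl _ => X | inr _ => dualinf X end.

Definition slot_act X (s : slot) (f : multi_index -> F) : multi_index -> F :=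
  fun I => vact (slot_mx X s) (fun l => f (upd I s l)) (I s).

Definition tens_act X (f : multi_index -> F) : multi_index -> F^o :=
  fun I => \sum_(s : slot) slot_act X s f I.

Definition pure_tensor (u : slot -> nat -> F) : multi_index -> F :=
  fun I => \prod_(s : slot) u s (I s).

Definition fin_supp : {pred (multi_index -> F^o)} :=
  fun f => `[< finite_set [set I | f I <> 0] >].

Fact fin_supp_submod : submod_closed fin_supp.
Proof.
split; first by apply/asboolP; rewrite (_ : [set I | _] = set0) // -subset0 => I.
move=> a f g /asboolP ff /asboolP fg; apply/asboolP.
apply: (@sub_finite_set _ _ ([set I | f I <> 0] `|` [set I | g I <> 0])).
  move=> I /= fgI; apply: contrapT => /not_orP[/contrapT f0 /contrapT g0].
  by apply: fgI; change (a * f I + g I = 0); rewrite f0 g0 mulr0 addr0.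
by rewrite finite_setU.
Qed.

HB.instance Definition _ := GRing.isSubmodClosed.Build F (multi_index -> F^o)
  fin_supp fin_supp_submod.

Record tensor := Tensor {
  tval :> multi_index -> F^o;
  tvalP : tval \in fin_supp
}.

HB.instance Definition _ := [isSub of tensor for tval].
HB.instance Definition _ := [Choice of tensor by <:].
HB.instance Definition _ := [SubChoice_isSubLmodule of tensor by <:].

Lemma upd_same (I : multi_index) s l : upd I s l s = l.
Proof. by rewrite ffunE eqxx. Qed.

Lemma upd_other (I : multi_index) s s' l : s' != s -> upd I s l s' = I s'.
Proof. by rewrite ffunE => /negPf ->. Qed.

Lemma upd_upd (I : multi_index) s l k : upd (upd I s l) s k = upd I s k.
Proof. by apply/ffunP => s'; rewrite !ffunE; case: eqP. Qed.

Lemma upd_id (I : multi_index) s : upd I s (I s) = I.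
Proof. by apply/ffunP => s'; rewrite !ffunE; case: eqP => [->|]. Qed.

Lemma upd_comm (I : multi_index) (s r : slot) l k : s != r ->
  upd (upd I s l) r k = upd (upd I r k) s l.
Proof.
move=> sr; apply/ffunP => s'; rewrite !ffunE.
by case: (eqVneq s' r) => [->|//]; rewrite eq_sym (negPf sr).
Qed.

Lemma slot_mx_bounded n X s : bounded n X -> bounded n (slot_mx X s).
Proof.
move=> bX; case: s => s //= i j ij; rewrite /dualinf bX ?oppr0 //.
by rewrite orbC.
Qed.

Lemma vactE n X v i : bounded n X -> vact X v i = \sum_(k < n) X i k * v k.
Proof.
move=> bX; rewrite /vact (@sum_bounded n) // => k nk.
by rewrite bX ?nk ?orbT // mul0r.
Qed.

Lemma slot_actE n X s f I : bounded n X ->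
  slot_act X s f I = \sum_(l < n) slot_mx X s (I s) l * f (upd I s l).
Proof. by move=> bX; rewrite /slot_act (@vactE n) //; exact: slot_mx_bounded. Qed.

Lemma slot_act_sum n X s (T : finType) (f : T -> multi_index -> F) I :
  bounded n X ->
  slot_act X s (fun J => \sum_z f z J) I = \sum_z slot_act X s (f z) I.
Proof.
move=> bX; rewrite (slot_actE _ _ _ bX).
under [RHS]eq_bigr do rewrite (slot_actE _ _ _ bX).
rewrite exchange_big; apply: eq_bigr => l _; exact: mulr_sumr.
Qed.

Lemma slot_act_comm n X Y s r f I : bounded n X -> bounded n Y -> s != r ->
  slot_act X s (slot_act Y r f) I = slot_act Y r (slot_act X s f) I.
Proof.
move=> bX bY sr; rewrite !(@slot_actE n) //.
transitivity (\sum_(l < n) \sum_(k < n)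
    slot_mx X s (I s) l * (slot_mx Y r (I r) k * f (upd (upd I s l) r k))).
  apply: eq_bigr => l _; rewrite (@slot_actE n) // mulr_sumr.
  by apply: eq_bigr => k _; rewrite upd_other // eq_sym.
rewrite exchange_big; apply: eq_bigr => k _; rewrite (@slot_actE n) // mulr_sumr.
by apply: eq_bigr => l _; rewrite upd_other // mulrCA upd_comm.
Qed.

Lemma slot_act_mul n X Y s f I : bounded n X -> bounded n Y ->
  slot_act X s (slot_act Y s f) I =
  vact (mulinf (slot_mx X s) (slot_mx Y s)) (fun l => f (upd I s l)) (I s).
Proof.
move=> bX bY; have bXs := slot_mx_bounded s bX; have bYs := slot_mx_bounded s bY.
rewrite (@slot_actE n) // (@vactE n); last first.
  rewrite -(corner_mxE bXs) -(corner_mxE bYs) mulinf_corner.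
  exact: corner_bounded.
under eq_bigr do rewrite (@slot_actE n) // mulr_sumr.
rewrite exchange_big; apply: eq_bigr => k _ /=.
rewrite /mulinf (@sum_bounded n) => [|j nj]; last by rewrite bXs ?nj ?orbT // mul0r.
by rewrite mulr_suml; apply: eq_bigr => l _; rewrite upd_same upd_upd mulrA.
Qed.

Lemma slot_act_commutator n X Y s f I : bounded n X -> bounded n Y ->
  slot_act (commutator X Y) s f I =
  slot_act X s (slot_act Y s f) I - slot_act Y s (slot_act X s f) I.
Proof.
move=> bX bY; rewrite !(@slot_act_mul n) //.
have bXs := slot_mx_bounded s bX; have bYs := slot_mx_bounded s bY.
have bM Z W : bounded n Z -> bounded n W -> bounded n (mulinf Z W).
  move=> bZ bW; rewrite -(corner_mxE bZ) -(corner_mxE bW) mulinf_corner.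
  exact: corner_bounded.
have bC : bounded n (commutator X Y).
  by move=> i j ij; rewrite /commutator !bM // subr0.
rewrite (@slot_actE n) // !(@vactE n) -?sumrB; [|exact: bM..].
apply: eq_bigr => l _; rewrite -mulrBl; congr (_ * _).
case: s {bXs bYs} => s //=; rewrite /dualinf /commutator opprB /mulinf.
by congr (_ - _); apply: eq_fsbigr => k _; rewrite mulrNN mulrC.
Qed.

Lemma pure_tensor_basis (J I : multi_index) :
  pure_tensor (fun s i => (i == J s)%:R) I = (I == J)%:R.
Proof.
rewrite /pure_tensor; case: eqP => [->|IJ].
  by rewrite big1 // => s _; rewrite eqxx.
case: (pickP (fun s => I s != J s)) => [s /negPf IJs|eqIJ].
  by rewrite (bigD1 s) //= IJs mul0r.
by case: IJ; apply/ffunP => s; apply/eqP/negbFE/eqIJ.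
Qed.

Fact tens_act_supp n X (f : multi_index -> F^o) : bounded n X ->
  f \in fin_supp -> tens_act X f \in fin_supp.
Proof.
move=> bX /asboolP ff; apply/asboolP.
pose B (sa : slot * 'I_n) := (fun J => upd J sa.1 sa.2) @` [set I | f I <> 0].
apply: (@sub_finite_set _ _ (\bigcup_(sa in [set: slot * 'I_n]) B sa)).
  move=> I /= fI; apply: contrapT => nB; apply: fI; apply: big1 => s _.
  rewrite (@slot_actE n) //; apply: big1 => l _.
  case: (leqP n (I s)) => [nI|ltIn].
    by rewrite (slot_mx_bounded s bX) ?nI // mul0r.
  apply: contrapT => fI; apply: nB; exists (s, Ordinal ltIn) => //=.
  exists (upd I s l); last by rewrite upd_upd upd_id.
  by move=> /= f0; apply: fI; rewrite f0 mulr0.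
apply: bigcup_finite => [|sa _]; first exact: finite_finset.
exact: finite_image.
Qed.

Lemma tens_act_pure n X (u : slot -> nat -> F) : bounded n X ->
  tens_act X (pure_tensor u) = fun I => \sum_(s : slot)
    pure_tensor (fun s' => if s' == s then vact (slot_mx X s) (u s) else u s') I.
Proof.
move=> bX; apply/funext => I; apply: eq_bigr => s _.
rewrite (@slot_actE n) // /pure_tensor (bigD1 s) //= eqxx.
rewrite (@vactE n); last exact: slot_mx_bounded.
rewrite mulr_suml; apply: eq_bigr => l _; rewrite (bigD1 s) //= upd_same mulrA.
congr (_ * _); apply: eq_bigr => s' s's.
by rewrite upd_other // (negPf s's).
Qed.
End Tensor.

Lemma pairing_dualinf n X (phi v : nat -> F) : bounded n X ->
  \sum_(i < n) vact (dualinf X) phi i * v i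
    = - \sum_(i < n) phi i * vact X v i.
Proof.
move=> bX; have bX' : bounded n (dualinf X).
  by move=> i j ij; rewrite /dualinf bX ?oppr0 // orbC.
under eq_bigr do rewrite (@vactE n) // mulr_suml.
rewrite exchange_big -sumrN; apply: eq_bigr => j _ /=.
rewrite (@vactE n) // mulr_sumr -sumrN; apply: eq_bigr => i _.
by rewrite /dualinf mulNr mulNr mulrCA mulrA.
Qed.

Section TensorModule.
Variables (t : series) (p q : nat).

Notation tensor := (tensor p q).

Fact ginf_bounded (x y : ginf t) : exists n, bounded n x /\ bounded n y.
Proof.
have [n [A [B [_ _ -> ->]]]] := ginf_common x y; exists (mx_size t n).
by split; exact: corner_bounded.
Qed.

Fact tensor_act_subproof (x : ginf t) (f : tensor) :
  tens_act x (tval f) \in @fin_supp p q.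
Proof.
by have [n [bx _]] := ginf_bounded x x; apply: tens_act_supp bx (tvalP f).
Qed.

Definition tensor_act (x : ginf t) (f : tensor) : tensor :=
  Tensor (tensor_act_subproof x f).

Fact tensor_act_linearl f : linear (tensor_act^~ f).
Proof.
move=> a x y; apply: val_inj; apply/funext => I /=.
have [n [bx by_]] := ginf_bounded x y.
change (tens_act (gval (a *: x + y)) (tval f) I =
  a * tens_act x (tval f) I + tens_act y (tval f) I).
have bxy : bounded n (gval (a *: x + y)).
  move=> i j ij; change (a * x i j + y i j = 0).
  by rewrite bx // by_ // mulr0 addr0.
rewrite /tens_act mulr_sumr -big_split; apply: eq_bigr => s _ /=.
rewrite !(@slot_actE _ _ n) // mulr_sumr -big_split; apply: eq_bigr => l _ /=.
rewrite mulrA -mulrDl; congr (_ * _); case: s => s //=.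
by rewrite /dualinf mulrN -opprD.
Qed.

Fact tensor_act_linearr x : linear (tensor_act x).
Proof.
move=> a f g; apply: val_inj; apply/funext => I /=.
have [n [bx _]] := ginf_bounded x x.
change (tens_act x (tval (a *: f + g)) I =
  a * tens_act x (tval f) I + tens_act x (tval g) I).
rewrite /tens_act mulr_sumr -big_split; apply: eq_bigr => s _ /=.
rewrite !(@slot_actE _ _ n) // mulr_sumr -big_split; apply: eq_bigr => l _ /=.
by rewrite mulrCA -mulrDr.
Qed.

Fact tensor_act_bracket x y f : tensor_act (bracket x y) f =
  tensor_act x (tensor_act y f) - tensor_act y (tensor_act x f).
Proof.
apply: val_inj; apply/funext => I /=.
have [n [bx by_]] := ginf_bounded x y.
change (tens_act (commutator x y) (tval f) I =
  tens_act x (tens_act y (tval f)) I - tens_act y (tens_act x (tval f)) I).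
rewrite [in RHS]/tens_act.
under [X in X - _]eq_bigr do rewrite (@slot_act_sum _ _ n) //.
under [X in _ - X]eq_bigr do rewrite (@slot_act_sum _ _ n) //.
rewrite [X in _ - X]exchange_big -sumrB; apply: eq_bigr => s _ /=.
rewrite -sumrB (bigD1 s) //= big1 => [|s' s's].
  by rewrite addr0 (@slot_act_commutator _ _ n).
by rewrite (@slot_act_comm _ _ n) // ?subrr // eq_sym.
Qed.

HB.instance Definition _ := isLieModule.Build F (ginf t) tensor
  tensor_act_linearl tensor_act_linearr tensor_act_bracket.

End TensorModule.

Section AbsoluteWeight.
Variable t : series.
Implicit Types h : set (ginf t).

(* The field is meant to be algebraically closed: an element of the linear Lie
   algebra g_n is then semisimple when its matrix is diagonalizable. *)
Definition semisimple (x : ginf t) : Prop :=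
  exists n (A : 'M[F]_(mx_size t n)),
    [/\ in_fin t A, diagonalizable A & gval x = corner A].

Definition toral h := subalgebra h /\ forall x, h x -> semisimple x.

Definition maximal_toral h :=
  toral h /\ forall h', toral h' -> h `<=` h' -> h' = h.

Definition splitting_cartan h :=
  maximal_toral h /\ weight_module h (adjoint (ginf t)).

Definition absolute_weight (M : lieModType (ginf t)) :=
  forall h, splitting_cartan h -> weight_module h M.

Definition in_TT (M : lieModType (ginf t)) :=
  absolute_weight M /\ finite_length M.
End AbsoluteWeight.

Definition T_le (t : series) (r : nat) : lieModType (ginf t) :=
  match t with
  | SL => dsum (fun pq : {pq : 'I_r.+1 * 'I_r.+1 | (pq.1 + pq.2 <= r)%N} =>
                  tensor (val pq).1 (val pq).2)
  | _ => dsum (fun p : 'I_r.+1 => tensor p 0)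
  end.

End Finitary.

(* Main.v *)
(* Let [N] be an absolute weight module, [M] a submodule and [u : M -> T] with
   [T = V^(x)p (x) V_*^(x)q]. The elements [y_kl + y_lk] and [i (y_kl - y_lk)], where [y_kl] is
   the projection of the matrix unit [E_kl] to the Lie algebra, lie in splitting Cartan
   subalgebras, hence are diagonalizable on [N], with real eigenvalues by an sl(2) trace
   argument. Since a sum of squares of such operators vanishes only where they all do, the
   Casimir operator of each finite level splits off the invariants. Applied to [N (x) T'], with
   [T'] the tensors dual to [T], this extends the invariant functional defined by [u] from
   [M (x) T'] to [N (x) T'], that is, extends [u] to an equivariant map [psi] from [N] to
   arbitrary functions of multi-indices.
   The weights of [N] for Cartan subalgebras spread over all indices show that each [psi m] is
   annihilated by the [y_kl] for all large [k], [l], distinct and not paired by the form. Such a function is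
   the sum of its contractions at every index that is large, so it is finitely supported as
   soon as all its contractions vanish. Subtracting the contractions, one pair of slots after
   the other, is equivariant and leaves finitely supported functions unchanged: it turns [psi]
   into a map from [N] to [T] extending [u].
   For the finite length of [T], a vector of [W' \ W] can be moved, one slot at a time, into
   fresh indices until it becomes invariant under a large finite level; such an invariant is
   determined by a number of coordinates that depends only on [p + q]. *)
From HB Require Import structures.
From mathcomp Require Import all_boot all_order all_algebra.
From mathcomp Require Import boolp classical_sets functions cardinality fsbigop.
From mathcomp Require Import reals complex.
From mathcomp Require Import ring zify.
Require Import Defs.

Set Implicit Arguments.
Unset Strict Implicit.
Unset Printing Implicit Defensive.
Import Order.TTheory GRing.Theory Num.Theory.
Local Open Scope classical_set_scope.
Local Open Scope ring_scope.

(** * Linear spans and functionals *)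

(** Local finiteness comes from straightening words in diagonalizable operators. A [y_kl] is in
    general nilpotent, which is why its Hermitian combinations appear; the reality of their
    eigenvalues makes the traces of their squares nonnegative and plays the part of an invariant
    Hermitian form. The functional is extended by Zorn's lemma, so nothing controls the support of
    the resulting coordinates: the full dual of [T'] contains invariant functions of infinite
    support, such as the Kronecker delta on a vector slot and a covector slot. Contractions are
    designed to detect this part. One Cartan subalgebra only informs on the pairs of one involution
    of the indices; three involutions linking each cell to the next one, together with brackets,
    reach all pairs. For [sp] an index and its partner under the form go together, whence the
    bookkeeping by cells. *)

Section LinearSpan.
Variables (K : fieldType) (V : lmodType K).
Implicit Types (S P : set V) (u v : V).

Inductive lin_span S : V -> Prop :=
| lin_span0 : lin_span S 0
| lin_spanS a u v : S u -> lin_span S v -> lin_span S (a *: u + v).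

Definition subspace P := P 0 /\ forall a u v, P u -> P v -> P (a *: u + v).

Lemma lin_span_sub S u : S u -> lin_span S u.
Proof.
move=> Su; rewrite -[u]addr0 -[u]scale1r; apply: lin_spanS => //.
exact: lin_span0.
Qed.

Lemma lin_span_subspace S : subspace (lin_span S).
Proof.
split=> [|a u v]; first exact: lin_span0.
elim=> [|b w {}u Sw _ IH] Sv; first by rewrite scaler0 add0r.
by rewrite scalerDr scalerA -addrA; apply: lin_spanS => //; exact: IH.
Qed.

Lemma lin_span_min S P : subspace P -> S `<=` P -> lin_span S `<=` P.
Proof. by move=> [P0 PP] SP v; elim=> // a u w /SP Pu _; exact: PP. Qed.

Lemma lin_spanW S S' : S `<=` S' -> lin_span S `<=` lin_span S'.
Proof.
move=> SS; apply: lin_span_min; first exact: lin_span_subspace.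
by move=> u /SS; exact: lin_span_sub.
Qed.

Lemma subspaceD P u v : subspace P -> P u -> P v -> P (u + v).
Proof. by case=> _ PP Pu Pv; rewrite -[u]scale1r; exact: PP. Qed.

Lemma subspaceZ P a u : subspace P -> P u -> P (a *: u).
Proof. by case=> P0 PP Pu; rewrite -[a *: u]addr0; exact: PP. Qed.

Lemma subspaceN P u : subspace P -> P u -> P (- u).
Proof. by move=> sP Pu; rewrite -scaleN1r; exact: subspaceZ. Qed.

Lemma subspaceB P u v : subspace P -> P u -> P v -> P (u - v).
Proof. by move=> sP Pu Pv; apply: subspaceD => //; exact: subspaceN. Qed.

Lemma subspaceZr P a u : subspace P -> a != 0 -> P (a *: u) -> P u.
Proof.
by move=> sP a0 /(subspaceZ a^-1 sP); rewrite scalerA mulVf // scale1r.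
Qed.

Lemma subspace_sum P (I : Type) (r : seq I) (Q : pred I) (F : I -> V) :
  subspace P -> (forall i, Q i -> P (F i)) -> P (\sum_(i <- r | Q i) F i).
Proof.
by move=> sP PF; apply: big_ind => //; [case: sP | move=> *; exact: subspaceD].
Qed.

Lemma subspace_sum_seq P (I : eqType) (r : seq I) (F : I -> V) :
  subspace P -> (forall i, i \in r -> P (F i)) -> P (\sum_(i <- r) F i).
Proof.
move=> sP PF; rewrite big_seq; apply: subspace_sum => // i; exact: PF.
Qed.

(** Induction on [s]: the operator [op x - lam i0 x] kills the component of the head [i0] and
    multiplies the component [i] by [lam i x - lam i0 x], nonzero for an [x] separating [i] from
    [i0]. This [x] depends on [i], so the components of the tail are treated one by one; the head is
    what remains. *)
Lemma weight_components (H : Type) (I : eqType) (op : H -> V -> V)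
    (lam : I -> H -> K) P (s : seq I) (w : I -> V) :
  (forall x, linear (op x)) -> subspace P -> (forall x v, P v -> P (op x v)) ->
  (forall i j, i != j -> exists x, lam i x != lam j x) ->
  uniq s -> (forall i, i \in s -> forall x, op x (w i) = lam i x *: w i) ->
  P (\sum_(i <- s) w i) -> forall i, i \in s -> P (w i).
Proof.
move=> lin_op sP Pop sep; elim: s w => // i0 s IH w /= /andP[i0s us] wt Pw.
have op_sum x (F : I -> V) r : op x (\sum_(i <- r) F i) = \sum_(i <- r) op x (F i).
  elim: r => [|j r IHr]; last by rewrite !big_cons -IHr -[F j]scale1r lin_op !scale1r.
  rewrite !big_nil; have := lin_op x (-1) 0 0.
  by rewrite !scaleN1r oppr0 addr0 addNr.
have Ps i : i \in s -> P (w i).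
  move=> si; have i0i : i != i0 by apply: contraNneq i0s => <-.
  have [x xi] := sep _ _ i0i.
  pose w' j := (lam j x - lam i0 x) *: w j.
  apply: (@subspaceZr _ (lam i x - lam i0 x)) => //; first by rewrite subr_eq0.
  apply: (IH w') => // [j sj z|].
    rewrite /w' -[_ *: w j in LHS]addr0 lin_op.
    have -> : op z 0 = 0.
      have := lin_op z (-1) 0 0; by rewrite !scaleN1r oppr0 addr0 addNr.
    by rewrite addr0 wt ?inE ?sj ?orbT // !scalerA mulrC.
  have -> : \sum_(j <- s) w' j =
      op x (\sum_(j <- i0 :: s) w j) - lam i0 x *: \sum_(j <- i0 :: s) w j.
    rewrite op_sum scaler_sumr -sumrB big_cons wt ?inE ?eqxx // subrr add0r.
    apply: eq_big_seq => j sj.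
    by rewrite wt ?inE ?sj ?orbT // /w' scalerBl.
  by apply: subspaceB => //; [exact: Pop|exact: subspaceZ].
move=> i; rewrite inE => /predU1P[->|]; last exact: Ps.
rewrite big_cons in Pw; rewrite -[w i0](addrK (\sum_(j <- s) w j)).
by apply: subspaceB => //; exact: subspace_sum_seq.
Qed.

(** A substitute for a basis, through which operators preserving [P] become matrices acting on rows.
    By induction on [s]: if [P] is not inside the span of the tail, a vector [p] of [P] outside it
    splits [P] as the line of [p] plus the part of [P] inside that span. *)
Lemma subspace_coordinates (s : seq V) P :
  subspace P -> P `<=` lin_span [set` s] ->
  exists d (f : 'rV[K]_d -> V),
    [/\ linear f, injective f & forall v, P v <-> exists c, f c = v].
Proof.
elim: s P => [|x s IH] P sP Ps.
  exists 0%N, (fun=> 0); split=> [a u v|c c' _|v]; first by rewrite scaler0 addr0.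
    by rewrite [c]thinmx0 [c']thinmx0.
  split=> [/Ps|[_ <-]]; last by case: sP.
  by elim=> [|a u w] //; exists 0.
have spanx v : lin_span [set` x :: s] v ->
    exists a u, lin_span [set` s] u /\ v = a *: x + u.
  elim=> [|a u w /= xu _ [b [u' [su' ->]]]].
    by exists 0, 0; split; [exact: lin_span0|rewrite scale0r addr0].
  move: xu; rewrite inE => /predU1P[->|us].
    by exists (a + b), u'; rewrite scalerDl addrA.
  exists b, (a *: u + u'); split; last by rewrite addrCA.
  exact: lin_spanS.
have [Pss|] := pselect (P `<=` lin_span [set` s]); first exact: IH.
move=> /existsNP[p /not_implyP[Pp nsp]].
have [a [u [su pE]]] := spanx _ (Ps _ Pp).
have a0 : a != 0 by apply: contra_notN nsp => /eqP a0; rewrite pE a0 scale0r add0r.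
have sps := lin_span_subspace [set` s].
pose P' v := P v /\ lin_span [set` s] v.
have sP' : subspace P'.
  split; first by split; [case: sP|case: sps].
  by move=> b v w [? ?] [? ?]; split; [apply: (proj2 sP)|apply: (proj2 sps)].
have [d [f [lin_f inj_f Pf]]] := IH P' sP' (fun v => @proj2 _ _).
pose g (c : 'rV_(1 + d)) := lsubmx c 0 0 *: p + f (rsubmx c).
have P'f c : P' (f c) by apply/Pf; exists c.
exists (1 + d)%N, g; split=> [b c c'|c c' gc|v].
- rewrite /g !linearP lin_f /= !mxE scalerDl scalerA [b * _]mulrC.
  by rewrite -!addrA; congr (_ + _); rewrite addrCA.
- have fB : (lsubmx c 0 0 - lsubmx c' 0 0) *: p = f (rsubmx c') - f (rsubmx c).
    rewrite scalerBl; apply/eqP; rewrite subr_eq addrAC eq_sym subr_eq addrC.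
    by rewrite -/(g c) -/(g c') gc.
  have c00 : lsubmx c 0 0 = lsubmx c' 0 0.
    apply/eqP; rewrite -subr_eq0; apply: contra_notT nsp => c0.
    apply: (subspaceZr sps c0); rewrite fB.
    by apply: subspaceB => //; apply: (proj2 (P'f _)).
  move: fB; rewrite c00 subrr scale0r => /eqP; rewrite eq_sym subr_eq0 => /eqP.
  move/inj_f => cr; rewrite -[c]hsubmxK -[c']hsubmxK cr; congr row_mx.
  by apply/rowP => i; rewrite !ord1.
- split=> [Pv|[c <-]]; last first.
    by apply: (proj2 sP) => //; apply: (proj1 (P'f _)).
  have [b [w [sw vE]]] := spanx _ (Ps _ Pv).
  have : P' (v - (b / a) *: p).
    split; first by apply: subspaceB => //; exact: subspaceZ.
    rewrite vE pE scalerDr scalerA divfK // [b *: x + w]addrC opprD addrA addrK.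
    by apply: subspaceB => //; exact: subspaceZ.
  move/Pf => [c cE]; exists (row_mx (b / a)%:M c).
  by rewrite /g row_mxKl row_mxKr !mxE eqxx mulr1n cE addrC subrK.
Qed.

Definition linear_on P (g : V -> K) :=
  forall a u v, P u -> P v -> g (a *: u + v) = a * g u + g v.

Lemma extend_functional P (g : V -> K) : subspace P -> linear_on P g ->
  exists h : V -> K, linear_on setT h /\ forall v, P v -> h v = g v.
Proof.
move=> sP lin_g; pose G0 : set (V * K) := [set z | P z.1 /\ z.2 = g z.1].
pose good (G : set (V * K)) := (forall a z z', G z -> G z' ->
  G (a *: z.1 + z'.1, a * z.2 + z'.2)) /\ (forall z, G z -> z.1 = 0 -> z.2 = 0).
have g0 : g 0 = 0.
  have := lin_g (-1) 0 0 (proj1 sP) (proj1 sP).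
  by rewrite scaleN1r addr0 oppr0 mulN1r addNr.
have goodG0 : good G0.
  split=> [a z z' [Pz ->] [Pz' ->]|z [_ ->] -> //].
  by split=> /=; [exact: (proj2 sP)|rewrite lin_g].
(* [G0] is adjoined inside the predicate: the union of the empty chain is empty and could not be
   required to contain it. *)
pose Q (G : set (V * K)) := good (G `|` G0).
have [|A [QA Amax]] := @Zorn_bigcup _ Q.
  move=> F FQ Ftot.
  have up z z' : (\bigcup_(X in F) X `|` G0) z -> (\bigcup_(X in F) X `|` G0) z' ->
      (G0 z /\ G0 z') \/ exists2 X, F X & (X `|` G0) z /\ (X `|` G0) z'.
    move=> [[X FX Xz]|Gz] [[Y FY Yz']|Gz']; last by left.
    - right; have [XY|YX] := Ftot X Y FX FY.
        by exists Y => //; split; left => //; exact: XY.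
      by exists X => //; split; left => //; exact: YX.
    - by right; exists X => //; split; [left|right].
    - by right; exists Y => //; split; [right|left].
  split=> [a z z' zF z'F|z zF].
    have [[Gz Gz']|[X FX [Xz Xz']]] := up z z' zF z'F.
      by right; apply: (proj1 goodG0).
    have [+ _] := FQ X FX => /(_ a z z' Xz Xz')[Xzz|Gzz]; last by right.
    by left; exists X.
  have [[Gz _]|[X FX [Xz _]]] := up z z zF zF; first exact: (proj2 goodG0).
  exact: (proj2 (FQ X FX)).
set M := A `|` G0 in QA.
have [Mlin Mfun] := QA.
have M0 : M (0, 0) by right; split=> //=; case: sP.
have dom v : exists c, M (v, c).
  apply: contrapT => nv.
  (* A vector [v] outside the domain of [M] could be sent to [0], against maximality. *)
  pose M' : set (V * K) := [set z | exists a z', M z' /\ z = (a *: v + z'.1, z'.2)].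
  have MM' : M `<=` M' by move=> [u c] Mz; exists 0, (u, c); rewrite /= scale0r add0r.
  have vM' : M' (v, 0) by exists 1, (0, 0); rewrite /= scale1r addr0.
  apply: (Amax M'); first split.
  - by move=> z Az; apply: MM'; left.
  - by move=> M'A; apply: nv; exists 0; left; exact: M'A.
  - have -> : Q M' = good M'.
      by congr good; apply/seteqP; split=> [z [//|G0z]|z]; [apply: MM'; right|left].
    split=> [a _ _ [b [z [Mz ->]]] [b' [z' [Mz' ->]]] /=|_ [a [z [Mz ->]]] /= az0].
      exists (a * b + b'), (a *: z.1 + z'.1, a * z.2 + z'.2); split; first exact: Mlin.
      by congr pair; rewrite /= scalerDr scalerA scalerDl addrACA.
    have [a0|a0] := eqVneq a 0; first by apply: Mfun => //; rewrite -az0 a0 scale0r add0r.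
    exfalso; apply: nv; exists (- a^-1 * z.2).
    have := Mlin (- a^-1) z (0, 0) Mz M0; rewrite /= !addr0.
    suff -> : - a^-1 *: z.1 = v by [].
    move/eqP: az0; rewrite addrC addr_eq0 => /eqP ->.
    by rewrite scaleNr scalerN opprK scalerA mulVf // scale1r.
have [h hM] := choice dom.
have Muniq v c c' : M (v, c) -> M (v, c') -> c = c'.
  move=> Mc Mc'; have /= := Mfun _ (Mlin (-1) _ _ Mc Mc').
  by rewrite scaleN1r addNr mulN1r addrC => /(_ erefl)/eqP; rewrite subr_eq0 => /eqP.
exists h; split=> [a u v _ _|v Pv].
  by apply: (Muniq (a *: u + v)); [exact: hM|exact: (Mlin a _ _ (hM u) (hM v))].
by apply: (Muniq v); [exact: hM|right].
Qed.

End LinearSpan.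

Lemma lin_span_image (K : fieldType) (V W : lmodType K) (f : V -> W) S v :
  linear f -> lin_span S v -> lin_span (f @` S) (f v).
Proof.
move=> lin_f; elim=> [|a u w Su _ IH].
  have -> : f 0 = 0.
    by have := lin_f (-1) 0 0; rewrite !scaleN1r oppr0 addr0 addNr.
  exact: lin_span0.
by rewrite lin_f; apply: lin_spanS => //; exists u.
Qed.

Section Functionals.
Variables (K : fieldType) (V : lmodType K).
Implicit Types u v w : V.

Lemma linear_fun_rules (W : lmodType K) (g : V -> W) : linear g ->
  [/\ g 0 = 0, forall u v, g (u + v) = g u + g v, forall u, g (- u) = - g u
    & forall a u, g (a *: u) = a *: g u].
Proof.
move=> lg; have g0 : g 0 = 0 by have := lg (-1) 0 0; rewrite !scaleN1r oppr0 addr0 addNr.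
have gD u v : g (u + v) = g u + g v by rewrite -[u in LHS]scale1r lg scale1r.
have gZ a u : g (a *: u) = a *: g u by rewrite -[a *: u]addr0 lg g0 addr0.
by split=> // u; rewrite -scaleN1r gZ scaleN1r.
Qed.

Lemma functional_neq0 u : u != 0 -> exists g : V -> K, linear_on setT g /\ g u = 1.
Proof.
move=> u0; pose P v := exists a, v = a *: u.
have sP : subspace P.
  split=> [|a _ _ [b ->] [c ->]]; first by exists 0; rewrite scale0r.
  by exists (a * b + c); rewrite scalerDl scalerA.
pose g v := xget 0 [set a | v = a *: u].
have gE a : g (a *: u) = a.
  rewrite /g; case: xgetP => [b _ /= ab|/(_ a)]; last by case.
  have /eqP : (a - b) *: u = 0 by rewrite scalerBl ab subrr.
  by rewrite scaler_eq0 (negPf u0) orbF subr_eq0 => /eqP.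
have [|h [lh hE]] := @extend_functional _ _ P g sP.
  by move=> a _ _ [b ->] [c ->]; rewrite scalerA -scalerDl !gE.
by exists h; split=> //; rewrite hE; [rewrite -[u]scale1r gE|exists 1; rewrite scale1r].
Qed.

(* Turns an identity between vectors into one between scalars, for [ring]. *)
Lemma functional_eq u w : (forall g : V -> K,
    (forall v v', g (v + v') = g v + g v') -> (forall v, g (- v) = - g v) ->
    (forall a v, g (a *: v) = a * g v) -> g 0 = 0 -> g u = g w) -> u = w.
Proof.
move=> guw; apply/eqP; rewrite -subr_eq0; apply: contrapT => /negP/functional_neq0[g [lg]].
have lg' : linear (g : V -> K^o) by move=> a v v'; exact: lg.
have [g0 gD gN gZ] := linear_fun_rules lg'.
by rewrite gD gN (guw g) // subrr => /eqP; rewrite eq_sym oner_eq0.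
Qed.

End Functionals.

(** * Weight modules, submodules, finite length *)

Lemma fsbig_uniq_seq (V : zmodType) (I : choiceType) (D : set I) (s : seq I)
    (f : I -> V) : uniq s -> (forall i, i \in s -> D i) ->
  (forall i, i \notin s -> f i = 0) -> \sum_(i \in D) f i = \sum_(i <- s) f i.
Proof.
move=> us sD f0; rewrite (@fsbigE _ _ _ _ _ s) //; last by move=> i _ /f0.
by rewrite big_mkcond; apply: eq_big_seq => i /sD Di; rewrite mem_set.
Qed.

Section WeightModules.
Variables (K : fieldType) (L : lieAlgType K).
Implicit Types (h : set L) (M N : lieModType L).

Lemma lact0r M (x : L) : lact x (0 : M) = 0.
Proof.
by have := lact_linearr (s := M) x (-1) 0 0; rewrite !scaleN1r oppr0 addr0 addNr.
Qed.

Lemma lactD M (x : L) (u v : M) : lact x (u + v) = lact x u + lact x v.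
Proof. by have := lact_linearr x 1 u v; rewrite !scale1r. Qed.

Lemma lactZ M (x : L) a (u : M) : lact x (a *: u) = a *: lact x u.
Proof. by have := lact_linearr x a u 0; rewrite lact0r !addr0. Qed.

Lemma lactB M (x : L) (u v : M) : lact x (u - v) = lact x u - lact x v.
Proof. by rewrite -scaleN1r lactD lactZ scaleN1r. Qed.

Lemma lact_sum M (x : L) (I : Type) (r : seq I) (Q : pred I) (F : I -> M) :
  lact x (\sum_(i <- r | Q i) F i) = \sum_(i <- r | Q i) lact x (F i).
Proof.
by apply: (big_morph (lact x)); [move=> u v; exact: lactD|exact: lact0r].
Qed.

Lemma lact0l M (m : M) : lact (0 : L) m = 0.
Proof.
by have := lact_linearl (s := M) m (-1) 0 0; rewrite !scaleN1r oppr0 addr0 addNr.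
Qed.

Lemma lactDl M (x y : L) (m : M) : lact (x + y) m = lact x m + lact y m.
Proof. by have := lact_linearl m 1 x y; rewrite !scale1r. Qed.

Lemma lactZl M a (x : L) (m : M) : lact (a *: x) m = a *: lact x m.
Proof. by have := lact_linearl m a x 0; rewrite lact0l !addr0. Qed.

Lemma lactBl M (x y : L) (m : M) : lact (x - y) m = lact x m - lact y m.
Proof. by rewrite -scaleN1r lactDl lactZl scaleN1r. Qed.

Lemma lact_suml M (I : Type) (r : seq I) (Q : pred I) (F : I -> L) (m : M) :
  lact (\sum_(i <- r | Q i) F i) m = \sum_(i <- r | Q i) lact (F i) m.
Proof.
apply: (big_morph (fun x => lact x m)); last exact: lact0l.
by move=> x y; exact: lactDl.
Qed.

Definition is_weight_vector h M : set M :=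
  [set m | exists lam, weight_space h M lam m].

(* The linearity of the weight is automatic for a nonzero weight vector. *)
Lemma weight_dual h M lam (m : M) :
  m != 0 -> weight_space h M lam m -> dual_space h lam.
Proof.
move=> m0 wm a x y z zE.
have /eqP : (lam z - (a * lam x + lam y)) *: m = 0.
  by rewrite scalerBl scalerDl -scalerA -!wm zE lactDl lactZl subrr.
by rewrite scaler_eq0 (negPf m0) orbF subr_eq0 => /eqP.
Qed.

Definition weight_spanned h M := forall m : M, lin_span (is_weight_vector h (M:=M)) m.

Lemma fun_neq_sep (S : Type) (i j : S -> K) : i != j -> exists x, i x != j x.
Proof.
move=> ij; apply: contrapT => nx; case/eqP: ij; apply/funext => x.
by apply/eqP; apply: contrapT => /negP xij; apply: nx; exists x.
Qed.

Lemma weight_components_stable h M (P : set M) (s : seq (h -> K)) (w : (h -> K) -> M) :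
  subspace P -> (forall x v, h x -> P v -> P (lact x v)) ->
  uniq s -> (forall i, i \in s -> weight_space h M i (w i)) ->
  P (\sum_(i <- s) w i) -> forall i, i \in s -> P (w i).
Proof.
move=> sP Ph us ws Pw.
apply: (@weight_components _ _ h _ (fun x => lact (set_val x)) (fun i => i)) => //.
- by move=> x; exact: lact_linearr.
- by move=> x v; apply: Ph; exact: set_valP.
- by move=> i j; exact: fun_neq_sep.
Qed.

Lemma weight_spannedP h M (m : M) : lin_span (is_weight_vector h (M:=M)) m ->
  exists (s : seq (h -> K)) (f : (h -> K) -> M), [/\ uniq s,
    forall i, i \in s -> dual_space h i /\ weight_space h M i (f i)
    & m = \sum_(i <- s) f i].
Proof.
elim=> [|a u v [lam wu] _ [s [f [us sf ->]]]].
  by exists [::], (fun=> 0); rewrite big_nil.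
have [->|u0] := eqVneq u 0; first by exists s, f; rewrite scaler0 add0r.
have wau : weight_space h M lam (a *: u).
  by move=> x; rewrite lactZ wu !scalerA mulrC.
have dlam := weight_dual u0 wu.
pose g i := if i == lam then (if lam \in s then a *: u + f lam else a *: u) else f i.
have gw i : i \in lam :: s -> dual_space h i /\ weight_space h M i (g i).
  rewrite inE /g; case: eqVneq => [->|_ /sf//] _; split=> //.
  case: ifP => // ls; have [_ wf] := sf _ ls.
  by move=> x; rewrite lactD wau wf scalerDr.
have gl : g lam = if lam \in s then a *: u + f lam else a *: u by rewrite /g eqxx.
have [ls|ls] := boolP (lam \in s).
  exists s, g; split=> // [i si|]; first by apply: gw; rewrite inE si orbT.
  rewrite (big_rem lam) // [in RHS](big_rem lam) //= gl ls addrA.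
  congr (_ + _); apply: eq_big_seq => i; rewrite mem_rem_uniq // inE /g.
  by case: eqP.
exists (lam :: s), g; split=> //=; first by rewrite ls.
rewrite big_cons gl (negPf ls); congr (_ + _).
by apply: eq_big_seq => i si; rewrite /g; case: eqVneq si ls => // -> ->.
Qed.

(** Uniqueness in the direct sum is automatic: weight vectors for distinct weights are independent,
    by [weight_components_stable] with [P] the zero subspace. That the weights are linear comes from
    [weight_dual]. *)
Lemma weight_moduleP h M : weight_module h M <-> weight_spanned h M.
Proof.
split=> [wM m|wM m].
  have [f [[_ _ fw ->] _]] := wM m.
  apply: subspace_sum_seq => [|i]; first exact: lin_span_subspace.
  case: finite_supportP => // X XD _ _ /XD Di.
  by apply: lin_span_sub; exists i; exact: fw.
have [s [f [us sf ->]]] := weight_spannedP (wM m).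
pose g i := if i \in s then f i else 0.
exists g; split=> [|f' [finf' Df' wf' mE]].
  split=> [|i|i Di|].
  - apply: (@sub_finite_set _ _ [set` s]); last exact: finite_seq.
    by move=> i /=; rewrite /g; case: ifP.
  - by rewrite /g; case: ifP => // /sf[].
  - by rewrite /g; case: ifP => [/sf[]//|_ x]; rewrite lact0r scaler0.
  - rewrite (@fsbig_uniq_seq _ _ _ s) // => [|i /sf[]//|i si]; last first.
      by rewrite /g (negPf si).
    by apply: eq_big_seq => i si; rewrite /g si.
have /finite_seqP[s' s'E] := finf'.
pose r := undup (s ++ s').
have rD i : i \in r -> dual_space h i.
  rewrite mem_undup mem_cat => /orP[/sf[]//|is']; apply: Df'.
  by have : [set` s'] i by []; rewrite -s'E.
have f'0 i : i \notin r -> f' i = 0.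
  move=> ir; apply: contrapT => f'i; have : [set i | f' i <> 0] i by [].
  by rewrite s'E /= => is'; move: ir; rewrite mem_undup mem_cat is' orbT.
have g0 i : i \notin r -> g i = 0.
  by rewrite mem_undup mem_cat negb_or /g => /andP[/negPf ->].
have sumE : \sum_(i <- r) (g i - f' i) = 0.
  apply/eqP; rewrite sumrB subr_eq0; apply/eqP.
  move: mE; rewrite (@fsbig_uniq_seq _ _ _ r) ?undup_uniq // => <-.
  rewrite (bigID [pred i | i \in s]) /= [X in _ + X]big1 ?addr0 => [|i]; last first.
    by rewrite /g => /negPf ->.
  rewrite -big_filter [RHS](perm_big [seq i <- r | i \in s]).
    by apply: eq_big_seq => i; rewrite mem_filter /g => /andP[->].
  apply: uniq_perm; rewrite ?filter_uniq ?undup_uniq // => i.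
  by rewrite mem_filter mem_undup mem_cat; case: (i \in s).
have zero : forall i, i \in r -> g i - f' i = 0.
  apply: (@weight_components_stable h M [set 0]) => //=.
  - by split=> // a u v -> ->; rewrite scaler0 addr0.
  - by move=> x v _ ->; rewrite lact0r.
  - exact: undup_uniq.
  - move=> i ir x; rewrite lactB scalerBr; congr (_ - _); last by apply: wf' (rD _ ir) _.
    by rewrite /g; case: ifP => [/sf[_]|_]; [exact|rewrite lact0r scaler0].
apply/funext => i; have [/zero/eqP|ir] := boolP (i \in r).
  by rewrite subr_eq0 => /eqP.
by rewrite g0 // f'0.
Qed.

(** The image of [f] is stable under [h], so the weight components of [f a] lie in it and can be
    pulled back. *)
Lemma weight_spanned_sub h (A M : lieModType L) (f : A -> M) :
  linear f -> injective f -> (forall x m, f (lact x m) = lact x (f m)) ->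
  weight_spanned h M -> weight_spanned h A.
Proof.
move=> lin_f inj_f fP wM a.
have [s [w [us sw faE]]] := weight_spannedP (wM (f a)).
pose P m := exists b, f b = m.
have f0 : f 0 = 0 by have := lin_f (-1) 0 0; rewrite !scaleN1r oppr0 addr0 addNr.
have sP : subspace P.
  by split=> [|b _ _ [u <-] [v <-]]; [exists 0|exists (b *: u + v); exact: lin_f].
have Pw : forall i, i \in s -> P (w i).
  apply: (@weight_components_stable h M) => // [x _ _ [u <-]|i /sw[]//|].
  - by exists (lact x u).
  - by exists a.
pose g i := if pselect (P (w i)) is left e then projT1 (cid e) else 0.
have gE i : i \in s -> f (g i) = w i.
  by move=> /Pw; rewrite /g; case: pselect => // e _; exact: (projT2 (cid e)).
have -> : a = \sum_(i <- s) g i.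
  have fD : {morph f : u v / u + v}.
    by move=> u v; rewrite -[u]scale1r lin_f !scale1r.
  by apply: inj_f; rewrite faE (big_morph f fD f0); apply: eq_big_seq => i /gE ->.
apply: subspace_sum_seq => [|i si]; first exact: lin_span_subspace.
apply: lin_span_sub; exists i => x; apply: inj_f.
have [_ wi] := sw _ si; rewrite fP gE // wi.
have := lin_f (i x) (g i) 0; rewrite f0 !addr0 => ->; by rewrite gE.
Qed.

End WeightModules.

(** * Submodules as modules, and categorical monomorphisms *)

Section SubmoduleType.
Variables (K : fieldType) (L : lieAlgType K) (M : lieModType L) (W : set M).

Definition submod_pred (_ : submodule W) : {pred M} := fun m => `[< W m >].

Fact submod_pred_closed (sW : submodule W) : submod_closed (submod_pred sW).
Proof.
have [W0 WP _] := sW; split; first exact/asboolP.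
by move=> a u v /asboolP Wu /asboolP Wv; apply/asboolP/WP.
Qed.

HB.instance Definition _ (sW : submodule W) :=
  GRing.isSubmodClosed.Build K M (submod_pred sW) (submod_pred_closed sW).

Record submod_type (sW : submodule W) := SubmodType {
  submod_val :> M;
  submod_valP : submod_val \in submod_pred sW
}.

HB.instance Definition _ sW := [isSub of submod_type sW for @submod_val sW].
HB.instance Definition _ sW := [Choice of submod_type sW by <:].
HB.instance Definition _ sW := [SubChoice_isSubLmodule of submod_type sW by <:].

Variable sW : submodule W.

Fact submod_act_subproof (x : L) (m : submod_type sW) :
  lact x (submod_val m) \in submod_pred sW.
Proof.
by have /asboolP Wm := submod_valP m; have [_ _ Wx] := sW; apply/asboolP/Wx.
Qed.

Definition submod_act x m : submod_type sW := SubmodType (submod_act_subproof x m).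

Fact submod_act_linearl m : linear (submod_act^~ m).
Proof. by move=> a x y; apply: val_inj; exact: lact_linearl. Qed.
Fact submod_act_linearr x : linear (submod_act x).
Proof. by move=> a u v; apply: val_inj; exact: lact_linearr. Qed.
Fact submod_act_bracket x y m : submod_act (bracket x y) m =
  submod_act x (submod_act y m) - submod_act y (submod_act x m).
Proof. by apply: val_inj; exact: lact_bracket. Qed.

HB.instance Definition _ := isLieModule.Build K L (submod_type sW)
  submod_act_linearl submod_act_linearr submod_act_bracket.

Fact submod_val_linear : linear (@submod_val sW).
Proof. by []. Qed.

HB.instance Definition _ := GRing.isLinear.Build K (submod_type sW) M *:%R
  (@submod_val sW) submod_val_linear.

End SubmoduleType.

Section Monomorphisms.
Variables (K : fieldType) (L : lieAlgType K).

Lemma kernel_submodule (M N : lieModType L) (f : lie_hom M N) :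
  submodule [set m | f m = 0].
Proof.
split=> [|a u v /= fu fv|x u /= fu]; first exact: linear0.
  by rewrite linearP fu fv scaler0 addr0.
by rewrite lie_homP fu lact0r.
Qed.

(** The inclusion of the kernel and the zero map have the same composite with [f]. The kernel may
    serve as a test object because the hypothesis on [P] makes the category closed under
    submodules. *)
Lemma monomorphism_injective (P : lieModType L -> Prop) (M N : lieModType L)
    (f : lie_hom M N) :
  (forall W (sW : @submodule K L M W), P (submod_type sW)) ->
  monomorphism_in P f -> injective f.
Proof.
move=> Psub mono; pose sW := kernel_submodule f.
pose A := submod_type sW.
have valA (x : L) (m : A) : submod_val (lact x m) = lact x (submod_val m) by [].
have zeroA (x : L) (m : A) : (\0 : A -> M) (lact x m) = lact x ((\0 : A -> M) m).
  by rewrite /= lact0r.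
pose u := @LieHom _ _ A M (@submod_val K L M _ sW) valA.
pose v := @LieHom _ _ A M \0 zeroA.
move=> m m' fm.
have Wm : m - m' \in submod_pred sW by apply/asboolP; rewrite /= linearB fm subrr.
have := mono A u v (Psub _ _) _ (SubmodType Wm) => /= /(_ _)/eqP.
rewrite subr_eq0 => mm; apply/eqP; apply: mm => -[a /asboolP /= fa].
by rewrite fa linear0.
Qed.

End Monomorphisms.

(** * Finite length through rank functions on submodules *)

Section FiniteLength.
Variables (K : fieldType) (L : lieAlgType K).
Implicit Types M : lieModType L.

(** Any bounded, strictly increasing function on submodules does the work of the length: its
    existence is equivalent to [finite_length], by [finite_length_rank] and [finite_length_of_rank],
    which spares the Jordan-Hoelder theorem. *)
Definition length_function M n (rho : set M -> nat) :=
  (forall U, submodule U -> (rho U <= n)%N) /\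
  (forall U U', submodule U -> submodule U' -> U `<` U' -> (rho U < rho U')%N).

Lemma submodule_setT M : submodule (setT : set M).
Proof. by []. Qed.

Lemma submodule_set0 M : submodule [set (0 : M)].
Proof.
by split=> // [a u v -> ->|x u ->]; rewrite ?scaler0 ?addr0 ?lact0r.
Qed.

Lemma submodule_sub M (U : set M) : submodule U -> subspace U.
Proof. by case. Qed.

(** [rho U] counts the steps of the composition series in which [U] has something new. If [U] lies
    in [U'] and both have the same steps, then by induction on [i] the part of [U'] in [W i] lies in
    [U]: the simple quotient at a step is already filled by [U]. *)
Lemma finite_length_rank M : finite_length M -> exists n rho, @length_function M n rho.
Proof.
move=> [n [W [W0 Wn sW Wstep]]].
pose hits (U : set M) (i : 'I_n) := `[< exists2 m, (U `&` W i.+1) m & ~ W i m >].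
exists n, (fun U => #|[pred i | hits U i]|); split=> [U _|U U' sU sU' [UU' nU'U]].
  by rewrite -[leqRHS]card_ord max_card.
have sub : [pred i | hits U i] \subset [pred i | hits U' i].
  apply/fintype.subsetP => i hi; have /asboolP[m [Um Wm] nWm] : hits U i := hi.
  by apply/asboolP; exists m => //; split=> //; exact: UU'.
rewrite fintype.proper_card // fintype.properE sub /=; apply: contra_notN nU'U => /fintype.subsetP sub'.
have inW i : (i <= n)%N -> U' `&` W i `<=` U.
  elim: i => [_ m [_]|i IH lein m [U'm Wm]]; first by rewrite W0 => ->; case: sU.
  have [Wim|nWim] := pselect (W i m); first by apply: IH; rewrite 1?ltnW.
  have hm : hits U' (Ordinal lein) by apply/asboolP; exists m.
  have /asboolP[u [Uu Wu] nWu] : hits U (Ordinal lein) := sub' _ hm.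
  have [_ simple] := Wstep _ lein.
  have sWi := sW _ (ltnW lein).
  (* The sum of [W i] and of the part of [U] in [W i.+1]; it is strictly larger than [W i], hence
     all of [W i.+1]. *)
  pose X := [set m | exists a b, [/\ W i a, U b, W i.+1 b & m = a + b]].
  have sX : submodule X.
    split=> [|c _ _ [a [b [Wa Ub Wb ->]]] [a' [b' [Wa' Ub' Wb' ->]]]
             |x _ [a [b [Wa Ub Wb ->]]]].
    - exists 0, 0; rewrite addr0; split=> //; first by case: sWi.
        by case: sU.
      by case: (sW _ lein).
    - exists (c *: a + a'), (c *: b + b'); split.
      + by case: sWi => _ + _; apply.
      + by case: sU => _ + _; apply.
      + by case: (sW _ lein) => _ + _; apply.
      + by rewrite scalerDr addrACA.
    - exists (lact x a), (lact x b); split.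
      + by case: sWi => _ _; apply.
      + by case: sU => _ _; apply.
      + by case: (sW _ lein) => _ _; apply.
      + exact: lactD.
  have WX : W i `<=` X.
    move=> a Wa; exists a, 0; rewrite addr0; split=> //; first by case: sU.
    by case: (sW _ lein).
  have XW : X `<=` W i.+1.
    move=> _ [a [b [Wa Ub Wb ->]]]; apply: subspaceD => //.
      exact: submodule_sub (sW _ lein).
    by have [[+ _] _] := Wstep _ lein; apply.
  have [XE|XE] := simple X sX WX XW.
    exfalso; apply: nWu; rewrite -XE; exists 0, u; rewrite add0r; split=> //.
    by case: sWi.
  have : X m by rewrite XE.
  move=> [a [b [Wa Ub Wb mE]]]; rewrite mE; apply: subspaceD => //.
    exact: submodule_sub.
  apply: (IH (ltnW lein)); split=> //.
  have -> : a = m - b by rewrite mE addrK.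
  by apply: subspaceB (UU' _ Ub) => //; exact: submodule_sub.
by move=> m U'm; apply: (inW n) => //; split=> //; rewrite Wn.
Qed.

(** Among the submodules strictly above [X], one with the least [rho] leaves no room in between; a
    chain built by such choices cannot be refined, and it ends because [rho] is bounded. *)
Lemma finite_length_of_rank M n rho : @length_function M n rho -> finite_length M.
Proof.
move=> [rho_le rho_lt].
suff chain d (X : set M) : submodule X -> (n - rho X <= d)%N ->
    exists (k : nat) (W : nat -> set M), [/\ W 0%N = X, W k = setT,
      forall i, (i <= k)%N -> submodule (W i)
      & forall i, (i < k)%N -> W i `<` W i.+1 /\
        forall U, submodule U -> W i `<=` U -> U `<=` W i.+1 -> U = W i \/ U = W i.+1].
  exact: (chain _ _ (submodule_set0 M) (leqnn _)).
elim: d X => [|d IH] X sX Xd.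
all: have [->|XT] := pselect (X = setT).
1,3: by exists 0%N, (fun=> setT); split=> // i _; exact: submodule_setT.
all: have XTp : X `<` setT by split=> // TX; apply: XT; exact/seteqP.
  by move: Xd; rewrite leqn0 subn_eq0 leqNgt (leq_trans (rho_lt _ _ _ _ XTp)) ?rho_le.
have exm : exists m, `[< exists U, [/\ submodule U, X `<` U & rho U = m] >].
  by exists (rho setT); apply/asboolP; exists setT.
case: (ex_minnP exm) => m /asboolP[U [sU XU rU]] minU.
have [|k [W [W0 Wk sW Wstep]]] := IH U sU.
  by have := rho_lt _ _ sX sU XU; have := rho_le _ sU; lia.
exists k.+1, (fun i => if i is j.+1 then W j else X); split=> //.
  by case=> [|i] ik; [exact: sX|exact: sW].
case=> [|i] ik; last exact: Wstep.
rewrite W0; split=> // Y sY XY YU.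
have [YX|YX] := pselect (Y `<=` X); first by left; exact/seteqP.
right; apply/seteqP; split=> //; apply: contrapT => UY.
have := minU (rho Y); rewrite -rU leqNgt => /(_ _)/negP; apply.
  by apply/asboolP; exists Y.
exact: rho_lt.
Qed.

Lemma finite_length_sub (A M : lieModType L) (f : A -> M) :
  linear f -> injective f -> (forall x m, f (lact x m) = lact x (f m)) ->
  finite_length M -> finite_length A.
Proof.
move=> lin_f inj_f fP /finite_length_rank[n [rho [rho_le rho_lt]]].
have f0 : f 0 = 0 by have := lin_f (-1) 0 0; rewrite !scaleN1r oppr0 addr0 addNr.
have sf U : submodule U -> submodule (f @` U).
  move=> [U0 UP Ux]; split=> [|a _ _ [u Uu <-] [v Uv <-]|x _ [u Uu <-]].
  - by exists 0.
  - by exists (a *: u + v); [exact: UP|exact: lin_f].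
  - by exists (lact x u); [exact: Ux|exact: fP].
apply: (@finite_length_of_rank _ n (fun U => rho (f @` U))); split=> [U sU|U U' sU sU'].
  exact/rho_le/sf.
move=> [UU' nUU']; apply: rho_lt; [exact: sf|exact: sf|split].
  by move=> _ [u Uu <-]; exists u => //; exact: UU'.
by move=> sub; apply: nUU' => u U'u; have [|v Uv /inj_f <-] := sub (f u); first by exists u.
Qed.

(** With the factors ordered by [enum_rank], [sec U i] is the module of leading coefficients at [i].
    If [U] lies in [U'] and all their [sec] agree, an element of [U'] is reduced to [0] modulo [U],
    one leading coefficient after the other; so the sum of the ranks of the [sec] is strictly
    increasing. *)
Lemma finite_length_dsum (I : finType) (M : I -> lieModType L) :
  (forall i, finite_length (M i)) -> finite_length (dsum M).
Proof.
move=> finM; have ex_rho i := finite_length_rank (finM i).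
pose n i := projT1 (cid (ex_rho i)); pose ex_n i := cid (projT2 (cid (ex_rho i))).
pose rho i := projT1 (ex_n i).
have rhoP i : @length_function (M i) (n i) (rho i) := projT2 (ex_n i).
pose sec (U : set (dsum M)) i : set (M i) := [set m | exists u : dsum M,
  [/\ U u, u i = m & forall j, (enum_rank j < enum_rank i)%N -> u j = 0]].
have ssec U i : submodule U -> submodule (sec U i).
  move=> [U0 UP Ux]; split=> [|a _ _ [u [Uu <- u0]] [v [Uv <- v0]]|x _ [u [Uu <- u0]]].
  - by exists 0.
  - exists (a *: u + v); split=> // [|j ji]; first exact: UP.
    by change (a *: u j + v j = 0); rewrite u0 // v0 // scaler0 addr0.
  - exists (lact x u); split=> // [|j ji]; first exact: Ux.
    by change (lact x (u j) = 0); rewrite u0 // lact0r.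
apply: (@finite_length_of_rank _ (\sum_i n i) (fun U => \sum_i rho i (sec U i))%N).
split=> [U sU|U U' sU sU' [UU' nUU']].
  by apply: leq_sum => i _; apply: (proj1 (rhoP i)); exact: ssec.
have secS i : sec U i `<=` sec U' i.
  by move=> _ [u [Uu <- u0]]; exists u; split=> //; exact: UU'.
have rle i : (rho i (sec U i) <= rho i (sec U' i))%N.
  have [e|ne] := pselect (sec U' i `<=` sec U i).
    by have -> : sec U i = sec U' i by exact/seteqP.
  by apply/ltnW/(proj2 (rhoP i)); [exact: ssec|exact: ssec|split].
have [i neq] : exists i, ~ (sec U' i `<=` sec U i).
  apply: contrapT => /forallNP alleq; apply: nUU'.
  suff down k (u' : dsum M) : (k <= #|I|)%N -> U' u' ->
      (forall j, (enum_rank j < #|I| - k)%N -> u' j = 0) -> U u'.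
    by move=> u' U'u'; apply: (down #|I|) => // j; rewrite subnn.
  elim: k u' => [|k IH] u' kI U'u' u'0.
    have -> : u' = 0.
      by apply: functional_extensionality_dep => j; apply: u'0; rewrite subn0.
    by case: sU.
  have rk : (#|I| - k.+1 < #|I|)%N by rewrite ltn_subrL /= (leq_trans _ kI).
  pose j0 := enum_val (Ordinal rk).
  have rj0 : enum_rank j0 = Ordinal rk by rewrite /j0 enum_valK.
  have [u [Uu uj0 u0]] : sec U j0 (u' j0).
    apply: (contrapT (alleq j0)); exists u'; split=> // j; rewrite rj0 => ji.
    exact: u'0.
  have sU1 := submodule_sub sU; have sU1' := submodule_sub sU'.
  rewrite -(subrK u u'); apply: subspaceD => //; apply: IH; first exact: ltnW.
    by apply: subspaceB => //; exact: UU'.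
  move=> j jk; change (u' j - u j = 0).
  have : (enum_rank j <= #|I| - k.+1)%N by move: jk kI; lia.
  rewrite leq_eqVlt => /orP[jE|jlt].
    have -> : j = j0; last by rewrite uj0 subrr.
    by apply: enum_rank_inj; apply: val_inj; rewrite rj0 /=; apply/eqP.
  by rewrite u'0 // u0 ?subrr // rj0.
rewrite (bigD1 i) //= [ltnRHS](bigD1 i) //= -addSn leq_add //.
  by apply: (proj2 (rhoP i)); [exact: ssec|exact: ssec|split].
by apply: leq_sum => j _; exact: rle.
Qed.

End FiniteLength.

(** * Generators of the Lie algebra *)

Section Generators.
Variable F : fieldType.
Local Notation form := (form F).
Implicit Types (t : series) (X Y : nat -> nat -> F) (i j k l m n z : nat).

(* [dl t j] is the index paired with [j] by the form; a cell is an orbit of [dl t]. *)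
Definition dl t j : nat :=
  if t is SP then (if odd j then j.-1 else j.+1) else j.

Definition cell t j : nat := if t is SP then j./2 else j.

Definition sg t j : F := form t j (dl t j).

Lemma dlK t : involutive (dl t).
Proof.
case: t => // j /=; case oj: (odd j); first by rewrite (_ : odd j.-1 = false); lia.
by rewrite (_ : odd j.+1 = true); lia.
Qed.

Lemma cell_dl t j : cell t (dl t j) = cell t j.
Proof. by case: t => //=; case: ifP => oj; lia. Qed.

Lemma cell_eq t i j : cell t i = cell t j -> i = j \/ i = dl t j.
Proof. by case: t => /=; [left|left|left|case: ifP]; lia. Qed.

Lemma eq_dl t i j : (i == dl t j) = (j == dl t i).
Proof. by apply/eqP/eqP => ->; rewrite dlK. Qed.

Lemma formE t i j : form t i j = (j == dl t i)%:R * sg t i.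
Proof.
rewrite /sg; case: t => /=; rewrite ?eqxx ?mulr1 1?eq_sym //.
case oi: (odd i) => /=.
  have -> : (i == i.-1.+1) by lia.
  have -> : (i == j.+1) = (j == i.-1) by lia.
  by case: eqP; rewrite ?mul1r ?mul0r.
by rewrite eqxx mulr1 eq_sym; case: eqP.
Qed.

Lemma sg_sqr t i : sg t i * sg t i = 1.
Proof.
rewrite /sg; case: t => /=; rewrite ?eqxx ?mulr1 //.
case oi: (odd i) => /=; last by rewrite eqxx mulr1.
by rewrite (_ : (i == i.-1.+1) = true) ?mulrNN ?mulr1 //; lia.
Qed.

Lemma sg_neq0 t i : sg t i != 0.
Proof. by apply/eqP => s0; have := sg_sqr t i; rewrite s0 mul0r => /eqP; rewrite eq_sym oner_eq0. Qed.

Definition form_sign t : F := if t is SP then -1 else 1.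

Lemma form_sign_sqr t : form_sign t * form_sign t = 1.
Proof. by case: t; rewrite /= ?mulr1 // mulrNN mulr1. Qed.

Lemma sg_dl t i : sg t (dl t i) = form_sign t * sg t i.
Proof.
rewrite /sg dlK; case: t => /=; rewrite ?eqxx ?mulr1 //.
case oi: (odd i) => /=.
  have -> : odd i.-1 = false by lia.
  have -> : (i == i.-1.+1) by lia.
  by rewrite mulN1r opprK.
by rewrite oi eqxx /= mulr1.
Qed.

Lemma fsum_single (f : nat -> F) a :
  (forall k, k != a -> f k = 0) -> \sum_(k \in [set: nat]) f k = f a.
Proof.
move=> f0; rewrite (@fsbig_uniq_seq _ _ _ [:: a]) // => [|i]; first by rewrite big_seq1.
by rewrite inE; exact: f0.
Qed.

Lemma preserves_form t X : t <> SL ->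
  (forall i j, \sum_(k \in [set: nat]) X k i * form t k j
      + \sum_(k \in [set: nat]) form t i k * X k j = 0) <->
  (forall i j, X (dl t j) i * sg t (dl t j) + sg t i * X (dl t i) j = 0).
Proof.
move=> tSL.
have E i j : \sum_(k \in [set: nat]) X k i * form t k j
      + \sum_(k \in [set: nat]) form t i k * X k j =
    X (dl t j) i * sg t (dl t j) + sg t i * X (dl t i) j.
  congr (_ + _).
    rewrite (@fsum_single _ (dl t j)); first by rewrite formE dlK eqxx mul1r.
    by move=> k kj; rewrite formE eq_dl (negPf kj) mul0r mulr0.
  rewrite (@fsum_single _ (dl t i)); first by rewrite formE eqxx mul1r.
  by move=> k ki; rewrite formE (negPf ki) !mul0r.
by split=> H i j; have := H i j; rewrite E.
Qed.

Lemma in_inf_SLP n X : bounded n X -> \sum_(i < n) X i i = 0 -> in_inf SL X.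
Proof.
move=> bX trX; exists n, (\matrix_(i < n, j < n) X i j); split; last first.
  by rewrite (corner_mxE bX).
by apply/eqP; rewrite -[RHS]trX; apply: eq_bigr => i _; rewrite mxE.
Qed.

Lemma in_inf_formP t n X : t <> SL -> bounded n X ->
  (forall i j, X (dl t j) i * sg t (dl t j) + sg t i * X (dl t i) j = 0) ->
  in_inf t X.
Proof.
move=> tSL bX presX; have nN : (n <= mx_size t n)%N by case: (t) => //=; lia.
have bX' := boundedW nN bX.
exists n, (\matrix_(i < _, j < _) X i j); split; last by rewrite (corner_mxE bX').
by apply/(in_fin_preserves _ tSL); rewrite (corner_mxE bX'); apply/preserves_form.
Qed.

Lemma ginf_form t (x : ginf F t) i j : t <> SL ->
  gval x (dl t j) i * sg t (dl t j) + sg t i * gval x (dl t i) j = 0.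
Proof.
move=> tSL; have /asboolP[n [A [Ain ->]]] := gvalP x.
by apply: (proj1 (preserves_form _ tSL)); apply/in_fin_preserves.
Qed.

Lemma ginf_trace (x : ginf F SL) N : bounded N (gval x) -> \sum_(i < N) gval x i i = 0.
Proof.
move=> bN; have /asboolP[n [A [/eqP trA xA]]] := gvalP x.
rewrite -(@sum_bounded _ N (fun i => gval x i i)) => [|k Nk]; last by rewrite bN ?Nk.
rewrite (@sum_bounded _ n) => [|k nk]; last by rewrite xA corner_bounded ?nk.
by rewrite -[RHS]trA; apply: eq_bigr => i _; rewrite xA cornerE.
Qed.

(* The matrix unit [E_kl] corrected, by [E_zz] for a spare index [z] or by its transpose for
   the form, so as to lie in the Lie algebra. *)
Definition gy_fun t z k l : nat -> nat -> F := fun i j =>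
  ((i == k) && (j == l))%:R -
  (if t is SL then ((k == l) && ((i == z) && (j == z)))%:R
   else form t l i * form t k j).

(** The number of indices in the first [n] cells: a cut there never separates an index from its
    partner. *)
Definition cell_bound t n : nat := if t is SP then n.*2 else n.

(** For [SL] the correction restores trace zero; for a form, the corrected matrix is [E_kl] minus
    its adjoint, hence skew. *)
Lemma gy_subproof t z k l : gy_fun t z k l \in @in_infb F t.
Proof.
apply/asboolP; have [tSL|tSL] := pselect (t = SL).
  rewrite /gy_fun tSL; apply: (@in_inf_SLP (maxn z (maxn k l)).+1) => [i j|].
    move=> ij; rewrite [(i == k) && _](_ : _ = false); last by lia.
    by rewrite [(i == z) && _](_ : _ = false) ?andbF ?subr0 //; lia.
  set N := (maxn z (maxn k l)).+1.
  have zN : (z < N)%N by lia.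
  have kN : (k < N)%N by lia.
  rewrite sumrB (bigD1 (Ordinal kN)) //= big1 ?addr0 => [|i ik]; last first.
    by have -> : (i == k :> nat) = false by apply: contraNF ik => /eqP ik; apply/eqP/val_inj.
  rewrite eqxx (bigD1 (Ordinal zN)) //= big1 ?addr0 => [|i iz]; last first.
    have -> : (i == z :> nat) = false by apply: contraNF iz => /eqP iz; apply/eqP/val_inj.
    by rewrite /= andbF.
  by rewrite ?eqxx /= ?andbT subrr.
have dlb i j : i = dl t j -> (i <= j.+1)%N by move=> ->; case: (t) => //=; case: ifP; lia.
have -> : gy_fun t z k l = fun i j =>
    ((i == k) && (j == l))%:R - form t l i * form t k j.
  by rewrite /gy_fun; case: (t) tSL.
apply: (@in_inf_formP _ (maxn k l).+2) => // [i j ij|i j].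
  rewrite [(i == k) && _](_ : _ = false); last by lia.
  rewrite !formE; case: eqP => [/dlb il|_]; last by rewrite !mul0r subr0.
  case: eqP => [/dlb jk|_]; last by rewrite mul0r mulr0 subr0.
  by lia.
(* The two products of deltas in the skewness identity; each occurs twice, with opposite signs. *)
pose A : F := (i == l)%:R * (j == dl t k)%:R.
pose B : F := (i == dl t k)%:R * (j == l)%:R.
have sub (u v : nat) (f : nat -> F) : (u == v)%:R * f u = (u == v)%:R * f v.
  by case: eqP => [->//|_]; rewrite !mul0r.
have mulnb (b c : bool) : (b && c)%:R = b%:R * c%:R :> F by rewrite -mulnb natrM.
have ldl u v : (dl t u == v) = (u == dl t v) by rewrite eq_sym eq_dl.
have dd u v : (dl t u == dl t v) = (u == v) by rewrite ldl dlK.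
rewrite !mulnb !formE !dd !ldl.
have -> : ((j == dl t k)%:R * (i == l)%:R -
    (j == l)%:R * sg t l * ((i == dl t k)%:R * sg t k)) * sg t (dl t j) =
    A * sg t k - B * (form_sign t * sg t k).
  rewrite mulrBl; congr (_ - _).
    by rewrite mulrAC (sub j (dl t k) (fun u => sg t (dl t u))) dlK /A; ring.
  have -> : (j == l)%:R * sg t l * ((i == dl t k)%:R * sg t k) * sg t (dl t j) =
     sg t l * ((i == dl t k)%:R * sg t k) * ((j == l)%:R * sg t (dl t j)) by ring.
  rewrite (sub j l (fun u => sg t (dl t u))) sg_dl /B -[RHS]mul1r -(sg_sqr t l); ring.
have -> : sg t i * ((i == dl t k)%:R * (j == l)%:R -
    (i == l)%:R * sg t l * ((j == dl t k)%:R * sg t k)) =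
    B * (form_sign t * sg t k) - A * sg t k.
  rewrite mulrBr; congr (_ - _).
    by rewrite mulrCA mulrA (sub i (dl t k) (sg t)) sg_dl /B; ring.
  have -> : sg t i * ((i == l)%:R * sg t l * ((j == dl t k)%:R * sg t k)) =
     sg t l * ((j == dl t k)%:R * sg t k) * ((i == l)%:R * sg t i) by ring.
  by rewrite (sub i l (sg t)) /A -[RHS]mul1r -(sg_sqr t l); ring.
by rewrite addrA subrK subrr.
Qed.

End Generators.

(** * Brackets of the generators *)

Section Brackets.
Variable F : fieldType.
Local Notation form := (form F).
Local Notation sg := (@sg F).
Implicit Types (t : series) (X Y : nat -> nat -> F) (i j k l m n z : nat).

Definition gy t z k l : ginf F t := Ginf (gy_subproof F t z k l).

(* [gval] has values in [F^o], which hinders the inference of scalar actions. *)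
Definition gc t (x : ginf F t) : nat -> nat -> F := gval x.

Lemma ginf_ext t (x y : ginf F t) : (forall i j, gc x i j = gc y i j) -> x = y.
Proof. by move=> xy; apply: val_inj; apply/funext => i; apply/funext => j; exact: xy. Qed.

Lemma gc_lin t a (x y : ginf F t) i j :
  gc (a *: x + y) i j = a * gc x i j + gc y i j.
Proof. by []. Qed.

Lemma gcB t (x y : ginf F t) i j : gc (x - y) i j = gc x i j - gc y i j.
Proof. by []. Qed.

Lemma gcZ t a (x : ginf F t) i j : gc (a *: x) i j = a * gc x i j.
Proof. by []. Qed.

Lemma gc_sum t (I : Type) (r : seq I) (f : I -> ginf F t) i j :
  gc (\sum_(s <- r) f s) i j = \sum_(s <- r) gc (f s) i j.
Proof. by elim: r => [|s r IH]; rewrite ?big_nil // !big_cons -IH. Qed.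

Lemma gc_bracket t (x y : ginf F t) i j :
  gc (bracket x y) i j = mulinf (gc x) (gc y) i j - mulinf (gc y) (gc x) i j.
Proof. by []. Qed.

Lemma ginf_boundedE t (x : ginf F t) : exists n, bounded n (gc x).
Proof. by have [n [bx _]] := ginf_bounded x x; exists n. Qed.

Lemma mulinfE n X Y i j : (forall k, (n <= k)%N -> X i k * Y k j = 0) ->
  mulinf X Y i j = \sum_(k < n) X i k * Y k j.
Proof. by move=> b0; rewrite /mulinf (@sum_bounded _ n). Qed.

Lemma ord_single n (V : nmodType) (f : nat -> V) a :
  (forall k, (k < n)%N -> k != a -> f k = 0) -> ((n <= a)%N -> f a = 0) ->
  \sum_(k < n) f k = f a.
Proof.
move=> f0 fa; case: (ltnP a n) => [lan|nla].
  rewrite (bigD1 (Ordinal lan)) //= big1 ?addr0 // => k kna; apply: f0 => //.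
rewrite big1 ?fa // => k _; apply: f0 => //.
by apply: contraTneq nla => <-; rewrite -ltnNge.
Qed.

Lemma formD t i : form t i (dl t i) = sg t i.
Proof. by []. Qed.

Lemma form_neq t i j : j != dl t i -> form t i j = 0.
Proof. by move=> ij; rewrite formE (negPf ij) mul0r. Qed.

Lemma dl_neq t i j : i != dl t j -> j != dl t i.
Proof. by rewrite eq_dl. Qed.

Lemma mulinf_gyr t X z k l i j n : bounded n X -> mulinf X (gy_fun F t z k l) i j =
  X i k * (j == l)%:R -
  (if t is SL then (k == l)%:R * X i z * (j == z)%:R
   else X i (dl t l) * sg t l * form t k j).
Proof.
move=> bX; rewrite (@mulinfE n) => [|m nm]; last by rewrite bX ?nm ?orbT // mul0r.
under eq_bigr do rewrite /gy_fun mulrBr.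
rewrite sumrB; congr (_ - _).
  rewrite (@ord_single _ _ (fun m => X i m * ((m == k) && (j == l))%:R) k).
  - by rewrite eqxx.
  - by move=> m _ /negPf ->; rewrite mulr0.
  - by move=> nk; rewrite bX ?nk ?orbT // mul0r.
case: (t) => /=.
- rewrite (@ord_single _ _ (fun m => X i m * ((k == l) && ((m == z) && (j == z)))%:R) z).
  + by rewrite eqxx /= -mulnb natrM; ring.
  + by move=> m _ /negPf ->; rewrite andbF mulr0.
  + by move=> nk; rewrite bX ?nk ?orbT // mul0r.
all: have aux t' : \sum_(m < n) X i m * (form t' l m * form t' k j) =
   X i (dl t' l) * sg t' l * form t' k j.
1,3,5: rewrite (@ord_single _ _ (fun m => X i m * (form t' l m * form t' k j)) (dl t' l)).
1,4,7: by rewrite formD mulrA.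
1,3,5: by move=> m _ ml; rewrite form_neq // mul0r mulr0.
1,2,3: by move=> nk; rewrite bX ?nk ?orbT // mul0r.
- exact: (aux Oeven).
- exact: (aux Oodd).
- exact: (aux SP).
Qed.

Lemma mulinf_gyl t X z k l i j n : bounded n X -> mulinf (gy_fun F t z k l) X i j =
  (i == k)%:R * X l j -
  (if t is SL then (k == l)%:R * (i == z)%:R * X z j
   else form t l i * sg t k * X (dl t k) j).
Proof.
move=> bX; rewrite (@mulinfE n) => [|m nm]; last by rewrite (bX m) ?nm // mulr0.
under eq_bigr do rewrite /gy_fun mulrBl.
rewrite sumrB; congr (_ - _).
  rewrite (@ord_single _ _ (fun m => ((i == k) && (m == l))%:R * X m j) l).
  - by rewrite eqxx andbT.
  - by move=> m _ /negPf ->; rewrite andbF mul0r.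
  - by move=> nk; rewrite (bX l) ?nk // mulr0.
case: (t) => /=.
- rewrite (@ord_single _ _ (fun m => ((k == l) && ((i == z) && (m == z)))%:R * X m j) z).
  + by rewrite eqxx andbT -mulnb natrM.
  + by move=> m _ /negPf ->; rewrite !andbF mul0r.
  + by move=> nk; rewrite (bX z) ?nk // mulr0.
all: have aux t' : \sum_(m < n) form t' l i * form t' k m * X m j =
   form t' l i * sg t' k * X (dl t' k) j.
1,3,5: rewrite (@ord_single _ _ (fun m => form t' l i * form t' k m * X m j) (dl t' k)).
1,4,7: by rewrite formD.
1,3,5: by move=> m _ ml; rewrite (form_neq ml) mulr0 mul0r.
1,2,3: by move=> nk; rewrite (bX (dl t' k)) ?nk // mulr0.
- exact: (aux Oeven).
- exact: (aux Oodd).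
- exact: (aux SP).
Qed.

Lemma if_SL (A : Type) t (u v : A) : t <> SL -> (if t is SL then u else v) = v.
Proof. by case: t. Qed.

Lemma lt_cell_bound t n i : (i < cell_bound t n)%N = (cell t i < n)%N.
Proof. by case: t => //=; lia. Qed.

Lemma lt_dl t n i : (dl t i < cell_bound t n)%N = (i < cell_bound t n)%N.
Proof. by rewrite !lt_cell_bound cell_dl. Qed.

(** The entry at [(z, z)] is tolerated because the correction of a diagonal [gy] for [SL] sits
    there. *)
Definition block N z t (x : ginf F t) := forall i j,
  ~~ ((i < N) && (j < N))%N -> ~~ ((i == z) && (j == z)) -> gc x i j = 0.

(* The action of [block] elements on the [gy]'s is that of [gl_N] on its matrix units. *)
Lemma bracket_gy t n z (x : ginf F t) k l : let N := cell_bound t n in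
  (N <= z)%N -> block N z x -> (k < N)%N -> (l < N)%N ->
  bracket x (gy t z k l) =
  \sum_(m < N) gc x m k *: gy t z m l - \sum_(m < N) gc x l m *: gy t z k m.
Proof.
move=> N Nz bx kN lN; apply: ginf_ext => i j.
have [n' bx'] := ginf_boundedE x.
have xk i' : (N <= i')%N -> gc x i' k = 0 by move=> Ni; apply: bx; lia.
have xl j' : (N <= j')%N -> gc x l j' = 0 by move=> Nj; apply: bx; lia.
have xiz : i != z -> gc x i z = 0 by move=> iz; apply: bx; lia.
have xzj : j != z -> gc x z j = 0 by move=> jz; apply: bx; lia.
rewrite gc_bracket (mulinf_gyr _ _ _ _ _ _ bx') (mulinf_gyl _ _ _ _ _ _ bx').
rewrite gcB !gc_sum.
under eq_bigr do rewrite gcZ mulrBr.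
under [X in _ = _ - X]eq_bigr do rewrite gcZ mulrBr.
rewrite !sumrB.
rewrite (@ord_single _ _ (fun m => gc x m k * ((i == m) && (j == l))%:R) i); last first.
- by move=> Ni; rewrite xk // mul0r.
- by move=> m _ mi; rewrite eq_sym (negPf mi) mulr0.
rewrite (@ord_single _ _ (fun m => gc x l m * ((i == k) && (j == m))%:R) j); last first.
- by move=> Ni; rewrite xl // mul0r.
- by move=> m _ mi; rewrite [j == m]eq_sym (negPf mi) andbF mulr0.
rewrite !eqxx andbT /= [gc x l j * _]mulrC.
have [tSL|tSL] := pselect (t = SL).
  subst t.
  rewrite (@ord_single _ _
    (fun m => gc x m k * ((m == l) && ((i == z) && (j == z)))%:R) l); last first.
  - by move=> Ni; rewrite ltnNge Ni in lN.
  - by move=> m _ /negPf ->; rewrite mulr0.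
  rewrite (@ord_single _ _
    (fun m => gc x l m * ((k == m) && ((i == z) && (j == z)))%:R) k); last first.
  - by move=> Ni; rewrite ltnNge Ni in kN.
  - by move=> m _ /negPf mk; rewrite [k == m]eq_sym mk mulr0.
  have PQ : gc x i z * (j == z)%:R = (i == z)%:R * gc x z j.
    by case: (eqVneq i z) => [->|/xiz ->]; case: (eqVneq j z) => [->|/xzj ->];
      rewrite ?mulr1 ?mulr0 ?mul0r ?mul1r.
  by rewrite !eqxx /= -!mulrA PQ; ring.
rewrite !(if_SL _ _ tSL).
have gyS (f : nat -> F) (a b : nat -> nat) : \sum_(m < N) f m *
    (if t is SL then ((a m == b m) && ((i == z) && (j == z)))%:R
     else form t (b m) i * form t (a m) j) =
    \sum_(m < N) f m * (form t (b m) i * form t (a m) j).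
  by apply: eq_bigr => m _; rewrite (if_SL _ _ tSL).
rewrite (gyS (fun m => gc x m k) id (fun=> l)).
rewrite (gyS (fun m => gc x l m) (fun=> k) id).
rewrite (@ord_single _ _
  (fun m => gc x m k * (form t l i * form t m j)) (dl t j)); last first.
- by move=> Nj; rewrite xk // mul0r.
- by move=> m _ mj; rewrite (@form_neq _ m j) ?mulr0 // dl_neq.
rewrite (@ord_single _ _
  (fun m => gc x l m * (form t m i * form t k j)) (dl t i)); last first.
- by move=> Nj; rewrite xl // mul0r.
- by move=> m _ mj; rewrite (@form_neq _ m i) ?mul0r ?mulr0 // dl_neq.
rewrite (formE _ _ (dl t j)) (formE _ _ (dl t i)) !dlK !eqxx !mul1r.
(* Skewness of [x] moves an entry across the form; this matches the corrections in the sums with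
   those in the products. *)
have e1 := ginf_form x k j tSL.
have e2 := ginf_form x (dl t i) (dl t l) tSL; rewrite !dlK in e2.
have e2' : gc x l (dl t i) * sg t (dl t i) = - (gc x i (dl t l) * sg t l).
  move/eqP: e2; rewrite addr_eq0 => /eqP e2.
  rewrite -[LHS]mulr1 -(sg_sqr F t l).
  transitivity (gc x l (dl t i) * sg t l * (sg t (dl t i) * sg t l)); first by ring.
  by rewrite e2 mulNr mulrACA sg_sqr mul1r.
have e1' : sg t k * gc x (dl t k) j = - (gc x (dl t j) k * sg t (dl t j)).
  by apply/eqP; rewrite -addr_eq0 addrC e1.
have -> : gc x l (dl t i) * (sg t (dl t i) * form t k j) =
  gc x l (dl t i) * sg t (dl t i) * form t k j by ring.
rewrite e2' -[form t l i * sg t k * _]mulrA e1'; ring.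
Qed.

End Brackets.

Section BracketTables.
Variables (F : fieldType) (t : series) (n z : nat).
Let N := cell_bound t n.
Hypothesis Nz : (N <= z)%N.
Local Notation form := (form F).
Local Notation sg := (@sg F).
Local Notation y := (gy F t z).
Implicit Types (i j k l m : nat).

Lemma gc_gy k l i j : gc (y k l) i j = ((i == k) && (j == l))%:R -
  (if t is SL then ((k == l) && ((i == z) && (j == z)))%:R
   else form t l i * form t k j).
Proof. by []. Qed.

Lemma block_gy k l : (k < N)%N -> (l < N)%N -> block N z (y k l).
Proof.
move=> kN lN i j ij ijz; rewrite gc_gy.
have -> : (i == k) && (j == l) = false by apply/negbTE; lia.
have [tSL|tSL] := pselect (t = SL).
  by rewrite tSL (negPf ijz) andbF subrr.
rewrite (if_SL _ _ tSL) !formE; case: eqP => [il|_]; last by rewrite !mul0r subrr.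
case: eqP => [jk|_]; last by rewrite mul0r mulr0 subrr.
by move: ij; rewrite il jk !lt_dl -/N kN lN.
Qed.

Lemma if_same_SL (A : Type) (u : A) : (if t is SL then u else u) = u.
Proof. by case: t. Qed.

Lemma cell_neq i j : cell t i != cell t j -> (i == j) = false /\ form t i j = 0.
Proof.
move=> ij; split; first by apply: contraNF ij => /eqP ->.
by apply: form_neq; apply: contraNneq ij => ->; rewrite cell_dl.
Qed.

Lemma gc_gy_col a b i : (b < N)%N -> cell t a != cell t b -> gc (y a b) i b = (i == a)%:R.
Proof.
move=> bN ab; have [abF fab] := cell_neq ab.
rewrite gc_gy eqxx andbT fab mulr0 abF /=; case: (t); exact: subr0.
Qed.

Lemma gc_gy_row a b l j : (l < N)%N -> cell t l != cell t b ->
  gc (y a b) l j = ((l == a) && (j == b))%:R.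
Proof.
move=> lN lb; have bl : cell t b != cell t l by rewrite eq_sym.
have [_ fbl] := cell_neq bl.
rewrite gc_gy fbl mul0r; have -> : (l == z) = false by lia.
by rewrite andbF; case: (t); exact: subr0.
Qed.

Lemma sum_delta_l (f : nat -> ginf F t) a : (a < N)%N ->
  \sum_(m < N) ((m : nat) == a)%:R *: f m = f a.
Proof.
move=> aN; rewrite (@ord_single _ _ (fun m => (m == a)%:R *: f m) a).
- by rewrite eqxx scale1r.
- by move=> m _ /negPf ->; rewrite scale0r.
- by rewrite leqNgt aN.
Qed.

(** The cell conditions make column [b] and row [l] of [y a b] those of the matrix unit, the
    correction lying elsewhere; so the relation of matrix units holds. *)
Lemma bracket_gy_chain a b l : (a < N)%N -> (b < N)%N -> (l < N)%N ->
  cell t a != cell t b -> cell t l != cell t b ->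
  bracket (y a b) (y b l) = y a l - (l == a)%:R *: y b b.
Proof.
move=> aN bN lN ab lb; rewrite (@bracket_gy _ _ n) //; last exact: block_gy.
under eq_bigr do rewrite gc_gy_col //.
under [X in _ - X]eq_bigr do rewrite gc_gy_row //.
rewrite (@sum_delta_l (fun m => y m l)) //; congr (_ - _).
have [_|_] := eqVneq l a; last by rewrite scale0r big1 // => m _; rewrite scale0r.
by rewrite (@sum_delta_l (fun m => y b m)) // scale1r.
Qed.

Lemma gy_dual k l : t <> SL -> y (dl t l) (dl t k) = - (sg t l * sg t k) *: y k l.
Proof.
move=> tSL; apply: ginf_ext => i j; rewrite gcZ !gc_gy !(if_SL _ _ tSL) !formE !dlK !sg_dl.
have e2 := form_sign_sqr F t; set e := form_sign F t in e2 *.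
have s2 := sg_sqr F t k; have s2' := sg_sqr F t l.
set s := sg t k in s2 *; set s' := sg t l in s2' *.
have mulnb' (b c : bool) : (b && c)%:R = b%:R * c%:R :> F by rewrite -mulnb natrM.
rewrite !mulnb'; set A : F := (i == k)%:R; set B : F := (j == l)%:R.
set A' : F := (i == dl t l)%:R; set B' : F := (j == dl t k)%:R.
transitivity (A' * B' * (s' * s') * (s * s) - A * B * s * s' * (e * e)); first by rewrite s2 s2'; ring.
rewrite e2; ring.
Qed.

(** Origin of the factor: for [SL] the corrections add up to a multiple of the trace of [x], which
    is zero; for a form, matrix units and corrections contribute one copy of [x] each, since [x] is
    minus its own adjoint. *)
Lemma ginf_expansion (x : ginf F t) : bounded N (gc x) ->
  \sum_(k < N) \sum_(l < N) gc x k l *: y k l = (if t is SL then 1 else 2) *: x.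
Proof.
move=> bx; apply: ginf_ext => i j; rewrite gcZ gc_sum.
transitivity (\sum_(k < N) \sum_(l < N) gc x k l * gc (y k l) i j).
  by apply: eq_bigr => k _; rewrite gc_sum.
have E1 : \sum_(k < N) \sum_(l < N) gc x k l * ((i == k) && (j == l))%:R = gc x i j.
  rewrite (@ord_single _ _ (fun k => \sum_(l < N) gc x k l * ((i == k) && (j == l))%:R) i).
  - rewrite (@ord_single _ _ (fun l => gc x i l * ((i == i) && (j == l))%:R) j).
    + by rewrite !eqxx mulr1.
    + by move=> l _ /negPf jl; rewrite [j == l]eq_sym jl andbF mulr0.
    + by move=> Nj; rewrite bx ?Nj ?orbT // mul0r.
  - move=> k _ /negPf ki; apply: big1 => l _.
    by rewrite [i == k]eq_sym ki mulr0.
  - by move=> Ni; apply: big1 => l _; rewrite bx ?Ni // mul0r.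
under eq_bigr do under eq_bigr do rewrite gc_gy mulrBr.
under eq_bigr do rewrite sumrB.
rewrite sumrB E1; have [tSL|tSL] := pselect (t = SL).
  clear E1; have := bx; have := Nz; rewrite /N /y; subst t => /= nz bx'.
  rewrite mul1r -[RHS]subr0; congr (_ - _).
  transitivity (\sum_(k < n) gc x k k * ((i == z) && (j == z))%:R).
    apply: eq_bigr => k _.
    rewrite (@ord_single _ _ (fun l => gc x k l *
      (((k : nat) == l) && ((i == z) && (j == z)))%:R) k).
    + by rewrite eqxx.
    + by move=> l _ /negPf lk; rewrite [nat_of_ord k == l]eq_sym lk mulr0.
    + by rewrite leqNgt ltn_ord.
  by rewrite -mulr_suml ginf_trace // mul0r.
have -> : \sum_(k < N) \sum_(l < N) gc x k l * (if t is SL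
    then (((k : nat) == l) && ((i == z) && (j == z)))%:R
    else form t l i * form t k j) =
    \sum_(k < N) \sum_(l < N) gc x k l * (form t l i * form t k j).
  by apply: eq_bigr => k _; apply: eq_bigr => l _; rewrite (if_SL _ _ tSL).
rewrite (if_SL _ _ tSL) mulrDl mul1r; congr (_ + _).
rewrite (@ord_single _ _ (fun k => \sum_(l < N) gc x k l * (form t l i * form t k j)) (dl t j)).
- rewrite (@ord_single _ _ (fun l => gc x (dl t j) l * (form t l i * form t (dl t j) j)) (dl t i)).
  + rewrite !formE !dlK !eqxx !mul1r.
    have := ginf_form x (dl t i) j tSL; rewrite dlK => /eqP.
    rewrite addr_eq0 => /eqP e1; rewrite mulrCA e1 mulrN opprK mulrA.
    by rewrite sg_sqr mul1r.
  + by move=> l _ li; rewrite (@form_neq _ _ l i) ?mul0r ?mulr0 // dl_neq.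
  + by move=> Ni; rewrite bx ?Ni ?orbT // mul0r.
- by move=> k _ kj; apply: big1 => l _; rewrite (@form_neq _ _ k j) ?mulr0 // dl_neq.
- by move=> Nj; apply: big1 => l _; rewrite bx ?Nj // mul0r.
Qed.

(** The orthogonal series are left out because [y k k] vanishes there. *)
Lemma bracket_gy_diag k l : t = SL \/ t = SP -> (k < N)%N -> (l < N)%N ->
  cell t k != cell t l ->
  bracket (y k k) (y k l) = y k l /\ bracket (y l l) (y k l) = - y k l.
Proof.
move=> tSS kN lN kl; have [klF fkl] := cell_neq kl.
have lk : cell t l != cell t k by rewrite eq_sym.
have [lkF flk] := cell_neq lk.
have diag k' : (k' < N)%N -> forall m : nat, (m < N)%N ->
    gc (y k' k') m k' = (m == k')%:R /\ gc (y k' k') k' m = (m == k')%:R.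
  move=> k'N m mN; rewrite !gc_gy eqxx !andbT andTb.
  case: tSS => tE; rewrite tE.
    have -> : (k' == z) = false by lia.
    by rewrite !andbF !subr0.
  have -> : form SP k' k' = 0 by rewrite -tE form_neq // tE /=; case: ifP; lia.
  by rewrite mulr0 mul0r !subr0.
rewrite !(@bracket_gy _ _ n) //; try exact: block_gy; split.
  under eq_bigr => m _ do rewrite (proj1 (diag k kN m (ltn_ord m))).
  under [X in _ - X]eq_bigr => m _ do rewrite gc_gy_row // lkF /= scale0r.
  by rewrite big1_eq subr0 (@sum_delta_l (fun m => y m l)).
under [X in _ - X]eq_bigr => m _ do rewrite (proj2 (diag l lN m (ltn_ord m))).
rewrite (@sum_delta_l (fun m => y k m)) // big1 ?sub0r // => m _.
rewrite gc_gy klF andbF flk mulr0; have -> : (k == z) = false by lia.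
by rewrite !andbF /= mulr0n if_same_SL subrr scale0r.
Qed.

End BracketTables.

(** * Diagonalizable operators and the Casimir operator *)

Section SpanningFamilies.
Variables (K : fieldType) (V : lmodType K).
Implicit Types (S P : set V) (s : seq V).

Lemma lin_span_seq S (r : seq V) : (forall u, u \in r -> lin_span S u) ->
  exists s, (forall u, u \in s -> S u) /\ forall u, u \in r -> lin_span [set` s] u.
Proof.
elim: r => [|x r IH] rS; first by exists [::].
have [|s [sS rs]] := IH; first by move=> u ur; apply: rS; rewrite inE ur orbT.
have [s' [s'S xs']] : exists s', (forall u, u \in s' -> S u) /\ lin_span [set` s'] x.
  elim: {IH}(rS x (mem_head _ _)) => [|a u v Su _ [s' [s'S vs']]].
    by exists [::]; split=> //; exact: lin_span0.
  exists (u :: s'); split=> [w|]; first by rewrite inE => /predU1P[->//|/s'S].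
  apply: lin_spanS; first by rewrite /= mem_head.
  by apply: lin_spanW vs' => w /= ws'; rewrite inE ws' orbT.
exists (s' ++ s); split=> u; rewrite ?mem_cat; first by case/orP => [/s'S|/sS].
rewrite inE => /predU1P[->|/rs us].
  by apply: lin_spanW xs' => w /= ws'; rewrite mem_cat ws'.
by apply: lin_spanW us => w /= ws; rewrite mem_cat ws orbT.
Qed.

Definition eigenvectors (a : V -> V) (E : set K) : set V :=
  [set v | exists2 mu, E mu & a v = mu *: v].

Lemma eigenspan_components (a : V -> V) (E : set K) P (v : V) :
  linear a -> subspace P -> (forall u, P u -> P (a u)) ->
  lin_span (eigenvectors a E) v -> P v ->
  lin_span [set u | P u /\ eigenvectors a E u] v.
Proof.
move=> lin_a sP Pa vE Pv.
have a0 : a 0 = 0 by have := lin_a (-1) 0 0; rewrite !scaleN1r oppr0 addr0 addNr.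
have [s [w [us sE vsum]]] : exists (s : seq K) (w : K -> V), [/\ uniq s,
    forall mu, mu \in s -> E mu /\ a (w mu) = mu *: w mu & v = \sum_(mu <- s) w mu].
  elim: vE {Pv} => [|c u u' [mu Emu au] _ [s [w [us sE ->]]]].
    by exists [::], (fun=> 0); rewrite big_nil.
  have acu : a (c *: u) = mu *: (c *: u).
    by rewrite -[c *: u in LHS]addr0 lin_a a0 addr0 au !scalerA mulrC.
  have aD x y : a (x + y) = a x + a y by rewrite -[x in LHS]scale1r lin_a scale1r.
  pose g i := if i == mu then (if mu \in s then c *: u + w mu else c *: u) else w i.
  have gmu : g mu = if mu \in s then c *: u + w mu else c *: u by rewrite /g eqxx.
  have gE i : i \in mu :: s -> E i /\ a (g i) = i *: g i.
    rewrite inE; case: (eqVneq i mu) => [->|imu /= is_]; last first.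
      by rewrite /g (negPf imu); exact: sE.
    move=> _; rewrite gmu; split=> //; case: ifP => // /sE[_ awmu].
    by rewrite aD acu awmu scalerDr.
  have [mus|mus] := boolP (mu \in s).
    exists s, g; split=> // [i is_|]; first by apply: gE; rewrite inE is_ orbT.
    rewrite (big_rem mu) // [in RHS](big_rem mu) //= gmu mus addrA.
    congr (_ + _); apply: eq_big_seq => i; rewrite mem_rem_uniq // inE /g.
    by case: eqP.
  exists (mu :: s), g; split=> //=; first by rewrite mus.
  rewrite big_cons gmu (negPf mus); congr (_ + _).
  by apply: eq_big_seq => i is_; rewrite /g; case: eqVneq is_ mus => // -> ->.
rewrite vsum; apply: subspace_sum_seq => [|mu mus]; first exact: lin_span_subspace.
apply: lin_span_sub; split; last by have [? ?] := sE _ mus; exists mu.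
move: mu mus; apply: (@weight_components _ _ unit _ (fun=> a) (fun mu=> fun=> mu)) => //.
- by move=> mu mus _; case: (sE _ mus).
- by rewrite -vsum.
Qed.

Lemma coordinates_matrix d (f : 'rV[K]_d -> V) P (a : V -> V) :
  linear f -> (forall v, P v <-> exists c, f c = v) ->
  linear a -> (forall v, P v -> P (a v)) ->
  exists A : 'M[K]_d, forall c, f (c *m A) = a (f c).
Proof.
move=> lin_f Pf lin_a Pa.
have ex_row i : exists c, f c = a (f (delta_mx 0 i)).
  by apply/Pf/Pa/Pf; exists (delta_mx 0 i).
have [g gE] := choice ex_row.
have lin_sum (h : 'rV[K]_d -> V) : linear h ->
    forall c, h c = \sum_i c 0 i *: h (delta_mx 0 i).
  move=> lin_h c; have h0 : h 0 = 0.
    by have := lin_h (-1) 0 0; rewrite !scaleN1r oppr0 addr0 addNr.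
  rewrite {1}(row_sum_delta c); elim/big_rec2: _ => // i y x _ <-.
  by rewrite lin_h.
exists (\matrix_i g i) => c.
have lin_L : linear (fun c => f (c *m \matrix_i g i)).
  by move=> b u v; rewrite mulmxDl -scalemxAl lin_f.
have lin_R : linear (a \o f) by move=> b u v; rewrite /= lin_f lin_a.
rewrite (lin_sum _ lin_L) [RHS](lin_sum _ lin_R).
by apply: eq_bigr => i _; rewrite -rowE rowK gE.
Qed.

Lemma coordinates_eigenspan d (f : 'rV[K]_d -> V) P (a : V -> V) E (A : 'M[K]_d) :
  linear f -> injective f -> subspace P -> (forall v, P v <-> exists c, f c = v) ->
  linear a -> (forall v, P v -> P (a v)) -> (forall c, f (c *m A) = a (f c)) ->
  (forall v, P v -> lin_span (eigenvectors a E) v) ->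
  forall c, lin_span [set c : 'rV[K]_d | exists2 mu, E mu & c *m A = mu *: c] c.
Proof.
move=> lin_f inj_f sP Pf lin_a Pa fA PE c.
have Pfc c' : P (f c') by apply/Pf; exists c'.
have f0 : f 0 = 0 by have := lin_f (-1) 0 0; rewrite !scaleN1r oppr0 addr0 addNr.
have := eigenspan_components lin_a sP Pa (PE _ (Pfc c)) (Pfc c).
set S := lin_span _; suff H v : S v -> exists2 c' : 'rV[K]_d, f c' = v &
    lin_span [set c : 'rV[K]_d | exists2 mu, E mu & c *m A = mu *: c] c'.
  by case/H => c' /inj_f ->.
elim=> [|b u w [/Pf[cu cuE] [mu Emu au]] _ [cw <- IH]].
  by exists 0 => //; exact: lin_span0.
exists (b *: cu + cw); first by rewrite lin_f cuE.
apply: lin_spanS => //; exists mu => //; apply: inj_f.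
by rewrite fA cuE au -cuE -[mu *: cu]addr0 lin_f f0 addr0.
Qed.

End SpanningFamilies.

Section Diagonalization.
Variable K : fieldType.

(** Finitely many eigenvectors span the rows; [fullrankfun] selects among them a basis, whose
    eigenvalues stay in [E]. *)
Lemma diagonalizable_of_span d (A : 'M[K]_d) (E : set K) :
  (forall c, lin_span [set c : 'rV[K]_d | exists2 mu, E mu & c *m A = mu *: c] c) ->
  exists (P : 'M[K]_d) (D : 'rV[K]_d),
    [/\ P \in unitmx, P *m A = diag_mx D *m P & forall i, E (D 0 i)].
Proof.
move=> spanE; set S := (X in forall c, lin_span X c) in spanE.
have [|s [sS sE]] := @lin_span_seq _ _ S [seq delta_mx 0 i | i : 'I_d]; first by [].
pose M := \matrix_(i < size s) s`_i.
have full : row_full M.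
  rewrite -sub1mx; apply/row_subP => i; rewrite row1.
  have : lin_span [set` s] (delta_mx 0 i : 'rV_d) by apply: sE; apply/mapP; exists i; rewrite ?mem_enum.
  apply: (@lin_span_min _ _ _ [set u : 'rV_d | (u <= M)%MS]) => [|u /= us].
    split=> /= [|a u v uM vM]; first exact: sub0mx.
    by rewrite addmx_sub // scalemx_sub.
  have us' : (index u s < size s)%N by rewrite index_mem.
  by rewrite -(nth_index 0 us) -[nth _ _ _](rowK (fun i : 'I_(size s) => s`_i)
    (Ordinal us')) row_sub.
have Srow i : exists mu, E mu /\ row i (rowsub (fullrankfun full) M) *m A =
    mu *: row i (rowsub (fullrankfun full) M).
  have : S s`_(fullrankfun full i) by apply/sS/mem_nth.
  case=> mu Emu Amu; exists mu; split=> //.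
  have -> : row i (rowsub (fullrankfun full) M) = s`_(fullrankfun full i).
    by apply/rowP => j; rewrite !mxE.
  exact: Amu.
have [g gE] := choice Srow.
exists (rowsub (fullrankfun full) M), (\row_i g i); split.
- exact: fullrowsub_unit.
- apply/row_matrixP => i; rewrite row_mul (proj2 (gE i)).
  by rewrite row_mul row_diag_mx mxE -scalemxAl -rowE.
- by move=> i; rewrite mxE; case: (gE i).
Qed.

Lemma trace_diagonalized d (P A : 'M[K]_d) (D : 'rV[K]_d) : P \in unitmx ->
  P *m A = diag_mx D *m P -> \tr A = \sum_i D 0 i.
Proof.
move=> Pu PA; have -> : A = invmx P *m (diag_mx D *m P) by rewrite -PA mulKmx.
by rewrite mxtrace_mulC mulmxK // mxtrace_diag.
Qed.

End Diagonalization.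

(** The trace of the square of [A j] is the sum of the squares of the real eigenvalues of [A j],
    hence nonnegative. These traces add up to zero, so all the eigenvalues vanish, and a
    diagonalizable matrix without nonzero eigenvalue is zero. *)
Lemma sum_squares_eq0 (C : numClosedFieldType) (J : finType) d (A : J -> 'M[C]_d) :
  (forall j c, lin_span [set c : 'rV[C]_d | exists2 mu, mu \is Num.real &
    c *m A j = mu *: c] c) ->
  \sum_j A j *m A j = 0 -> forall j, A j = 0.
Proof.
move=> Areal sum0.
have diag j := diagonalizable_of_span (Areal j).
have trE j : exists D : 'rV[C]_d, [/\ \tr (A j *m A j) = \sum_i D 0 i ^+ 2,
    forall i, D 0 i \is Num.real & (forall i, D 0 i = 0) -> A j = 0].
  have [P [D [Pu PA Dreal]]] := diag j; exists D; split=> // [|D0].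
    rewrite (@trace_diagonalized _ _ P _ (\row_i D 0 i ^+ 2)) //.
      by apply: eq_bigr => i _; rewrite mxE.
    rewrite mulmxA PA -mulmxA PA mulmxA; congr (_ *m P).
    by rewrite mulmx_diag; congr diag_mx; apply/rowP => i; rewrite !mxE expr2.
  have -> : A j = invmx P *m (diag_mx D *m P) by rewrite -PA mulKmx.
  have -> : D = 0 by apply/rowP => i; rewrite D0 mxE.
  by rewrite linear0 mul0mx mulmx0.
have [D DE] := choice trE.
have ge0 j : 0 <= \sum_i D j 0 i ^+ 2.
  by apply: sumr_ge0 => i _; case: (DE j) => _ Dr _; rewrite real_exprn_even_ge0.
have tr0 : \sum_j \sum_i D j 0 i ^+ 2 = 0.
  transitivity (\tr (\sum_j A j *m A j)); last by rewrite sum0 mxtrace0.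
  by rewrite raddf_sum; apply: eq_bigr => j _; have [<- _ _] := DE j.
move=> j; have [_ Dr] := DE j; apply => i.
move/eqP: tr0; rewrite psumr_eq0 // => /allP/(_ j (mem_index_enum _)) /=.
rewrite psumr_eq0 => [/allP/(_ i (mem_index_enum _))|k _] /=.
  by rewrite sqrf_eq0 => /eqP.
by rewrite real_exprn_even_ge0.
Qed.

(** * Local finiteness by straightening words *)

Section Generated.
Variables (K : fieldType) (X : lmodType K).

Definition generated (J : Type) (a : J -> X -> X) (v : X) : set X :=
  [set w | forall P : set X, subspace P -> (forall j u, P u -> P (a j u)) -> P v -> P w].

Lemma generated_subspace J (a : J -> X -> X) v : subspace (generated a v).
Proof.
split=> [P [P0 _] _ _ //|b u w gu gw P sP Pa Pv].
by apply: (proj2 sP); [exact: gu|exact: gw].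
Qed.

Lemma generated_stable J (a : J -> X -> X) v j u : generated a v u -> generated a v (a j u).
Proof. by move=> gu P sP Pa Pv; apply: (Pa); exact: gu. Qed.

Lemma generated_self J (a : J -> X -> X) v : generated a v v.
Proof. by move=> P. Qed.

Variables (J : finType) (a : J -> X -> X).
Hypothesis lin_a : forall j, linear (a j).
Hypothesis bracket_a : forall i j v,
  lin_span [set w | exists k, w = a k v] (a i (a j v) - a j (a i v)).
Hypothesis eigen_a : forall j v, lin_span (eigenvectors (a j) setT) v.

Let le : rel J := fun i j => (enum_rank i <= enum_rank j)%N.
Let act (w : seq J) (v : X) := foldr a v w.

Let le_trans : transitive le.
Proof. by move=> x y z; exact: leq_trans. Qed.

Let a0 j : a j 0 = 0.
Proof. by have := lin_a j (-1) 0 0; rewrite !scaleN1r oppr0 addr0 addNr. Qed.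

Let aD j u w : a j (u + w) = a j u + a j w.
Proof. by rewrite -[u in LHS]scale1r lin_a scale1r. Qed.

Definition sorted_span v n := lin_span
  [set u | exists w, [/\ sorted le w, (size w <= n)%N & u = act w v]].

Lemma sorted_spanW v m n : (m <= n)%N -> sorted_span v m `<=` sorted_span v n.
Proof.
move=> mn; apply: lin_spanW => u [w [sw wm ->]]; exists w; split=> //.
exact: leq_trans mn.
Qed.

(* Straightening: commuting letters past each other only costs shorter words. *)
Lemma straighten v n w i : (size w <= n)%N -> sorted le w ->
  exists w', [/\ sorted le w', perm_eq w' (i :: w) &
    sorted_span v (size w) (a i (act w v) - act w' v)].
Proof.
elim: n w i => [|n IHn] w i wn sw.
  exists [:: i]; case: w wn sw => // _ _; split=> //=.
  by rewrite subrr; exact: lin_span0.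
case: w wn sw => [|j u] wn sw.
  by exists [:: i]; split=> //=; rewrite subrr; exact: lin_span0.
have [ij|ij] := boolP (le i j).
  by exists (i :: j :: u); split=> //=; rewrite ?ij // subrr; exact: lin_span0.
have ji : le j i by rewrite /le ltnW // ltnNge.
have su : sorted le u := path_sorted sw.
have un : (size u <= n)%N by rewrite -ltnS.
have step k x : (size x <= n)%N -> sorted le x -> sorted_span v (size x).+1 (a k (act x v)).
  move=> xn sx; have [x' [sx' px' dx']] := IHn x k xn sx.
  rewrite -(subrK (act x' v) (a k (act x v))); apply: subspaceD.
  - exact: lin_span_subspace.
  - exact: sorted_spanW dx'.
  - by apply: lin_span_sub; exists x'; split=> //; rewrite (perm_size px').
have [u' [su' pu' du']] := IHn u i un su.
have s' : sorted le (j :: u').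
  rewrite /= path_sortedE // su' andbT (perm_all _ pu') /= ji.
  by move: sw; rewrite /= path_sortedE // => /andP[].
exists (j :: u'); split=> //.
  rewrite (perm_trans (_ : perm_eq _ (j :: i :: u))) ?perm_cons //.
  by rewrite -(cat1s j) -(cat1s i) -[i :: j :: u](cat1s i) -[j :: u](cat1s j) perm_catCA.
have -> : a i (act (j :: u) v) - act (j :: u') v =
    (a i (a j (act u v)) - a j (a i (act u v))) + a j (a i (act u v) - act u' v).
  have aB x y : a j (x - y) = a j x - a j y.
    by rewrite -scaleN1r aD -[-1 *: y]addr0 lin_a a0 addr0 scaleN1r.
  by rewrite aB addrA subrK.
apply: subspaceD; first exact: lin_span_subspace.
  apply: (lin_span_min _ _ (bracket_a i j (act u v))); first exact: lin_span_subspace.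
  by move=> _ [k ->]; exact: step.
move: du'; apply: (@lin_span_min _ _ _ (fun x => sorted_span v (size (j :: u)) (a j x))).
  split=> [|c x y Px Py]; first by rewrite a0; exact: lin_span0.
  by rewrite lin_a; apply: (proj2 (lin_span_subspace _)).
move=> _ [x [sx xu ->]]; apply: (@sorted_spanW v (size x).+1) => //.
by apply: step => //; exact: leq_trans un.
Qed.

Lemma generated_sorted v w : generated a v w -> exists n, sorted_span v n w.
Proof.
move=> gw; apply: (gw (fun x => exists n, sorted_span v n x)).
- split=> [|c x y [m Px] [n Py]]; first by exists 0%N; exact: lin_span0.
  exists (maxn m n); apply: (proj2 (lin_span_subspace _)).
    by apply: sorted_spanW Px; exact: leq_maxl.
  by apply: sorted_spanW Py; exact: leq_maxr.
- move=> j u [n un]; exists n.+1; move: un.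
  apply: (@lin_span_min _ _ _ (fun x => sorted_span v n.+1 (a j x))).
    split=> [|c x y Px Py]; first by rewrite a0; exact: lin_span0.
    by rewrite lin_a; apply: (proj2 (lin_span_subspace _)).
  move=> _ [x [sx xn ->]]; have [x' [sx' px' dx']] := straighten v j (leqnn _) sx.
  rewrite -(subrK (act x' v) (a j (act x v))); apply: subspaceD.
  + exact: lin_span_subspace.
  + by apply: sorted_spanW dx'; rewrite (leq_trans xn).
  + by apply: lin_span_sub; exists x'; split=> //; rewrite (perm_size px').
- by exists 0%N; apply: lin_span_sub; exists [::].
Qed.

(** Each vector of [s] is a finite sum of eigenvectors of [a j]; these summands form [s']. *)
Lemma eigen_cover j (s : seq X) : exists s' : seq X, lin_span [set` s] `<=` lin_span [set` s'] /\
  forall u, lin_span [set` s'] u -> lin_span [set` s'] (a j u).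
Proof.
have [s' [s'E ss']] := @lin_span_seq _ _ _ s (fun u _ => eigen_a j u).
exists s'; split=> [|u].
  by apply: lin_span_min => [|u]; [exact: lin_span_subspace|exact: ss'].
elim=> [|b x y xs' _ IH]; first by rewrite a0; exact: lin_span0.
rewrite lin_a; have [mu _ ->] := s'E _ xs'; rewrite scalerA.
exact: lin_spanS.
Qed.

(** A Poincare-Birkhoff-Witt argument: sorted words suffice, and a sorted word applies its letters
    in decreasing order. Allowing the next smaller letter [j0] only applies powers of [a j0] to a
    finite-dimensional space, which [eigen_cover] encloses in a stable one. The induction is on the
    number [k] of largest letters allowed. *)
Lemma generated_finite v : exists s : seq X, generated a v `<=` lin_span [set` s].
Proof.
suff [s sP] : exists s : seq X, forall w, sorted le w -> lin_span [set` s] (act w v).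
  exists s => w /generated_sorted[n]; apply: lin_span_min.
    exact: lin_span_subspace.
  by move=> _ [x [sx _ ->]]; exact: sP.
suff [s sP] : exists s : seq X, forall w, sorted le w ->
    all (fun j => (#|J| - #|J| <= enum_rank j)%N) w -> lin_span [set` s] (act w v).
  by exists s => w /sP; apply; rewrite subnn; exact/allP.
suff H k : (k <= #|J|)%N -> exists s : seq X, forall w, sorted le w ->
    all (fun j => (#|J| - k <= enum_rank j)%N) w -> lin_span [set` s] (act w v).
  exact: H.
elim: k => [_|k IH kJ].
  exists [:: v] => -[|j w] _ //=; last by rewrite subn0 leqNgt ltn_ord.
  by move=> _; apply: lin_span_sub; rewrite /= mem_head.
have [s sP] := IH (ltnW kJ).
have rk : (#|J| - k.+1 < #|J|)%N by lia.
pose j0 := enum_val (Ordinal rk).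
have rj0 : enum_rank j0 = (#|J| - k.+1)%N :> nat by rewrite /j0 enum_valK.
have [s' [ss' s's']] := eigen_cover j0 s.
exists s'; elim=> [_ _|j w IHw sw /= /andP[jk wk]].
  by apply/ss'/sP.
move: jk; rewrite leq_eqVlt => /orP[/eqP jE|jlt].
  have -> : j = j0 by apply/enum_rank_inj/val_inj; rewrite /= rj0 -jE.
  by apply/s's'/IHw => //; exact: path_sorted sw.
apply/ss'/(sP (j :: w)) => //.
have ltj : (#|J| - k <= enum_rank j)%N by rewrite -subnSK.
rewrite /= ltj /=; apply/allP => x xw; apply: leq_trans ltj _.
by move: sw; rewrite /= path_sortedE // => /andP[/allP/(_ _ xw)].
Qed.

End Generated.

(** * The Casimir operator, its kernel and its image *)

Section Casimir.
Variables (C : numClosedFieldType) (X : lmodType C) (I : finType).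
Variable y : I -> I -> X -> X.
Hypothesis lin_y : forall k l, linear (y k l).
Hypothesis bracket_y : forall a b, exists Y : I -> I -> C, forall k l v,
  y a b (y k l v) - y k l (y a b v) =
  \sum_m Y m k *: y m l v - \sum_m Y l m *: y k m v.

Definition hermitian (x : I * I * bool) (v : X) : X :=
  let: (k, l, b) := x in
  if b then y k l v + y l k v else 'i *: (y k l v - y l k v).

Hypothesis eigen_y : forall x v, lin_span (eigenvectors (hermitian x) setT) v.

(** The Casimir element of [gl] for the trace form, with [y k l] in the role of the matrix unit
    [E_kl]. *)
Definition casimir v := \sum_k \sum_l y k l (y l k v).

Let y0 k l : y k l 0 = 0.
Proof. by have := lin_y k l (-1) 0 0; rewrite !scaleN1r oppr0 addr0 addNr. Qed.

Let yD k l u w : y k l (u + w) = y k l u + y k l w.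
Proof. by rewrite -[u in LHS]scale1r lin_y scale1r. Qed.

Let yZ k l c u : y k l (c *: u) = c *: y k l u.
Proof. by rewrite -[c *: u]addr0 lin_y y0 addr0. Qed.

Let yB k l u w : y k l (u - w) = y k l u - y k l w.
Proof. by rewrite -scaleN1r yD yZ scaleN1r. Qed.

Let ysum k l (T : Type) (r : seq T) (f : T -> X) :
  y k l (\sum_(i <- r) f i) = \sum_(i <- r) y k l (f i).
Proof. by apply: (big_morph (y k l)); [exact: yD|exact: y0]. Qed.

Let lin_h x : linear (hermitian x).
Proof.
case: x => [[k l] [] c u w] /=; rewrite !lin_y; first by rewrite scalerDr addrACA.
rewrite opprD addrACA -scalerBr scalerDr !scalerA [c * _]mulrC.
by [].
Qed.

Let y_hermitian k l v : y k l v = 2^-1 *: (hermitian (k, l, true) v) -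
  ('i / 2) *: hermitian (k, l, false) v.
Proof.
rewrite /= scalerA -mulrA [2^-1 * 'i]mulrC mulrA -expr2 sqrCi mulN1r.
rewrite scaleNr opprK -scalerDr addrACA subrr addr0 -mulr2n -scaler_nat scalerA.
by rewrite mulVf ?scale1r // pnatr_eq0.
Qed.

Let bracket_h i j v : lin_span [set w | exists k, w = hermitian k v]
  (hermitian i (hermitian j v) - hermitian j (hermitian i v)).
Proof.
set Q := lin_span _; have sQ : subspace Q by exact: lin_span_subspace.
have Qy k l : Q (y k l v).
  rewrite y_hermitian; apply: subspaceB => //; apply: subspaceZ => //;
  by apply: lin_span_sub; eexists.
have Qyy a b k l : Q (y a b (y k l v) - y k l (y a b v)).
  have [Y ->] := bracket_y a b.
  by apply: subspaceB => //; apply: subspace_sum => // m _; apply: subspaceZ.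
have hcomm (g : X -> X) x : linear g -> (forall k l, Q (y k l (g v) - g (y k l v))) ->
    Q (hermitian x (g v) - g (hermitian x v)).
  move=> lin_g Qg; have [c [e hE]] : exists c e, forall w,
      hermitian x w = c *: (e *: y x.1.2 x.1.1 w + y x.1.1 x.1.2 w).
    case: x => [[k l] []]; first by exists 1, 1 => w; rewrite /= !scale1r addrC.
    by exists 'i, (-1) => w; rewrite /= scaleN1r addrC.
  have gZ b w : g (b *: w) = b *: g w.
    have g0 : g 0 = 0 by have := lin_g (-1) 0 0; rewrite !scaleN1r oppr0 addr0 addNr.
    by rewrite -[b *: w]addr0 lin_g g0 addr0.
  rewrite !hE gZ lin_g -scalerBr opprD addrACA -scalerBr.
  by apply: subspaceZ => //; apply: (proj2 sQ).
apply: (hcomm) => // k l; rewrite -opprB; apply: subspaceN => //.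
by apply: (hcomm (y k l) j) => // k' l'; exact: Qyy.
Qed.

(** The commutator with [y a b] falls on either factor of [y k l (y l k v)]. After renaming
    summation indices one factor contributes [A - B] and the other [B - A]. *)
Let casimir_comm a b v : y a b (casimir v) = casimir (y a b v).
Proof.
have [Y YE] := bracket_y a b.
have comm k l u : y a b (y k l u) = y k l (y a b u) +
    (\sum_m Y m k *: y m l u - \sum_m Y l m *: y k m u) by rewrite -YE addrC subrK.
have sub3 (P D E : X) : P + D + E - P = D + E.
  by rewrite addrAC [P + D - P]addrAC subrr add0r.
rewrite /casimir ysum; apply/eqP; rewrite -subr_eq0 -sumrB.
pose A := \sum_k \sum_l \sum_m Y m l *: y k l (y m k v).
pose B := \sum_k \sum_l \sum_m Y k m *: y k l (y l m v).
suff -> : \sum_k (y a b (\sum_l y k l (y l k v)) - \sum_l y k l (y l k (y a b v))) =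
    (A - B) + (B - A) by rewrite addrA subrK subrr.
transitivity (\sum_k \sum_l (
   (\sum_m Y m l *: y k l (y m k v) - \sum_m Y k m *: y k l (y l m v)) +
   (\sum_m Y m k *: y m l (y l k v) - \sum_m Y l m *: y k m (y l k v)))).
  apply: eq_bigr => k _; rewrite ysum -sumrB; apply: eq_bigr => l _.
  rewrite (comm k l) (comm l k) yD sub3 yB !ysum.
  congr (_ - _ + _); apply: eq_bigr => m _; exact: yZ.
under eq_bigr do rewrite big_split /= !sumrB.
rewrite big_split /= !sumrB; congr (_ - _ + (_ - _)).
  rewrite exchange_big; under eq_bigr do rewrite exchange_big.
  by rewrite exchange_big.
by apply: eq_bigr => k _; rewrite exchange_big.
Qed.

Let casimir_linear : linear casimir.
Proof.
move=> c u v; rewrite /casimir scaler_sumr -big_split; apply: eq_bigr => k _ /=.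
by rewrite scaler_sumr -big_split; apply: eq_bigr => l _ /=; rewrite !lin_y.
Qed.

Let casimir0 : casimir 0 = 0.
Proof. by apply: big1 => k _; apply: big1 => l _; rewrite !y0. Qed.

Let gen v := generated (fun kl : I * I => y kl.1 kl.2) v.

Let gen_y v k l u : gen v u -> gen v (y k l u).
Proof. exact: (@generated_stable _ _ _ (fun kl : I * I => y kl.1 kl.2) v (k, l)). Qed.

Let gen_casimir v u : gen v u -> gen v (casimir u).
Proof.
move=> gu; apply: subspace_sum => [|k _]; first exact: generated_subspace.
by apply: subspace_sum => [|l _]; [exact: generated_subspace|do 2!apply: gen_y].
Qed.

Lemma casimir_generated_finite v : exists s : seq X, gen v `<=` lin_span [set` s].
Proof.
have [s sP] := generated_finite lin_h bracket_h eigen_y v.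
exists s => u gu; apply: sP => P sP Ph; apply: gu => // -[k l] w Pw /=.
by rewrite y_hermitian; apply: subspaceB => //; apply: subspaceZ => //; apply: Ph.
Qed.

Hypothesis real_y : forall x v, lin_span (eigenvectors (hermitian x) [set mu | mu \is Num.real]) v.

(** [(y_kl + y_lk)^2 - (y_kl - y_lk)^2 = 2 (y_kl y_lk + y_lk y_kl)], and the sum over ordered pairs
    counts each product twice, whence the factor [4]. *)
Let hermitian_squares v : \sum_x hermitian x (hermitian x v) = 4 *: casimir v.
Proof.
have -> : \sum_x hermitian x (hermitian x v) =
    \sum_k \sum_l \sum_b hermitian (k, l, b) (hermitian (k, l, b) v).
  by rewrite !pair_bigA; apply: eq_bigr => -[[k l] b] _.
transitivity (\sum_k \sum_l 2 *: (y k l (y l k v) + y l k (y k l v))).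
  apply: eq_bigr => k _; apply: eq_bigr => l _; rewrite big_bool /=.
  rewrite !yZ !yB !yD -scalerBr scalerA -expr2 sqrCi scaleN1r.
  set A := y k l (y k l v); set B := y k l (y l k v).
  set D := y l k (y k l v); set E := y l k (y l k v).
  rewrite (opprD (A - B)) opprK addrACA opprB [A + B]addrC.
  rewrite (addrACA B A) (addrACA D E) !subrr !addr0.
  by rewrite scaler_nat mulr2n addrACA.
under eq_bigr do rewrite -scaler_sumr big_split /=.
rewrite -scaler_sumr big_split /= [X in _ + X]exchange_big /= -/(casimir v).
by rewrite scalerDr -scalerDl -natrD.
Qed.

(** The Casimir operator commutes with the [y k l], so it vanishes on the whole finite-dimensional
    space [gen v]. There it is a quarter of the sum of the squares of the Hermitian operators, which
    all vanish by [sum_squares_eq0]. *)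
Lemma casimir_ker v : casimir v = 0 -> forall k l, y k l v = 0.
Proof.
move=> cv0; have [s genS] := casimir_generated_finite v.
have sgen : subspace (gen v) by exact: generated_subspace.
have [d [f [lin_f inj_f genf]]] := subspace_coordinates sgen genS.
have gen_h x u : gen v u -> gen v (hermitian x u).
  case: x => [[k l] []] gu /=; first by apply: (subspaceD sgen); exact: gen_y.
  by apply: (subspaceZ _ sgen); apply: (subspaceB sgen); exact: gen_y.
have exA x := coordinates_matrix lin_f genf (@lin_h x) (gen_h x).
have [A fA] := choice exA.
have f0 : f 0 = 0 by have := lin_f (-1) 0 0; rewrite !scaleN1r oppr0 addr0 addNr.
have fD u w : f (u + w) = f u + f w by rewrite -[u in LHS]scale1r lin_f scale1r.
have cgen u : gen v u -> casimir u = 0.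
  move=> gu; apply: (gu (fun w => casimir w = 0)) => // [|[k l] w cw].
    by split=> // c a b ca cb; rewrite casimir_linear ca cb scaler0 addr0.
  by rewrite -casimir_comm cw y0.
have A0 : forall x, A x = 0.
  apply: sum_squares_eq0 => [x|].
    apply: (coordinates_eigenspan lin_f inj_f sgen genf (@lin_h x) (gen_h x) (fA x)).
    by move=> w _; exact: real_y.
  apply/row_matrixP => i; rewrite row0 rowE; apply: inj_f.
  rewrite f0 mulmx_sumr (big_morph f fD f0).
  transitivity (4 *: casimir (f (delta_mx 0 i))).
    by rewrite -hermitian_squares; apply: eq_bigr => x _; rewrite mulmxA !fA.
  by rewrite cgen ?scaler0 //; apply/genf; exists (delta_mx 0 i).
have /genf[c cE] : gen v v by exact: generated_self.
move=> k l; rewrite y_hermitian -cE -!fA !A0 !mulmx0 f0 !scaler0.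
exact: subrr.
Qed.

Lemma casimir_ker2 v : casimir (casimir v) = 0 -> casimir v = 0.
Proof.
move=> /casimir_ker ycv; rewrite /casimir big1 // => k _; apply: big1 => l _.
by apply: casimir_ker; rewrite -casimir_comm ycv.
Qed.

(* Finite-dimensionality of [gen v] makes [casimir] bijective on its own image. *)
Lemma casimir_decomposition v : exists v', gen v v' /\ forall k l, y k l (v - casimir v') = 0.
Proof.
have [s genS] := casimir_generated_finite v.
have sgen : subspace (gen v) by exact: generated_subspace.
have [d [f [lin_f inj_f genf]]] := subspace_coordinates sgen genS.
have [A fA] := coordinates_matrix lin_f genf casimir_linear (@gen_casimir v).
have f0 : f 0 = 0 by have := lin_f (-1) 0 0; rewrite !scaleN1r oppr0 addr0 addNr.
have capA : (A :&: kermx A)%MS = 0.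
  apply/eqP; rewrite -submx0; apply/rV_subP => w; rewrite sub_capmx => /andP[].
  move=> /submxP[u ->] /sub_kermxP uAA; rewrite submx0; apply/eqP; apply: inj_f.
  by rewrite f0 fA; apply: casimir_ker2; rewrite -!fA uAA f0.
have rkA : \rank (A *m A) = \rank A.
  by have := mxrank_mul_ker A A; rewrite capA mxrank0 addn0.
have sAA : (A <= A *m A)%MS.
  by rewrite -(geq_leqif (mxrank_leqif_sup (submxMl A A))) rkA.
have /genf[c cE] : gen v v by exact: generated_self.
have /submxP[c' c'E] : (c *m A <= A *m A)%MS by apply: submx_trans sAA; exact: submxMl.
exists (f c'); split; first by apply/genf; exists c'.
apply: casimir_ker; have -> : v - casimir (f c') = -1 *: casimir (f c') + v.
  by rewrite scaleN1r addrC.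
rewrite casimir_linear -cE -!fA -mulmxA -c'E.
by rewrite scaleN1r addNr.
Qed.

(** By [casimir_decomposition] a vector [y k l u] equals [y k l (casimir u'')] for some [u''], so it
    lies in the image of the Casimir operator. This image meets the kernel only in zero, by
    [casimir_ker2]. *)
Lemma casimir_invariants v :
  lin_span [set w | exists k l u, w = y k l u] v -> (forall k l, y k l v = 0) -> v = 0.
Proof.
move=> span_v yv0.
have [u vE] : exists u, v = casimir u.
  elim: span_v {yv0} => [|c _ w [k [l [u ->]]] _ [u' ->]].
    by exists 0; rewrite casimir0.
  have [u'' [_ yu'']] := casimir_decomposition u.
  exists (c *: y k l u'' + u'); rewrite casimir_linear -casimir_comm; congr (_ *: _ + _).
  by apply/eqP; rewrite -subr_eq0 -yB yu''.
have cv0 : casimir v = 0 by rewrite /casimir big1 // => k _; rewrite big1 // => l _; rewrite yv0 y0.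
by rewrite vE; apply: casimir_ker2; rewrite -vE.
Qed.

End Casimir.

(** * Weights of the tensor modules *)

Section PureTensors.
Variables (F : fieldType) (t : series) (p q : nat).
Local Notation slot := ('I_p + 'I_q)%type.
Local Notation multi_index := {ffun slot -> nat}.
Local Notation tensor := (Defs.tensor F p q).
Implicit Types (u : slot -> nat -> F^o) (s : slot) (I : multi_index).

Definition fin_vec (v : nat -> F^o) := exists n, forall k, (n <= k)%N -> v k = 0.

Lemma fin_vec_subspace : subspace fin_vec.
Proof.
split=> [|a v w [n vn] [m wm]]; first by exists 0%N.
exists (maxn n m) => k; rewrite geq_max => /andP[nk mk].
by change (a * v k + w k = 0); rewrite vn // wm // mulr0 addr0.
Qed.

Definition basis_vec k : nat -> F^o := fun i => (i == k)%:R.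

Lemma fin_vec_basis k : fin_vec (basis_vec k).
Proof. by exists k.+1 => i ki; rewrite /basis_vec gtn_eqF. Qed.

Lemma finite_boxes n : finite_set [set I : multi_index | forall s, (I s < n)%N].
Proof.
pose g (J : {ffun slot -> 'I_n}) : multi_index := [ffun s => nat_of_ord (J s)].
apply: (@sub_finite_set _ _ (g @` setT)).
  move=> I /= In; exists [ffun s => Ordinal (In s)] => //.
  by apply/ffunP => s; rewrite !ffunE.
by apply: finite_image; exact: finite_finset.
Qed.

Lemma fin_supp_boxed (f : multi_index -> F^o) n :
  (forall (I : multi_index) s, (n <= I s)%N -> f I = 0) -> f \in @fin_supp F p q.
Proof.
move=> fn; apply/asboolP; apply: sub_finite_set (finite_boxes n) => I /= fI s.
by rewrite ltnNge; apply/negP => ns; apply: fI; exact: fn ns.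
Qed.

Lemma pure_tensor_fin_supp u : (forall s, fin_vec (u s)) ->
  (pure_tensor u : multi_index -> F^o) \in @fin_supp F p q.
Proof.
move=> fu; have [n nP] := choice fu.
apply: (@fin_supp_boxed _ (\max_s n s)) => I s nI.
rewrite /pure_tensor (bigD1 s) //= nP ?mul0r //.
by apply: leq_trans nI; exact: leq_bigmax.
Qed.

(* [0] unless all the [u s] have finite support. *)
Definition ptensor u : tensor :=
  if pselect ((pure_tensor u : multi_index -> F^o) \in @fin_supp F p q) is left e
  then Tensor e else 0.

Lemma ptensorE u I : (forall s, fin_vec (u s)) -> tval (ptensor u) I = \prod_s u s (I s).
Proof.
by move=> fu; rewrite /ptensor; case: pselect => // /(_ (pure_tensor_fin_supp fu)).
Qed.

Lemma tensor_ext (f g : tensor) : (forall I, tval f I = tval g I) -> f = g.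
Proof. by move=> fg; apply: val_inj; apply/funext => I; exact: fg. Qed.

Definition upd_vec u s (v : nat -> F^o) : slot -> nat -> F^o :=
  fun s' => if s' == s then v else u s'.

Lemma fin_upd_vec u s v : (forall s', s' != s -> fin_vec (u s')) -> fin_vec v ->
  forall s', fin_vec (upd_vec u s v s').
Proof. by move=> fu fv s'; rewrite /upd_vec; case: eqVneq => // /fu. Qed.

Lemma ptensor_linear u s a v w : (forall s', s' != s -> fin_vec (u s')) ->
  fin_vec v -> fin_vec w ->
  ptensor (upd_vec u s (a *: v + w)) = a *: ptensor (upd_vec u s v) + ptensor (upd_vec u s w).
Proof.
move=> fu fv fw; apply: tensor_ext => I.
have favw : fin_vec (a *: v + w) by apply: (proj2 fin_vec_subspace).
change (tval (ptensor (upd_vec u s (a *: v + w))) I =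
  a * tval (ptensor (upd_vec u s v)) I + tval (ptensor (upd_vec u s w)) I).
rewrite !ptensorE; try exact: fin_upd_vec.
have E (x : nat -> F^o) : \prod_s' upd_vec u s x s' (I s') =
    x (I s) * \prod_(s' | s' != s) u s' (I s').
  rewrite (bigD1 s) //= /upd_vec eqxx; congr (_ * _).
  by apply: eq_bigr => s' /negPf ->.
by rewrite !E mulrA -mulrDl.
Qed.

Definition basis_tensor (I : multi_index) : tensor := ptensor (fun s => basis_vec (I s)).

Lemma basis_tensorE I J : tval (basis_tensor I) J = (J == I)%:R.
Proof.
rewrite ptensorE => [|s]; last exact: fin_vec_basis.
exact: pure_tensor_basis.
Qed.

Lemma tensor_sum_fun (T : Type) (r : seq T) (g : T -> tensor) I :
  tval (\sum_(i <- r) g i) I = \sum_(i <- r) tval (g i) I.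
Proof. by elim: r => [|i r IH]; rewrite ?big_nil // !big_cons -IH. Qed.

Lemma tensor_support (f : tensor) : exists r : seq multi_index, uniq r /\
  forall I, I \notin r -> tval f I = 0.
Proof.
have /asboolP/finite_seqP[r rE] := tvalP f.
exists (undup r); split=> [|I]; first exact: undup_uniq.
rewrite mem_undup => Ir; apply: contrapT => fI.
have : [set I | tval f I <> 0] I by [].
by rewrite rE /=; exact/negP.
Qed.

Lemma tensor_basis_sum (f : tensor) (r : seq multi_index) : uniq r ->
  (forall I, I \notin r -> tval f I = 0) ->
  f = \sum_(I <- r) (tval f I : F) *: basis_tensor I.
Proof.
move=> ur f0; apply: tensor_ext => J; rewrite tensor_sum_fun.
transitivity (\sum_(I <- r) tval f I * (J == I)%:R); last first.
  by apply: eq_bigr => I _; rewrite -basis_tensorE.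
have [Jr|Jr] := boolP (J \in r); last first.
  rewrite f0 // big1_seq // => I /andP[_ Ir].
  by case: eqVneq Ir Jr => [-> ->|]; rewrite ?mulr0.
rewrite (big_rem J) //= eqxx mulr1 big1_seq ?addr0 // => I /andP[_].
by rewrite mem_rem_uniq // inE => /andP[/negPf IJ _]; rewrite eq_sym IJ mulr0.
Qed.

Definition weight_vec (h : set (ginf F t)) s : set (nat -> F^o) :=
  [set v | fin_vec v /\ exists lam : h -> F, forall x : h,
    (vact (slot_mx (gc (set_val x)) s) v : nat -> F^o) = lam x *: v].

Lemma ptensor_weight (h : set (ginf F t)) u :
  (forall s, weight_vec h s (u s)) -> is_weight_vector h (ptensor u).
Proof.
move=> wu; have fu s : fin_vec (u s) by case: (wu s).
have exlam s : exists lam : h -> F, forall x : h,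
    (vact (slot_mx (gc (set_val x)) s) (u s) : nat -> F^o) = lam x *: u s.
  by case: (wu s).
have [lam lamE] := choice exlam.
exists (fun x => \sum_s lam s x) => x; apply: tensor_ext => I.
have [n bx] : exists n, @bounded F n (gval (set_val x)) := ginf_boundedE _.
change (@tens_act F p q (gval (set_val x)) (tval (ptensor u)) I =
  (\sum_s lam s x) * tval (ptensor u) I).
have -> : tval (ptensor u) = pure_tensor u.
  by apply/funext => J; rewrite ptensorE.
rewrite (tens_act_pure _ bx) mulr_suml; apply: eq_bigr => s _.
rewrite /pure_tensor (bigD1 s) //= eqxx [in RHS](bigD1 s) //= -/(gc (set_val x)) lamE.
change (lam s x * u s (I s) * \prod_(i | i != s)
  (if i == s then lam s x *: u s else u i) (I i) =
  lam s x * (u s (I s) * \prod_(i | i != s) u i (I i))).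
rewrite mulrA; congr (_ * _); by apply: eq_bigr => i /negPf ->.
Qed.

(** Slots are treated one at a time: [l] lists those whose vector need not yet be a weight vector,
    and multilinearity in the slot [s] replaces that vector by weight vectors. *)
Lemma tensor_weight_spanned (h : set (ginf F t)) :
  (forall s k, lin_span (weight_vec h s) (basis_vec k)) -> weight_spanned h tensor.
Proof.
move=> spanV.
pose W s := lin_span (weight_vec h s).
have finW s v : W s v -> fin_vec v.
  by apply: lin_span_min; [exact: fin_vec_subspace|move=> w []].
have step (l : seq slot) : forall u, (forall s, s \notin l -> weight_vec h s (u s)) ->
    (forall s, W s (u s)) -> lin_span (is_weight_vector h (M:=tensor)) (ptensor u).
  elim: l => [|s l IH] u uw uW.
    by apply: lin_span_sub; apply: ptensor_weight => s; exact: uw.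
  have fu s' : s' != s -> fin_vec (u s') by move=> _; exact: finW (uW s').
  have <- : upd_vec u s (u s) = u.
    by apply/funext => s'; rewrite /upd_vec; case: eqP => // ->.
  have uWv v s' : W s v -> W s' (upd_vec u s v s').
    by rewrite /upd_vec; case: eqVneq => // ->.
  suff main v : W s v -> lin_span (is_weight_vector h (M:=tensor)) (ptensor (upd_vec u s v)).
    exact: main (uW s).
  elim=> [|a {}v w wv Ww IHw].
    have -> : ptensor (upd_vec u s 0) = 0; last exact: lin_span0.
    apply: tensor_ext => I; rewrite ptensorE.
      by rewrite (bigD1 s) //= /upd_vec eqxx mul0r.
    by apply: fin_upd_vec => //; exact: (proj1 fin_vec_subspace).
  rewrite ptensor_linear //; [|by case: wv|exact: finW Ww].
  apply: subspaceD => //; first exact: lin_span_subspace.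
  apply: subspaceZ; first exact: lin_span_subspace.
  apply: IH => s'; last by apply: uWv; exact: lin_span_sub.
  by rewrite /upd_vec; case: eqVneq => [->//|s's s'l]; apply: uw; rewrite inE negb_or s's.
move=> f; have [r [ur f0]] := tensor_support f.
rewrite (tensor_basis_sum ur f0); apply: subspace_sum => [|I _].
  exact: lin_span_subspace.
apply: subspaceZ; first exact: lin_span_subspace.
apply: (step (enum {: slot})) => s; first by rewrite mem_enum.
exact: spanV.
Qed.

End PureTensors.

(** * The natural and conatural modules as weight modules *)

Section NaturalWeights.
Variable F : fieldType.
Implicit Types (t : series) (X Y : nat -> nat -> F).
Local Notation V := (nat -> F^o).

(** For [l] beyond the support of [w], the entry [(i, l)] of the bracket of [w] with [gy] at [k],
    [l] is that of [w] at [(i, k)]. *)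
Lemma ginf_center t (w : ginf F t) : (forall x : ginf F t, bracket w x = 0) -> w = 0.
Proof.
move=> wx0; have [n bw] := ginf_boundedE w.
apply: ginf_ext => i k; change (gc w i k = 0).
(* The margin keeps [l] and its partner beyond [n], and puts [l] in another cell than [k]. *)
pose l := (n + k).+4; have dln : (n <= dl t l)%N by rewrite /l; case: (t) => /=; [lia|lia|lia|case: ifP; lia].
have kl : cell t k != cell t l by rewrite /l; case: (t) => /=; lia.
have [klF fkl] := cell_neq F kl.
have := congr1 (fun x => gc x i l) (wx0 (gy F t l.+1 k l)).
have -> : gc (0 : ginf F t) i l = 0 by [].
have nl : (n <= l)%N by rewrite /l; lia.
change (gc (bracket w (gy F t l.+1 k l)) i l = 0 -> gc w i k = 0).
rewrite gc_bracket (mulinf_gyr _ _ _ _ _ _ bw) (mulinf_gyl _ _ _ _ _ _ bw).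
rewrite eqxx mulr1 klF fkl !mulr0 (bw l l) ?nl // mulr0 (bw (dl t k) l) ?nl ?orbT //.
by rewrite mulr0 !mul0r !if_same_SL subr0 subrr subr0.
Qed.

Definition mx_vec n (u : 'cV[F]_n) : V := fun i => if insub i is Some i' then u i' 0 else 0.

Lemma mx_vec_linear n : linear (@mx_vec n).
Proof.
move=> a u v; apply/funext => i.
change (mx_vec (a *: u + v) i = a * mx_vec u i + mx_vec v i).
by rewrite /mx_vec; case: insubP => [i' _ _|_]; rewrite ?mxE // mulr0 addr0.
Qed.

Lemma vact_corner n (B : 'M[F]_n) (u : 'cV[F]_n) :
  vact (corner B) (mx_vec u) = mx_vec (B *m u).
Proof.
apply/funext => i; rewrite (vactE _ _ (corner_bounded B)) /mx_vec.
rewrite /corner; case: insubP => [i' _ _|_]; last by rewrite big1 // => k _; rewrite mul0r.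
by rewrite mxE; apply: eq_bigr => k _; rewrite !valK.
Qed.

Lemma vact_linear n X : bounded n X -> linear (vact X : V -> V).
Proof.
move=> bX a u v; apply/funext => i.
change (vact X (fun k => a * u k + v k) i = a * vact X u i + vact X v i).
rewrite !(vactE _ _ bX) mulr_sumr -big_split; apply: eq_bigr => k _ /=; ring.
Qed.

(** Cutting [v] at [n] leaves a tail killed by [corner B], an eigenvector for [0]; the head is
    expanded in the columns of the inverse of [P], eigenvectors of [B]. *)
Lemma diagonalizable_eigenspan n (B : 'M[F]_n) (v : V) : diagonalizable B ->
  lin_span (eigenvectors (vact (corner B) : V -> V) setT) v.
Proof.
move=> [P Pu /diagonalizable_forPex[d /(simmxRL Pu) dB]].
pose vn : 'cV_n := \col_i v i; pose u := mx_vec vn.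
have -> : v = u + (v - u) by rewrite addrC subrK.
apply: subspaceD; first exact: lin_span_subspace; last first.
  apply: lin_span_sub; exists 0 => //; apply/funext => i; rewrite scale0r.
  rewrite (vactE _ _ (corner_bounded B)) big1 // => k _.
  change (corner B i k * (v k - u k) = 0).
  by rewrite /u /mx_vec valK mxE subrr mulr0.
pose w := P *m vn.
have -> : u = \sum_i w i 0 *: mx_vec (col i (invmx P)).
  have vnE : vn = \sum_i w i 0 *: col i (invmx P).
    rewrite -[LHS](mulKmx Pu) -/w.
    apply/colP => k; rewrite mxE summxE; apply: eq_bigr => i _; rewrite !mxE; ring.
  rewrite /u vnE; elim/big_rec2: _ => [|i y x _ <-]; last by rewrite mx_vec_linear.
  apply/funext => i; rewrite /mx_vec; by case: insubP => // i' _ _; rewrite mxE.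
apply: subspace_sum => [|i _]; first exact: lin_span_subspace.
apply: subspaceZ; first exact: lin_span_subspace.
apply: lin_span_sub; exists (d 0 i) => //; rewrite vact_corner.
have Bc : B *m col i (invmx P) = d 0 i *: col i (invmx P).
  have : B *m invmx P = invmx P *m diag_mx d by rewrite dB !mulmxA mulVmx // mul1mx.
  move/(congr1 (col i)); rewrite !colE -mulmxA => ->; rewrite -mulmxA -!colE.
  apply/colP => k; rewrite !mxE (bigD1 i) //= big1 ?addr0 => [|j ji].
    by rewrite !mxE eqxx mulr1n mulrC.
  by rewrite !mxE (negPf ji) mulr0n mulr0.
rewrite Bc; apply/funext => k.
change (mx_vec (d 0 i *: col i (invmx P)) k = d 0 i * mx_vec (col i (invmx P)) k).
by rewrite /mx_vec; case: insubP => [k' _ _|_]; rewrite ?mxE // mulr0.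
Qed.

Lemma diagonalizable_trN n (A : 'M[F]_n) : diagonalizable A -> diagonalizable (- A^T).
Proof.
move=> [P Pu /diagonalizable_forPex[d /(simmxP Pu) PA]].
exists (invmx P^T); first by rewrite unitmx_inv unitmx_tr.
apply/diagonalizable_forPex; exists (- d); apply/simmxP; first by rewrite unitmx_inv unitmx_tr.
have := congr1 trmx PA; rewrite !trmx_mul tr_diag_mx => AP.
have PTu : P^T \in unitmx by rewrite unitmx_tr.
have -> : diag_mx (- d) = - diag_mx d by rewrite linearN.
rewrite mulmxN mulNmx; congr (- _).
by rewrite -[LHS]mulmx1 -(mulmxV PTu) !mulmxA -[invmx P^T *m _ *m _]mulmxA AP mulKmx.
Qed.

Variables (p q : nat).
Local Notation slot := ('I_p + 'I_q)%type.
Implicit Type s : slot.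

Lemma slot_mx_corner n (A : 'M[F]_n) s : diagonalizable A ->
  exists2 B : 'M[F]_n, diagonalizable B & slot_mx (corner A) s = corner B.
Proof.
case: s => s dA /=; first by exists A.
exists (- A^T); first exact: diagonalizable_trN.
apply/funext => i; apply/funext => j; rewrite /dualinf /corner.
by case: insubP => [i' _ _|_]; case: insubP => [j' _ _|_]; rewrite ?mxE ?oppr0.
Qed.

Lemma slot_mx_lin t a (x y : ginf F t) s i j :
  slot_mx (gc (a *: x + y)) s i j = a * slot_mx (gc x) s i j + slot_mx (gc y) s i j.
Proof. by case: s => s //=; rewrite /dualinf mulrN -opprD. Qed.

Lemma vact_lin t a (x y : ginf F t) s (v : V) :
  (vact (slot_mx (gc (a *: x + y)) s) v : V) =
  a *: (vact (slot_mx (gc x) s) v : V) + vact (slot_mx (gc y) s) v.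
Proof.
have [n [bx by_]] : exists n, bounded n (gc x) /\ bounded n (gc y) := ginf_bounded x y.
have bxy : bounded n (gc (a *: x + y)).
  by move=> i j ij; change (a * gc x i j + gc y i j = 0); rewrite bx // by_ // mulr0 addr0.
apply/funext => i; change (vact (slot_mx (gc (a *: x + y)) s) v i =
  a * vact (slot_mx (gc x) s) v i + vact (slot_mx (gc y) s) v i).
rewrite !(@vactE _ n); try exact: slot_mx_bounded.
rewrite mulr_sumr -big_split; apply: eq_bigr => k _ /=; rewrite slot_mx_lin; ring.
Qed.

Lemma vact_bracket t (x y : ginf F t) s (v : V) :
  (vact (slot_mx (gc (bracket x y)) s) v : V) =
  (vact (slot_mx (gc x) s) (vact (slot_mx (gc y) s) v) : V)
  - vact (slot_mx (gc y) s) (vact (slot_mx (gc x) s) v).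
Proof.
have [n [bx by_]] : exists n, bounded n (gc x) /\ bounded n (gc y) := ginf_bounded x y.
apply/funext => i; pose I : {ffun slot -> nat} := [ffun=> i].
have := @slot_act_commutator F p q n (gc x) (gc y) s (fun J => v (J s)) I bx by_.
have upds l : upd I s l s = l by rewrite upd_same.
have Is : I s = i by rewrite ffunE.
rewrite /slot_act Is.
have E (Z W : nat -> nat -> F) :
   @vact F Z (fun l => @vact F W (fun m => v (upd (upd I s l) s m s)) (upd I s l s)) i =
   @vact F Z (vact W v) i.
  by congr (vact Z _ i); apply/funext => l; rewrite upds; congr (vact W _ l);
    apply/funext => m; rewrite upd_same.
have E' (Z : nat -> nat -> F) : @vact F Z (fun l => v (upd I s l s)) i = @vact F Z v i.
  by congr (vact Z _ i); apply/funext => l; rewrite upds.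
by rewrite !E E'.
Qed.

(* The image of an [ad h]-weight vector [x] is finite-dimensional and [h]-stable. *)
Lemma weight_vec_image t (h : set (ginf F t)) s (x : ginf F t) (al : h -> F) v :
  subalgebra h -> (forall z, h z -> semisimple z) ->
  (forall z w, h z -> h w -> bracket z w = 0) ->
  weight_space h (adjoint (ginf F t)) al x ->
  lin_span (weight_vec h s) (vact (slot_mx (gc x) s) v).
Proof.
move=> [h0 hP _] hss hcomm wx.
have [n bx] := ginf_boundedE x.
pose D (z : ginf F t) : V -> V := vact (slot_mx (gc z) s).
have lin_D z : linear (D z).
  by have [m bz] := ginf_boundedE z; apply: vact_linear; exact: slot_mx_bounded bz.
have D0 z : D z 0 = 0 by have := lin_D z (-1) 0 0; rewrite !scaleN1r oppr0 addr0 addNr.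
pose P : set V := [set w | exists u, w = D x u].
have sP : subspace P.
  split=> [|a _ _ [u ->] [w ->]]; first by exists 0.
  by exists (a *: u + w); rewrite lin_D.
pose bs := [seq basis_vec F k | k <- iota 0 n].
have fin_lt w : (forall k, (n <= k)%N -> w k = 0) -> lin_span [set` bs] w.
  move=> wn; have -> : w = \sum_(k <- iota 0 n) (w k : F) *: basis_vec F k.
    apply/funext => i.
    have sum_fun (r : seq nat) : (\sum_(k <- r) (w k : F) *: basis_vec F k) i =
        \sum_(k <- r) w k * (i == k)%:R.
      by elim: r => [|k r IH]; rewrite ?big_nil // !big_cons -IH.
    rewrite sum_fun; have [ni|ni] := leqP n i.
      rewrite wn // big1_seq // => k /andP[_]; rewrite mem_iota add0n => /= kn.
      by rewrite gtn_eqF ?mulr0 //; exact: leq_trans ni.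
    rewrite (big_rem i) /= ?mem_iota ?add0n //= eqxx mulr1 big1_seq ?addr0 // => k.
    rewrite mem_rem_uniq ?iota_uniq // inE => /andP[_ /andP[/negPf ki _]].
    by rewrite eq_sym ki mulr0.
  apply: subspace_sum_seq => [|k kn]; first exact: lin_span_subspace.
  apply: subspaceZ; first exact: lin_span_subspace.
  by apply: lin_span_sub => /=; apply: map_f.
have Pbs : P `<=` lin_span [set` bs].
  move=> _ [u ->]; apply: fin_lt => k nk; rewrite /D (vactE _ _ (slot_mx_bounded s bx)).
  by apply: big1 => l _; rewrite (slot_mx_bounded s bx) ?nk // mul0r.
have finP w : P w -> fin_vec w.
  move=> /Pbs; apply: lin_span_min; first exact: fin_vec_subspace.
  by move=> _ /mapP[k _ ->]; exact: fin_vec_basis.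
have [d [f [lin_f inj_f Pf]]] := subspace_coordinates sP Pbs.
have Ph z : h z -> forall w, P w -> P (D z w).
  move=> hz _ [u ->]; have := wx (exist _ z (mem_set hz)).
  rewrite set_valE /= => zx; have := vact_bracket z x s u.
  have -> : bracket z x = al (exist _ z (mem_set hz)) *: x by exact: zx.
  rewrite -[al _ *: x]addr0 vact_lin -/(D x u) -/(D z _) -/(D z u) -/(D x _) -/(D 0 u).
  have -> : D 0 u = 0.
    apply/funext => k; rewrite /D (vactE _ _ (slot_mx_bounded s (n := 0%N) _)) ?big_ord0 //.
  rewrite addr0 => /esym/eqP; rewrite subr_eq => /eqP ->.
  by apply: subspaceD => //; [apply: subspaceZ => //; exists u|exists (D z u)].
(* Outside [h], where [P] need not be stable, the matrix is set to [0]. *)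
have exM z : exists M : 'M[F]_d, h z -> forall c, f (c *m M) = D z (f c).
  have [hz|nhz] := pselect (h z); last by exists 0.
  have [M fM] := coordinates_matrix lin_f Pf (lin_D z) (Ph z hz).
  by exists M.
have [M fM] := choice exM.
have mxext (A B : 'M[F]_d) : (forall c, f (c *m A) = f (c *m B)) -> A = B.
  move=> AB; apply/row_matrixP => i; rewrite !rowE; exact/inj_f/AB.
have Mlin a z w : h z -> h w -> M (a *: z + w) = a *: M z + M w.
  move=> hz hw; apply: mxext => c; rewrite fM; last exact: hP.
  by rewrite mulmxDr -scalemxAr lin_f !fM // /D vact_lin.
have Mcomm z w : h z -> h w -> comm_mx (M z) (M w).
  move=> hz hw; apply: mxext => c; rewrite !mulmxA !fM //; apply/eqP; rewrite -subr_eq0.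
  have := vact_bracket w z s (f c); rewrite (hcomm _ _ hw hz) -!/(D _ _) => <-.
  apply/eqP/funext => k; rewrite /D (vactE _ _ (slot_mx_bounded s (n := 0%N) _)) ?big_ord0 //.
have Mdiag z : h z -> diagonalizable (M z).
  move=> hz; have [m [A [_ dA zA]]] := hss z hz.
  have [B dB zB] := slot_mx_corner s dA.
  have [|P0 [e [P0u P0M _]]] := @diagonalizable_of_span _ _ (M z) setT.
    apply: (coordinates_eigenspan lin_f inj_f sP Pf (lin_D z) (Ph z hz) (fM z hz)).
    move=> w _; rewrite /D; have -> : gc z = corner A := zA; rewrite zB.
    exact: diagonalizable_eigenspan.
  by exists P0 => //; apply/diagonalizable_forPex; exists e; apply/simmxP.
(* [h] may be infinite-dimensional, but the matrices of its elements fill a finite-dimensional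
   space; a simultaneous diagonalization of a finite spanning family diagonalizes all of them. *)
pose Q : set 'M[F]_d := [set B | exists2 z, h z & B = M z].
have sQ : subspace Q.
  split=> [|a _ _ [z hz ->] [w hw ->]].
    exists 0 => //; have := Mlin (-1) 0 0 h0 h0; rewrite !scaleN1r !addNr.
    by move=> ->.
  by exists (a *: z + w); [exact: hP|rewrite Mlin].
pose ds : seq 'M[F]_d := [seq delta_mx ij.1 ij.2 | ij : 'I_d * 'I_d].
have Qds : Q `<=` lin_span [set` ds].
  move=> B _; rewrite (matrix_sum_delta B); apply: subspace_sum => [|i _].
    exact: lin_span_subspace.
  apply: subspace_sum => [|j _]; first exact: lin_span_subspace.
  apply: subspaceZ; first exact: lin_span_subspace.
  by apply: lin_span_sub; apply/mapP; exists (i, j); rewrite ?mem_enum.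
have [e [g [lin_g _ Qg]]] := subspace_coordinates sQ Qds.
have Qgd i : Q (g (delta_mx 0 i)) by apply/Qg; exists (delta_mx 0 i).
have [P0 P0u /allP P0d] : codiagonalizable [seq g (delta_mx 0 i) | i : 'I_e].
  apply/codiagonalizableP; split=> [A B /mapP[i _ ->] /mapP[j _ ->]|A /mapP[i _ ->]].
    by have [z hz ->] := Qgd i; have [w hw ->] := Qgd j; exact: Mcomm.
  by have [z hz ->] := Qgd i; exact: Mdiag.
have diagM z : h z -> exists dz : 'rV_d, P0 *m M z = diag_mx dz *m P0.
  move=> hz; have /Qg[c <-] : Q (M z) by exists z.
  have g0 : g 0 = 0 by have := lin_g (-1) 0 0; rewrite !scaleN1r oppr0 addr0 addNr.
  rewrite (row_sum_delta c); elim/big_rec: _ => [|i y _ [dy yE]].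
    by exists 0; rewrite g0 mulmx0 linear0 mul0mx.
  have /P0d : g (delta_mx 0 i) \in [seq g (delta_mx 0 i) | i : 'I_e].
    by apply/mapP; exists i; rewrite ?mem_enum.
  move=> /diagonalizable_forPex[di /(simmxP P0u) diE].
  exists (c 0 i *: di + dy); rewrite lin_g mulmxDr -scalemxAr diE yE.
  by rewrite linearP /= mulmxDl -scalemxAl.
have /Pf[c cE] : P (vact (slot_mx (gc x) s) v) by exists v.
rewrite -cE -(mulmxKV P0u c) mulmx_sum_row.
have f0 : f 0 = 0 by have := lin_f (-1) 0 0; rewrite !scaleN1r oppr0 addr0 addNr.
elim/big_rec: _ => [|i y _ IH]; first by rewrite f0; exact: lin_span0.
rewrite lin_f; apply: lin_spanS => //; split.
  by apply: finP; apply/Pf; exists (row i P0).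
have exlam (z : h) : exists lam, D (set_val z) (f (row i P0)) = lam *: f (row i P0).
  have hz : h (set_val z) := set_valP z.
  have [dz dzE] := diagM _ hz; exists (dz 0 i).
  rewrite -fM // -row_mul dzE row_mul row_diag_mx -scalemxAl -rowE.
  by rewrite -[_ *: row i P0]addr0 lin_f f0 addr0.
by have [lam lamE] := choice exlam; exists lam.
Qed.

(** On an [h]-weight vector [z] and [w] act by scalars, so their bracket acts by zero. Weight
    vectors span the Lie algebra, whose centre is trivial. *)
Lemma toral_weight_comm t (h : set (ginf F t)) z w : subalgebra h ->
  weight_spanned h (adjoint (ginf F t)) -> h z -> h w -> bracket z w = 0.
Proof.
move=> [_ _ hbr] wg hz hw; apply: ginf_center => x.
have : lin_span (is_weight_vector h (M:=adjoint (ginf F t))) x by exact: wg.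
elim=> [|a u v [lam wu] _ IH].
  by have := bracket_linearr (bracket z w) (-1) 0 0; rewrite !scaleN1r oppr0 addr0 addNr.
rewrite bracket_linearr IH addr0.
have wz : bracket z u = lam (exist _ z (mem_set hz)) *: u := wu (exist _ z (mem_set hz)).
have ww : bracket w u = lam (exist _ w (mem_set hw)) *: u := wu (exist _ w (mem_set hw)).
have -> : bracket (bracket z w) u = bracket z (bracket w u) - bracket w (bracket z u).
  exact: (@lact_bracket _ _ (adjoint (ginf F t)) z w u).
have bZ b (x' v' : ginf F t) : bracket x' (b *: v') = b *: bracket x' v'.
  by exact: (@lactZ _ _ (adjoint (ginf F t)) x' b v').
by rewrite wz ww !bZ wz ww !scalerA [X in X *: _ - _]mulrC subrr scaler0.
Qed.

(** The vector [basis_vec F k] is the image of another basis vector under an element of the Lie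
    algebra. That element is a sum of weight vectors for the adjoint action of [h], and
    [weight_vec_image] applies to each of them. *)
Lemma splitting_natural_weight t (h : set (ginf F t)) s k :
  splitting_cartan h -> lin_span (weight_vec h s) (basis_vec F k).
Proof.
move=> [[[subh hss] _] /weight_moduleP wg].
pose l := k.+4; pose z := l.+4.
have kl : cell t k != cell t l by rewrite /l; case: (t) => /=; lia.
have [klF fkl] := cell_neq F kl.
have spanD (x : ginf F t) v : lin_span (weight_vec h s) (vact (slot_mx (gc x) s) v).
  have : lin_span (is_weight_vector h (M:=adjoint (ginf F t))) x by exact: wg.
  elim=> [|a u w [lam wu] _ IH].
    have -> : vact (slot_mx (gc (0 : adjoint (ginf F t))) s) v = 0 :> V.
      apply/funext => i.
      by rewrite (vactE _ _ (slot_mx_bounded s (n := 0%N) _)) ?big_ord0.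
    exact: lin_span0.
  have -> : vact (slot_mx (gc (a *: u + w : adjoint (ginf F t))) s) v =
    a *: (vact (slot_mx (gc u) s) v : V) + vact (slot_mx (gc w) s) v :> V := vact_lin a u w s v.
  apply: (proj2 (lin_span_subspace _)) => //.
  apply: weight_vec_image wu => // z' w' hz' hw'.
  exact: (toral_weight_comm subh wg).
have vbasis (Y : nat -> nat -> F) m i : vact Y (basis_vec F m) i = Y i m.
  rewrite /vact (@fsum_single _ _ m) /basis_vec ?eqxx ?mulr1 // => j /negPf ->.
  by rewrite mulr0.
have lkF : (l == k) = false by rewrite eq_sym.
have gyl i : gc (gy F t z k l) i l = (i == k)%:R.
  by rewrite gc_gy eqxx andbT fkl mulr0 klF /= mulr0n if_same_SL subr0.
have gyl' i : gc (gy F t z l k) l i = (i == k)%:R.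
  by rewrite gc_gy eqxx /= fkl mul0r lkF /= mulr0n if_same_SL subr0.
case: s spanD => s spanD.
  have -> : basis_vec F k = vact (slot_mx (gc (gy F t z k l)) (inl s : slot)) (basis_vec F l).
    by apply/funext => i; rewrite vbasis; apply: esym; exact: gyl.
  exact: spanD.
have -> : basis_vec F k =
    -1 *: (vact (slot_mx (gc (gy F t z l k)) (inr s : slot)) (basis_vec F l) : V).
  apply/funext => i; change (basis_vec F k i =
    -1 * vact (slot_mx (gc (gy F t z l k)) (inr s : slot)) (basis_vec F l) i).
  rewrite vbasis mulN1r -[RHS]/(- - gc (gy F t z l k) l i) opprK.
  by apply: esym; exact: gyl'.
apply: subspaceZ; [exact: lin_span_subspace|exact: spanD].
Qed.

End NaturalWeights.

(** * A supply of splitting Cartan subalgebras *)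

Section Adjoint.
Variables (F : fieldType) (t : series).
Local Notation slot := ('I_1 + 'I_1)%type.
Local Notation V := (nat -> F^o).
Let s0 : slot := inl ord0.
Let s1 : slot := inr ord0.

Fact adjoint_tensor_subproof (x : adjoint (ginf F t)) :
  (fun I : {ffun slot -> nat} => gc x (I s0) (I s1) : F^o) \in @fin_supp F 1 1.
Proof.
have [n bx] := ginf_boundedE x.
apply: (@fin_supp_boxed _ _ _ _ n) => I [] s; rewrite (ord1 s) => nI; apply: bx;
by rewrite nI ?orbT.
Qed.

(** Matrices are tensors with one vector slot and one covector slot; the weight decomposition of the
    adjoint module is thus inherited from tensors. *)
Definition adjoint_tensor (x : adjoint (ginf F t)) : Defs.tensor F 1 1 :=
  Tensor (adjoint_tensor_subproof x).

Lemma adjoint_tensor_linear : linear adjoint_tensor.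
Proof. by move=> a x y; apply: tensor_ext. Qed.

Lemma adjoint_tensor_inj : injective adjoint_tensor.
Proof.
move=> x y xy; apply: ginf_ext => i j.
pose I : {ffun slot -> nat} := [ffun s => if s is inl _ then i else j].
by have := congr1 (fun f => tval f I) xy; rewrite /= !ffunE.
Qed.

Lemma adjoint_tensor_hom (x : ginf F t) (y : adjoint (ginf F t)) :
  adjoint_tensor (lact x y) = lact x (adjoint_tensor y).
Proof.
apply: tensor_ext => I.
change (gc (bracket x (y : ginf F t)) (I s0) (I s1) =
  @tens_act F 1 1 (gc x) (fun I => gc (y : ginf F t) (I s0) (I s1)) I).
rewrite gc_bracket /tens_act big_sumType !big_ord1 /= /slot_act; congr (_ + _).
  by apply: eq_fsbigr => k _; rewrite upd_same upd_other.
have [n bx] := ginf_boundedE x; have [m bY] := ginf_boundedE (y : ginf F t).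
have bx' : bounded n (dualinf (gc x)) by move=> i j ij; rewrite /dualinf bx ?oppr0 // orbC.
rewrite (vactE _ _ bx') (@mulinfE _ n); last by move=> k nk; rewrite bx ?nk // mulr0.
rewrite -sumrN; apply: eq_bigr => k _; rewrite upd_same upd_other // /dualinf; ring.
Qed.

Lemma adjoint_weight_spanned (h : set (ginf F t)) :
  (forall (s : slot) k, lin_span (weight_vec h s) (basis_vec F k)) ->
  weight_spanned h (adjoint (ginf F t)).
Proof.
move=> spanV; apply: weight_spanned_sub adjoint_tensor_linear adjoint_tensor_inj
  adjoint_tensor_hom _; exact: tensor_weight_spanned.
Qed.

(** In a basis that diagonalizes [z], a bracket with [z] has zero diagonal, while [c *: z] is
    diagonal. *)
Lemma semisimple_no_ladder (x z : ginf F t) c : semisimple z -> c != 0 ->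
  bracket x z = c *: z -> z = 0.
Proof.
move=> [n [A [_ [P Pu /diagonalizable_forPex[d /(simmxP Pu) PA]] zA]]] c0 xz.
have zE : gc z = corner A := zA.
pose X := \matrix_(i < mx_size t n, j < mx_size t n) gc x i j.
have XA : X *m A - A *m X = c *: A.
  apply/matrixP => i j; rewrite !mxE; have := congr1 (fun w => gc w i j) xz.
  rewrite gc_bracket gcZ zE cornerE => <-.
  congr (_ - _); rewrite (@mulinfE _ (mx_size t n)).
  - by apply: eq_bigr => k _; rewrite !mxE cornerE.
  - by move=> k nk; rewrite (corner_bounded A) ?nk // mulr0.
  - by apply: eq_bigr => k _; rewrite !mxE cornerE.
  - by move=> k nk; rewrite (corner_bounded A) ?nk ?orbT // mul0r.
have AE : A = invmx P *m diag_mx d *m P by rewrite -mulmxA -PA mulKmx.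
have d0 i : d 0 i = 0.
  pose Y := P *m X *m invmx P.
  have YD : Y *m diag_mx d - diag_mx d *m Y = c *: diag_mx d.
    have -> : diag_mx d = P *m A *m invmx P by rewrite PA mulmxK.
    rewrite scalemxAl scalemxAr -XA mulmxBr mulmxBl /Y !mulmxA.
    by congr (_ - _); rewrite -!mulmxA mulKmx.
  move/matrixP/(_ i i): YD; rewrite mul_mx_diag mul_diag_mx !mxE eqxx mulr1n mulrC subrr.
  by move/esym/eqP; rewrite mulf_eq0 (negPf c0) => /eqP.
have A0 : A = 0.
  have -> : A = invmx P *m diag_mx d *m P by [].
  have -> : d = 0 by apply/rowP => i; rewrite d0 mxE.
  by rewrite linear0 mulmx0 mul0mx.
apply: ginf_ext => i j; change (gc z i j = 0); rewrite zE A0 /corner.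
by case: insubP => // i' _ _; case: insubP => // j' _ _; rewrite mxE.
Qed.

End Adjoint.

(** * Cartan subalgebras from a pair of dual bases *)

Section AdaptedBasis.
Variables (F : fieldType) (t : series).
Local Notation slot := ('I_1 + 'I_1)%type.
Local Notation V := (nat -> F^o).
Let s0 : slot := inl ord0.
Let s1 : slot := inr ord0.

Definition dot (u v : V) : F := \sum_(k \in [set: nat]) u k * v k.

Lemma dotE (u v : V) n : (forall k, (n <= k)%N -> u k = 0) \/ (forall k, (n <= k)%N -> v k = 0) ->
  dot u v = \sum_(k < n) u k * v k.
Proof.
move=> uv; rewrite /dot (@sum_bounded _ n (fun k => (u k : F) * v k)) // => k nk.
by case: uv => [u0|v0]; rewrite ?u0 ?v0 ?mul0r ?mulr0.
Qed.

Variables (b bs : nat -> V) (prt : nat -> nat) (xb : nat -> ginf F t).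
Hypothesis fin_b : forall j, fin_vec (b j).
Hypothesis fin_bs : forall j, fin_vec (bs j).
Hypothesis biorth : forall i j, dot (bs i) (b j) = (i == j)%:R.
Hypothesis prt_neq : forall j, prt j != j.
Hypothesis span_b : forall k, lin_span (range b) (basis_vec F k).
Hypothesis span_bs : forall k, lin_span (range bs) (basis_vec F k).
Hypothesis xbE : forall j k l,
  gc (xb j) k l = b j k * bs j l - b (prt j) k * bs (prt j) l.
Hypothesis two_neq0 : 2 != 0 :> F.

Let D (x : ginf F t) : V -> V := vact (slot_mx (gc x) s0).
Let D' (x : ginf F t) : V -> V := vact (slot_mx (gc x) s1).

Definition basis_cartan : set (ginf F t) := [set x | forall j, exists mu : F,
  D x (b j) = mu *: b j /\ D' x (bs j) = - mu *: bs j].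

Let Dlin a x y v : D (a *: x + y) v = a *: D x v + D y v.
Proof. exact: vact_lin. Qed.
Let D'lin a x y v : D' (a *: x + y) v = a *: D' x v + D' y v.
Proof. exact: vact_lin. Qed.
Let Dbr x y v : D (bracket x y) v = D x (D y v) - D y (D x v).
Proof. exact: vact_bracket. Qed.
Let D'br x y v : D' (bracket x y) v = D' x (D' y v) - D' y (D' x v).
Proof. exact: vact_bracket. Qed.

Let lin_D x : linear (D x).
Proof. by have [m bz] := ginf_boundedE x; apply: vact_linear; exact: slot_mx_bounded bz. Qed.
Let lin_D' x : linear (D' x).
Proof. by have [m bz] := ginf_boundedE x; apply: vact_linear; exact: slot_mx_bounded bz. Qed.

Let D0 x : D x 0 = 0.
Proof. by have := lin_D x (-1) 0 0; rewrite !scaleN1r oppr0 addr0 addNr. Qed.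
Let D'0 x : D' x 0 = 0.
Proof. by have := lin_D' x (-1) 0 0; rewrite !scaleN1r oppr0 addr0 addNr. Qed.
Let DZ x a v : D x (a *: v) = a *: D x v.
Proof. by rewrite -[a *: v]addr0 lin_D D0 addr0. Qed.
Let D'Z x a v : D' x (a *: v) = a *: D' x v.
Proof. by rewrite -[a *: v]addr0 lin_D' D'0 addr0. Qed.

Let Dx j (v : V) : D (xb j) v = dot (bs j) v *: b j - dot (bs (prt j)) v *: b (prt j).
Proof.
have [n nP] := fin_bs j; have [m mP] := fin_bs (prt j); have [N bN] := ginf_boundedE (xb j).
pose M := maxn N (maxn n m).
have bM : bounded M (gc (xb j)) by apply: boundedW bN; lia.
apply/funext => k; rewrite /D /= (vactE _ _ bM).
rewrite !(@dotE _ _ M); try by left => i Mi; (apply: nP || apply: mP); lia.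
change (\sum_(i < M) gc (xb j) k i * v i = (\sum_(i < M) bs j i * v i) * b j k -
  (\sum_(i < M) bs (prt j) i * v i) * b (prt j) k).
by rewrite !mulr_suml -sumrB; apply: eq_bigr => i _; rewrite xbE; ring.
Qed.

Let D'x j (v : V) : D' (xb j) v = - (dot v (b j) *: bs j - dot v (b (prt j)) *: bs (prt j)).
Proof.
have [n nP] := fin_b j; have [m mP] := fin_b (prt j); have [N bN] := ginf_boundedE (xb j).
pose M := maxn N (maxn n m).
have bM : bounded M (dualinf (gc (xb j))).
  by move=> i i' ii'; rewrite /dualinf bN ?oppr0 //; move: ii'; rewrite /M; lia.
apply/funext => k; rewrite /D' /= (vactE _ _ bM).
rewrite !(@dotE _ _ M); try by right => i Mi; (apply: nP || apply: mP); lia.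
change (\sum_(i < M) dualinf (gc (xb j)) k i * v i =
  - ((\sum_(i < M) v i * b j i) * bs j k - (\sum_(i < M) v i * b (prt j) i) * bs (prt j) k)).
rewrite !mulr_suml -sumrB -sumrN; apply: eq_bigr => i _; rewrite /dualinf xbE; ring.
Qed.

(** By biorthogonality [xb j] has eigenvalue [1] on [b j], [-1] on [b (prt j)] and [0] on the other
    basis vectors; it isolates the line of [b j] in the proof of maximality. *)
Lemma basis_cartan_xb j : basis_cartan (xb j).
Proof.
move=> i; exists ((j == i)%:R - (prt j == i)%:R); rewrite Dx D'x !biorth; split.
  rewrite scalerBl; congr (_ - _).
    by case: eqVneq => [->//|_]; rewrite !scale0r.
  by case: eqVneq => [->//|_]; rewrite !scale0r.
rewrite scaleNr scalerBl [i == j]eq_sym [i == prt j]eq_sym; congr (- (_ - _)).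
  by case: eqVneq => [->//|_]; rewrite !scale0r.
by case: eqVneq => [->//|_]; rewrite !scale0r.
Qed.

Lemma basis_cartan_subalgebra : subalgebra basis_cartan.
Proof.
split=> [j|a x y hx hy j|x y hx hy j].
- exists 0; rewrite oppr0 !scale0r; split; apply/funext => k; rewrite /D /D'.
    by rewrite (vactE _ _ (slot_mx_bounded s0 (n := 0%N) _)) ?big_ord0.
  by rewrite (vactE _ _ (slot_mx_bounded s1 (n := 0%N) _)) ?big_ord0.
- have [mu [xb_ xbs]] := hx j; have [nu [yb ybs]] := hy j.
  exists (a * mu + nu); rewrite Dlin D'lin xb_ xbs yb ybs !scalerA -!scalerDl.
  by split=> //; congr (_ *: _); ring.
- have [mu [xb_ xbs]] := hx j; have [nu [yb ybs]] := hy j.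
  exists 0; rewrite Dbr D'br xb_ xbs yb ybs !DZ !D'Z xb_ xbs yb ybs !scalerA.
  by rewrite ![mu * nu]mulrC ![- mu * _]mulrC !subrr oppr0 !scale0r.
Qed.

(** The vectors [bs j], truncated to the size of a finite matrix [A] of [x], span the rows and are
    left eigenvectors of [A], since the dual action is minus the transpose. *)
Lemma basis_cartan_semisimple x : basis_cartan x -> semisimple x.
Proof.
move=> hx; have /asboolP[n [A [Ain xA]]] := gvalP x.
exists n, A; split=> //; set N := mx_size t n in A Ain xA *.
have xE : gc x = corner A := xA.
pose tr (v : V) : 'rV[F]_N := \row_i v i.
have lin_tr : linear tr by move=> a u v; apply/rowP => i; rewrite !mxE.
have trA mu (v : V) : D' x v = - mu *: v -> tr v *m A = mu *: tr v.
  move=> xv; apply/rowP => i; have := congr1 (fun w : V => w i) xv.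
  have bA : bounded N (dualinf (corner A)).
    by move=> k l kl; rewrite /dualinf corner_bounded ?oppr0 // orbC.
  rewrite /D' /= xE (vactE _ _ bA) => /(congr1 -%R) E; rewrite !mxE.
  transitivity (- \sum_(k < N) dualinf (corner A) i k * v k).
    rewrite -sumrN; apply: eq_bigr => k _; rewrite mxE /dualinf cornerE; ring.
  rewrite E; change (- (- mu * v i) = mu * v i); ring.
have [|P [d [Pu PA _]]] := @diagonalizable_of_span _ _ A setT.
  move=> c; have -> : c = \sum_i c 0 i *: tr (basis_vec F i).
    rewrite {1}(row_sum_delta c); apply: eq_bigr => i _; congr (_ *: _).
    by apply/rowP => k; rewrite !mxE eqxx /=.
  apply: subspace_sum => [|i _]; first exact: lin_span_subspace.
  apply: subspaceZ; first exact: lin_span_subspace.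
  apply: lin_spanW (lin_span_image lin_tr (span_bs i)) => _ [_ [j _ <-] <-].
  by have [mu [_ /trA]] := hx j; exists mu.
by exists P => //; apply/diagonalizable_forPex; exists d; apply/simmxP.
Qed.

Lemma basis_cartan_weight_vec (s : slot) k :
  lin_span (weight_vec basis_cartan s) (basis_vec F k).
Proof.
have dual_weight j : exists lam : basis_cartan -> F, forall x : basis_cartan,
    D (set_val x) (b j) = lam x *: b j /\ D' (set_val x) (bs j) = - lam x *: bs j.
  by have [lam lamE] := choice (fun x : basis_cartan => set_valP x j); exists lam.
case: s => s; rewrite (ord1 s).
  apply: lin_spanW (span_b k) => _ [j _ <-]; split=> //.
  by have [lam lamE] := dual_weight j; exists lam => x; case: (lamE x).
apply: lin_spanW (span_bs k) => _ [j _ <-]; split=> //.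
by have [lam lamE] := dual_weight j; exists (fun x => - lam x) => x; case: (lamE x).
Qed.

Lemma dot_adjoint x (u v : V) : fin_vec u -> fin_vec v -> dot (D' x u) v = - dot u (D x v).
Proof.
move=> [n nu] [m mv]; have [N bN] := ginf_boundedE x.
pose M := maxn N (maxn n m).
have bM : bounded M (gc x) by apply: boundedW bN; lia.
rewrite (@dotE _ _ M); last by right=> i Mi; apply: mv; lia.
rewrite (@dotE _ _ M); last by left=> i Mi; apply: nu; lia.
exact: (pairing_dualinf u v bM).
Qed.

(** Maximality: the weight components of an element [y] of a larger toral [h'] stay in [h'], hence
    are semisimple, and [semisimple_no_ladder] kills those not commuting with [xb j]. So [y]
    commutes with every [xb j], which forces each [b j] and [bs j] to be an eigenvector. *)
Lemma basis_cartan_splitting : splitting_cartan basis_cartan.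
Proof.
have wg := adjoint_weight_spanned basis_cartan_weight_vec.
split; last exact/weight_moduleP.
split; first by split; [exact: basis_cartan_subalgebra|exact: basis_cartan_semisimple].
move=> h' [[h'0 h'P h'br] h'ss] hh'; apply/seteqP; split=> // y h'y.
have sh' : subspace (h' : set (ginf F t)) by [].
have xy0 j : bracket (xb j) y = 0.
  have [s [w [us sw yE]]] := weight_spannedP (wg y).
  have h'w : forall i, i \in s -> h' (w i).
    apply: (@weight_components_stable _ _ basis_cartan (adjoint (ginf F t)) h') => //.
    - by move=> x v /hh' h'x h'v; exact: h'br.
    - by move=> i /sw[].
    - by rewrite -yE.
  rewrite yE.
  have -> : bracket (xb j) (\sum_(i <- s) w i : adjoint (ginf F t)) =
      \sum_(i <- s) (lact (xb j) (w i) : adjoint (ginf F t)).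
    exact: (@lact_sum _ _ (adjoint (ginf F t)) (xb j) _ s xpredT w).
  apply: big1_seq => i /andP[_ is_]; have [_ wi] := sw i is_.
  have hx := basis_cartan_xb j.
  pose zb : basis_cartan := exist _ (xb j) (mem_set hx).
  have xw : lact (xb j) (w i) = i zb *: w i := wi zb.
  rewrite xw; have [->|c0] := eqVneq (i zb) 0; first by rewrite scale0r.
  by rewrite (semisimple_no_ladder (h'ss _ (h'w _ is_)) c0 xw) scaler0.
have commD j v : D (xb j) (D y v) = D y (D (xb j) v).
  apply/eqP; rewrite -subr_eq0 -Dbr xy0; apply/eqP/funext => k; rewrite /D.
  by rewrite (vactE _ _ (slot_mx_bounded s0 (n := 0%N) _)) ?big_ord0.
have commD' j v : D' (xb j) (D' y v) = D' y (D' (xb j) v).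
  apply/eqP; rewrite -subr_eq0 -D'br xy0; apply/eqP/funext => k; rewrite /D'.
  by rewrite (vactE _ _ (slot_mx_bounded s1 (n := 0%N) _)) ?big_ord0.
have fin_act (s : slot) (x : ginf F t) v : fin_vec (vact (slot_mx (gc x) s) v : V).
  have [n bx] := ginf_boundedE x; exists n => k nk.
  by rewrite (vactE _ _ (slot_mx_bounded s bx)) big1 // => l _; rewrite (slot_mx_bounded s bx) ?nk // mul0r.
have pjj j : (prt j == j) = false by apply/negbTE.
have dotB u v w : fin_vec u -> dot u (v - w) = dot u v - dot u w.
  move=> [n nu]; rewrite !(@dotE _ _ n); try by left.
  by rewrite -sumrB; apply: eq_bigr => k _; rewrite -mulrBr.
have dotZ u a v : fin_vec u -> dot u (a *: v) = a * dot u v.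
  move=> [n nu]; rewrite !(@dotE _ _ n); try by left.
  rewrite mulr_sumr; apply: eq_bigr => k _; change (u k * (a * v k) = a * (u k * v k)); ring.
have dotC u v : dot u v = dot v u by apply: eq_fsbigr => k _; rewrite mulrC.
have eq2 a : a = - a -> a = 0 :> F.
  move/eqP; rewrite -subr_eq0 opprK -mulr2n -mulr_natl mulf_eq0 (negPf two_neq0).
  by move/eqP.
move=> j; exists (dot (bs j) (D y (b j))).
have yb : D y (b j) = dot (bs j) (D y (b j)) *: b j.
  set v := D y (b j).
  have xv : dot (bs j) v *: b j - dot (bs (prt j)) v *: b (prt j) = v.
    rewrite -Dx commD Dx !biorth eqxx pjj scale1r scale0r subr0 //.
  (* [v] is fixed by [xb j], which acts by [-1] on [b (prt j)]; so the coefficient of [v] there is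
     its own opposite. *)
  have /eq2 c0 : dot (bs (prt j)) v = - dot (bs (prt j)) v.
    rewrite -{1}xv dotB // !dotZ // !biorth pjj eqxx mulr0 mulr1 sub0r //.
  by rewrite -{1}xv c0 scale0r subr0.
split=> //.
have -> : - dot (bs j) (D y (b j)) = dot (D' y (bs j)) (b j) by rewrite dot_adjoint.
set v := D' y (bs j).
have fv : fin_vec v by exact: fin_act.
have xv : dot v (b j) *: bs j - dot v (b (prt j)) *: bs (prt j) = v.
  apply: oppr_inj; rewrite -D'x commD' D'x !biorth eqxx [j == _]eq_sym pjj.
  by rewrite scale1r scale0r subr0 -[- bs j]scaleN1r D'Z scaleN1r.
have /eq2 c0 : dot v (b (prt j)) = - dot v (b (prt j)).
  rewrite dotC -{1}xv dotB // !dotZ // ![dot (b (prt j)) _]dotC !biorth.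
  by rewrite [j == _]eq_sym pjj eqxx mulr0 mulr1 sub0r // dotC.
by rewrite -{1}xv c0 scale0r subr0.
Qed.

End AdaptedBasis.

(** * Dual bases twisted by an involution of the indices *)

Section InvolutionBasis.
Variables (F : fieldType) (t : series) (pi : nat -> nat) (c : nat -> F).
Local Notation slot := ('I_1 + 'I_1)%type.
Local Notation V := (nat -> F^o).
Local Notation sg := (@sg F).
Local Notation e_ := (basis_vec F).
Hypothesis piK : involutive pi.
Hypothesis pi_neq : forall j, pi j != j.
Hypothesis c_neq1 : forall j, 1 - c j * c (pi j) != 0.
Hypothesis two_neq0 : 2 != 0 :> F.

Let kap j : F := (1 - c j * c (pi j))^-1.

(** On the plane of [e_j] and [e_(pi j)] this is a change of basis with determinant
    [1 - c j * c (pi j)], whose inverse is [kap j]; [inv_cobasis] is read off from the inverse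
    matrix. *)
Definition inv_basis j : V := fun k => (k == j)%:R + c j * (k == pi j)%:R.
Definition inv_cobasis j : V := fun k => kap j * ((k == j)%:R - c (pi j) * (k == pi j)%:R).

Local Notation b := inv_basis.
Local Notation bs := inv_cobasis.

Let kap_pi j : kap (pi j) = kap j.
Proof. by rewrite /kap piK mulrC. Qed.

Let pi_eq i j : (pi i == j) = (i == pi j).
Proof. by rewrite -(inj_eq (can_inj piK)) piK. Qed.

Lemma fin_inv_basis j : fin_vec (b j).
Proof.
exists (maxn j (pi j)).+1 => k jk; rewrite /b.
have -> : (k == j) = false by lia.
have -> : (k == pi j) = false by lia.
by rewrite mulr0 addr0.
Qed.

Lemma fin_inv_cobasis j : fin_vec (bs j).
Proof.
exists (maxn j (pi j)).+1 => k jk; rewrite /bs.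
have -> : (k == j) = false by lia.
have -> : (k == pi j) = false by lia.
by rewrite mulr0 subr0 mulr0.
Qed.

Lemma dot_cobasis j (v : V) : dot (bs j) v = kap j * (v j - c (pi j) * v (pi j)).
Proof.
rewrite (@dotE _ _ _ (maxn j (pi j)).+1); last first.
  left=> k jk; rewrite /bs.
  have -> : (k == j) = false by lia.
  have -> : (k == pi j) = false by lia.
  by rewrite mulr0 subr0 mulr0.
transitivity (\sum_(k < (maxn j (pi j)).+1) (kap j * v k * ((k : nat) == j)%:R -
  kap j * c (pi j) * v k * ((k : nat) == pi j)%:R)).
  apply: eq_bigr => k _; rewrite /bs; ring.
rewrite sumrB (@ord_single _ _ (fun k => kap j * v k * (k == j)%:R) j).
- rewrite (@ord_single _ _ (fun k => kap j * c (pi j) * v k * (k == pi j)%:R) (pi j)).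
  + rewrite !eqxx /=; ring.
  + by move=> k _ /negPf ->; rewrite mulr0.
  + by move=> H; exfalso; move: H; lia.
- by move=> k _ /negPf ->; rewrite mulr0.
- by move=> H; exfalso; move: H; lia.
Qed.

Lemma inv_biorth i j : dot (bs i) (b j) = (i == j)%:R.
Proof.
rewrite dot_cobasis /b pi_eq (inj_eq (can_inj piK)).
case: (eqVneq i j) => [->|ij].
  have -> : (j == pi j) = false by rewrite eq_sym (negPf (pi_neq j)).
  by rewrite mulr0 mulr1 add0r addr0 /kap [c (pi j) * _]mulrC mulVf.
case: (eqVneq i (pi j)) => [->|_]; first by rewrite piK /= ?mulr0n ?mulr1n; ring.
by rewrite /= ?mulr0n; ring.
Qed.

Lemma inv_basis_span k : lin_span (range b) (e_ k).
Proof.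
have -> : e_ k = kap k *: (b k - c k *: b (pi k)).
  apply/funext => i; change (e_ k i = kap k * (b k i - c k * b (pi k) i)).
  rewrite /b piK; transitivity (kap k * ((1 - c k * c (pi k)) * (i == k)%:R)).
    by rewrite mulrA /kap mulVf // mul1r.
  by congr (_ * _); ring.
apply: subspaceZ; first exact: lin_span_subspace.
apply: subspaceB; first exact: lin_span_subspace.
  by apply: lin_span_sub; exists k.
apply: subspaceZ; first exact: lin_span_subspace.
by apply: lin_span_sub; exists (pi k).
Qed.

Lemma inv_cobasis_span k : lin_span (range bs) (e_ k).
Proof.
have -> : e_ k = c (pi k) *: bs (pi k) + bs k.
  apply/funext => i; change (e_ k i = c (pi k) * bs (pi k) i + bs k i).
  rewrite /bs piK kap_pi; transitivity (kap k * ((1 - c k * c (pi k)) * (i == k)%:R)).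
    by rewrite mulrA /kap mulVf // mul1r.
  by ring.
apply: lin_spanS; first by exists (pi k).
by apply: lin_span_sub; exists k.
Qed.

Variable prt : nat -> nat.
Hypothesis prt_neq : forall j, prt j != j.

Definition inv_coroot j : nat -> nat -> F := fun k l =>
  b j k * bs j l - b (prt j) k * bs (prt j) l.

Lemma inv_coroot_bounded j : exists n, bounded n (inv_coroot j).
Proof.
have [n1 b1] := fin_inv_basis j; have [n2 b2] := fin_inv_cobasis j.
have [n3 b3] := fin_inv_basis (prt j); have [n4 b4] := fin_inv_cobasis (prt j).
exists (maxn (maxn n1 n2) (maxn n3 n4)) => k l; rewrite /inv_coroot => /orP[H|H].
  by rewrite b1 ?b3 ?mul0r ?subr0 //; lia.
by rewrite b2 ?b4 ?mulr0 ?subr0 //; lia.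
Qed.

(* The partner condition says that the coroots lie in the Lie algebra. *)
Hypothesis partner : t = SL \/ t <> SL /\ forall j, exists2 ga : F, ga != 0 &
  forall m, b (prt j) m = ga * (sg t m * bs j (dl t m)) /\
            bs (prt j) m = ga^-1 * (sg t m * b j (dl t m)).

(** For [SL] both halves have trace one by biorthogonality. For a form, the second half is the
    adjoint of the first, by the partner condition. *)
Lemma inv_coroot_in j : (inv_coroot j : nat -> nat -> F^o) \in @in_infb F t.
Proof.
have [n bn] := inv_coroot_bounded j; apply/asboolP.
case: partner => [tSL|[tSL part]].
  have [n2 b2] := fin_inv_cobasis j; have [n4 b4] := fin_inv_cobasis (prt j).
  rewrite tSL; apply: (@in_inf_SLP _ (maxn n (maxn n2 n4))).
    by apply: boundedW bn; lia.
  have trE i : fin_vec (bs i) -> (forall k, (maxn n (maxn n2 n4) <= k)%N -> bs i k = 0) ->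
      \sum_(k < maxn n (maxn n2 n4)) b i k * bs i k = 1.
    move=> _ b0; have <- : dot (bs i) (b i) = 1 by rewrite inv_biorth eqxx.
    by rewrite (@dotE _ _ _ (maxn n (maxn n2 n4))); [apply: eq_bigr => k _; exact: mulrC|left].
  rewrite sumrB !trE ?subrr //; try exact: fin_inv_cobasis.
    by move=> k nk; apply: b4; lia.
  by move=> k nk; apply: b2; lia.
apply: in_inf_formP bn _ => // i k; have [ga ga0 gaE] := part j.
rewrite /inv_coroot; have bE m := proj1 (gaE m); have bsE m := proj2 (gaE m).
rewrite !bE !bsE !dlK !sg_dl; set e := form_sign F t.
have e2 : e * e = 1 := form_sign_sqr F t.
set A := b j _; set B := b j _; set C := bs j _; set D := bs j _.
have sk := sg_sqr F t k; have si := sg_sqr F t i.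
set s := sg t k in sk *; set s' := sg t i in si *.
have ga1 : ga * ga^-1 = 1 by rewrite mulfV.
transitivity (A * C * (e * s) - (ga * ga^-1) * (e * e) * (s * s) * s' * D * B
  + (s' * B * D - (ga * ga^-1) * (s' * s') * e * s * C * A)); first by ring.
rewrite ga1 e2 sk si; ring.
Qed.

Definition inv_xb j : ginf F t := Ginf (inv_coroot_in j).

Definition inv_cartan : set (ginf F t) := basis_cartan b bs.

Lemma inv_cartan_splitting : splitting_cartan inv_cartan.
Proof.
apply: (@basis_cartan_splitting F t b bs prt inv_xb) => //.
- exact: fin_inv_basis.
- exact: fin_inv_cobasis.
- exact: inv_biorth.
- exact: inv_basis_span.
- exact: inv_cobasis_span.
Qed.

End InvolutionBasis.

Section Partners.
Variables (F : fieldType) (t : series) (pi : nat -> nat) (c : nat -> F).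
Local Notation sg := (@sg F).
Hypothesis piK : involutive pi.
Hypothesis pi_dl : forall j, pi (dl t j) = dl t (pi j).
Local Notation b := (inv_basis pi c).
Local Notation bs := (inv_cobasis pi c).

Let ldl u v : (dl t u == v) = (u == dl t v).
Proof. by rewrite -(inj_eq (can_inj (@dlK t))) dlK. Qed.

Let sgd (m u : nat) : sg t m * (m == u)%:R = sg t u * (m == u)%:R.
Proof. by case: eqVneq => [->//|_]; rewrite !mulr0. Qed.

Let sg_dd i j : sg t (dl t i) * sg t (dl t j) = sg t i * sg t j.
Proof.
have e2 := form_sign_sqr F t; rewrite !sg_dl.
by rewrite mulrACA e2 mul1r.
Qed.

(** The form turns the covector [bs j] into a vector supported on [dl t j] and [dl t (pi j)]; this
    symmetry of [c] makes it a multiple of [b (dl t j)]. *)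
Lemma dual_partner j : 1 - c j * c (pi j) != 0 ->
  (forall i, c (dl t i) = - (sg t i * sg t (pi i)) * c (pi i)) ->
  exists2 ga : F, ga != 0 &
  forall m, b (dl t j) m = ga * (sg t m * bs j (dl t m)) /\
            bs (dl t j) m = ga^-1 * (sg t m * b j (dl t m)).
Proof.
move=> n0 cond; pose d := 1 - c j * c (pi j).
have cc : c (dl t j) * c (dl t (pi j)) = c j * c (pi j).
  rewrite !cond piK; transitivity (sg t j * sg t j * (sg t (pi j) * sg t (pi j)) * c j * c (pi j)); first by ring.
  by rewrite !sg_sqr !mul1r.
have sj := sg_sqr F t (dl t j).
exists (sg t (dl t j) * d); first by rewrite mulf_neq0 // sg_neq0.
have ss := sg_dd j (pi j).
move=> m; rewrite /b /bs !ldl !pi_dl cc -/d; split.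
  transitivity (d * d^-1 * (sg t (dl t j) * (sg t m * (m == dl t j)%:R) -
    c (pi j) * sg t (dl t j) * (sg t m * (m == dl t (pi j))%:R))); last by ring.
  rewrite mulfV // mul1r !sgd cond.
  transitivity ((sg t (dl t j) * sg t (dl t j)) * (m == dl t j)%:R
   - (sg t (dl t j) * sg t (dl t (pi j))) * c (pi j) * (m == dl t (pi j))%:R); last by ring.
  by rewrite sj ss; ring.
rewrite invfM; have -> : (sg t (dl t j))^-1 = sg t (dl t j).
  by apply: (mulfI (sg_neq0 F t (dl t j))); rewrite mulfV ?sg_neq0.
transitivity (d^-1 * (sg t (dl t j) * (sg t m * (m == dl t j)%:R) +
    c j * sg t (dl t j) * (sg t m * (m == dl t (pi j))%:R))); last by ring.
rewrite !sgd cond piK.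
transitivity (d^-1 * ((sg t (dl t j) * sg t (dl t j)) * (m == dl t j)%:R
   + (sg t (dl t j) * sg t (dl t (pi j))) * c j * (m == dl t (pi j))%:R)); last by ring.
by rewrite sj ss; ring.
Qed.

(** Here the same vector is a multiple of [b (dl t (pi j))]. Model case, orthogonal with [c = 'i]:
    [e_j + 'i e_(pi j)] is isotropic and pairs with [e_j - 'i e_(pi j)], a multiple of
    [b (pi j)]. *)
Lemma twisted_partner j : 2 != 0 :> F -> (forall i, c i * c (pi i) = -1) ->
  (forall i, c (dl t (pi i)) = sg t i * sg t (pi i) * c i) ->
  exists2 ga : F, ga != 0 &
  forall m, b (dl t (pi j)) m = ga * (sg t m * bs j (dl t m)) /\
            bs (dl t (pi j)) m = ga^-1 * (sg t m * b j (dl t m)).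
Proof.
move=> n0 cc cond; pose d : F := 2.
have c_neq0 i : c i != 0.
  apply/eqP => ci0; move/eqP: (cc i); rewrite ci0 mul0r eq_sym oppr_eq0.
  by rewrite oner_eq0.
have d0 : d != 0 by [].
have condj : c (dl t j) = sg t j * sg t (pi j) * c (pi j).
  by have := cond (pi j); rewrite piK [sg t (pi j) * _]mulrC.
have dE : 1 - -1 = d :> F by rewrite /d opprK.
have cc' : c (dl t (pi j)) * c (dl t j) = -1.
  rewrite cond condj -(cc j); transitivity (sg t j * sg t j * (sg t (pi j) * sg t (pi j)) * c j * c (pi j)); first by ring.
  by rewrite !sg_sqr !mul1r.
have sj := sg_sqr F t (dl t (pi j)).
have ss := sg_dd j (pi j).
exists (c j * sg t (dl t (pi j)) * d); first by rewrite !mulf_neq0 // ?sg_neq0 ?c_neq0.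
move=> m; rewrite /b /bs !ldl !pi_dl !piK cc' cc dE //; split.
  transitivity (d * d^-1 * (c j * sg t (dl t (pi j)) * (sg t m * (m == dl t j)%:R) -
    (c j * c (pi j)) * sg t (dl t (pi j)) * (sg t m * (m == dl t (pi j))%:R))); last by ring.
  rewrite mulfV // mul1r !sgd cond cc.
  transitivity ((sg t (dl t (pi j)) * sg t (dl t (pi j))) * (m == dl t (pi j))%:R
   + (sg t (dl t j) * sg t (dl t (pi j))) * c j * (m == dl t j)%:R); last by ring.
  by rewrite sj ss; ring.
have -> : (c j * sg t (dl t (pi j)) * d)^-1 = - c (pi j) * sg t (dl t (pi j)) * d^-1.
  have gn0 : c j * sg t (dl t (pi j)) * d != 0 by rewrite !mulf_neq0 // ?sg_neq0 ?c_neq0.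
  apply: (mulfI gn0); rewrite mulfV //.
  transitivity (- (c j * c (pi j)) * (sg t (dl t (pi j)) * sg t (dl t (pi j))) * (d * d^-1)); last by ring.
  by rewrite cc sj mulfV // opprK !mul1r.
transitivity (d^-1 * (- c (pi j) * sg t (dl t (pi j)) * (sg t m * (m == dl t j)%:R)
   - (c j * c (pi j)) * sg t (dl t (pi j)) * (sg t m * (m == dl t (pi j))%:R))); last by ring.
rewrite !sgd cc condj.
transitivity (d^-1 * ((sg t (dl t (pi j)) * sg t (dl t (pi j))) * (m == dl t (pi j))%:R
   - (sg t (dl t j) * sg t (dl t (pi j))) * c (pi j) * (m == dl t j)%:R)); last by ring.
by rewrite sj ss; ring.
Qed.

End Partners.

Section Eigen.
Variables (F : fieldType) (t : series) (z : nat).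
Local Notation slot := ('I_1 + 'I_1)%type.
Local Notation V := (nat -> F^o).
Local Notation sg := (@sg F).
Local Notation y := (gy F t z).
Let s0 : slot := inl ord0.
Let s1 : slot := inr ord0.

Lemma vact_gy k l (v : V) m : vact (slot_mx (gc (y k l)) s0) v m =
  (m == k)%:R * v l - (if t is SL then (k == l)%:R * (m == z)%:R * v z
     else sg t l * sg t k * (m == dl t l)%:R * v (dl t k)).
Proof.
have [n0 bn0] := ginf_boundedE (y k l).
pose n := maxn n0 (maxn (maxn z (dl t k)) l).+1.
have bn : bounded n (gc (y k l)) by apply: boundedW bn0; rewrite /n; lia.
rewrite /= (vactE _ _ bn); under eq_bigr do rewrite gc_gy mulrBl.
rewrite sumrB; congr (_ - _).
  rewrite (@ord_single _ _ (fun i => ((m == k) && (i == l))%:R * v i) l).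
  - by rewrite eqxx andbT.
  - by move=> i _ /negPf ->; rewrite andbF mul0r.
  - by move=> H; exfalso; move: H; rewrite /n; lia.
have [tSL|tSL] := pselect (t = SL).
  rewrite tSL (@ord_single _ _ (fun i => ((k == l) && ((m == z) && (i == z)))%:R * v i) z).
  - by rewrite eqxx andbT -mulnb natrM.
  - by move=> i _ /negPf ->; rewrite !andbF mul0r.
  - by move=> H; exfalso; move: H; rewrite /n; lia.
rewrite (if_SL _ _ tSL); under eq_bigr do rewrite (if_SL _ _ tSL).
rewrite (@ord_single _ _ (fun i => form F t l m * form F t k i * v i) (dl t k)).
- by rewrite !formE eqxx /=; ring.
- by move=> i _ ik; rewrite (form_neq _ ik) mulr0 mul0r.
- by move=> H; exfalso; move: H; rewrite /n; lia.
Qed.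

Lemma vact_gy_dual k l (v : V) m : vact (slot_mx (gc (y k l)) s1) v m =
  - ((m == l)%:R * v k - (if t is SL then (k == l)%:R * (m == z)%:R * v z
     else sg t l * sg t k * (m == dl t k)%:R * v (dl t l))).
Proof.
have [n0 bn0] := ginf_boundedE (y k l).
pose n := maxn n0 (maxn (maxn z (dl t l)) k).+1.
have bn : bounded n (dualinf (gc (y k l))).
  by move=> i j ij; rewrite /dualinf bn0 ?oppr0 //; move: ij; rewrite /n; lia.
rewrite /= (vactE _ _ bn); under eq_bigr do rewrite /dualinf gc_gy mulNr mulrBl.
rewrite sumrN sumrB; congr (- (_ - _)).
  rewrite (@ord_single _ _ (fun i => ((i == k) && (m == l))%:R * v i) k).
  - by rewrite eqxx.
  - by move=> i _ /negPf ->; rewrite mul0r.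
  - by move=> H; exfalso; move: H; rewrite /n; lia.
have [tSL|tSL] := pselect (t = SL).
  rewrite tSL (@ord_single _ _ (fun i => ((k == l) && ((i == z) && (m == z)))%:R * v i) z).
  - by rewrite eqxx -mulnb natrM.
  - by move=> i _ /negPf ->; rewrite andbF mul0r.
  - by move=> H; exfalso; move: H; rewrite /n; lia.
rewrite (if_SL _ _ tSL); under eq_bigr do rewrite (if_SL _ _ tSL).
rewrite (@ord_single _ _ (fun i => form F t l i * form F t k m * v i) (dl t l)).
- by rewrite !formE eqxx /=; ring.
- by move=> i _ il; rewrite (form_neq _ il) !mul0r.
- by move=> H; exfalso; move: H; rewrite /n; lia.
Qed.

Variables (pi : nat -> nat) (c : nat -> F).
Hypothesis piK : involutive pi.
Hypothesis pi_neq : forall j, pi j != j.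
Hypothesis pi_dl : forall j, pi (dl t j) = dl t (pi j).
Local Notation b := (inv_basis pi c).
Local Notation bs := (inv_cobasis pi c).

(** The two matrix units send [e_k + c_k e_(pi k)] to [al c_k e_k + be e_(pi k)], which is the
    multiple by [al c_k] because [be] is [al] times the square of [c_k]. *)
Lemma inv_cartan_root (al be : F) k : (forall j, c j * c (pi j) = -1) ->
  (forall j, be = al * c j ^+ 2) -> (forall j, al = be * c j ^+ 2) ->
  @inv_cartan F t pi c (al *: y k (pi k) + be *: y (pi k) k).
Proof.
move=> cc bec alc j.
pose mu i := al * c i * (j == i)%:R + be * c (pi i) * (j == pi i)%:R.
have pe u v : (pi u == v) = (u == pi v) by rewrite -(inj_eq (can_inj piK)) piK.
have T i m : al * ((m == i)%:R * b j (pi i)) + be * ((m == pi i)%:R * b j i) = mu i * b j m.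
  rewrite /mu /b pe (inj_eq (can_inj piK)).
  have [->|ij] := eqVneq i j.
    have -> : (j == pi j) = false by rewrite eq_sym (negPf (pi_neq j)).
    rewrite ?eqxx (bec j) /= ?mulr0n ?mulr1n; ring.
  have [ij'|ipj] := eqVneq i (pi j).
    rewrite ij' piK ?eqxx /= ?mulr0n ?mulr1n; rewrite {1}(alc j); ring.
  rewrite [j == pi i]eq_sym pe (negPf ipj) /= ?mulr0n; ring.
have T' i m : al * ((m == pi i)%:R * bs j i) + be * ((m == i)%:R * bs j (pi i)) = mu i * bs j m.
  rewrite /mu /bs pe (inj_eq (can_inj piK)); set ka := (1 - _)^-1.
  have [->|ij] := eqVneq i j.
    have -> : (j == pi j) = false by rewrite eq_sym (negPf (pi_neq j)).
    rewrite ?eqxx /= ?mulr0n ?mulr1n.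
    have e1 : al = - al * (c j * c (pi j)) by rewrite cc mulrNN mulr1.
    have e2 : - be * c (pi j) = al * c j.
      rewrite (bec j); transitivity (- (al * c j * (c j * c (pi j)))); first by ring.
      by rewrite cc mulrN1 opprK.
    transitivity (al * (m == pi j)%:R * ka + (- be * c (pi j)) * (m == j)%:R * ka); first by ring.
    rewrite e2 {1}e1; ring.
  have [ij'|ipj] := eqVneq i (pi j).
    rewrite ij' piK ?eqxx /= ?mulr0n ?mulr1n.
    have e1 : be = - be * (c j * c (pi j)) by rewrite cc mulrNN mulr1.
    have e2 : - al * c (pi j) = be * c j.
      rewrite (alc j); transitivity (- (be * c j * (c j * c (pi j)))); first by ring.
      by rewrite cc mulrN1 opprK.
    transitivity (be * (m == pi j)%:R * ka + (- al * c (pi j)) * (m == j)%:R * ka); first by ring.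
    rewrite e2 {1}e1; ring.
  rewrite [j == pi i]eq_sym pe (negPf ipj) /= ?mulr0n; ring.
have kF : (k == pi k) = false by rewrite eq_sym (negPf (pi_neq k)).
have pkF : (pi k == k) = false by rewrite (negPf (pi_neq k)).
(* For [SL] an off-diagonal [gy] has no correction. For a form, the corrections act like the same
   matrix units at the index [dl t (pi k)], with sign [- ep]. *)
pose ep : F := if t is SL then 0 else sg t k * sg t (pi k).
exists (mu k - ep * mu (dl t (pi k))); split.
  rewrite vact_lin; apply/funext => m.
  rewrite -[be *: _]addr0 vact_lin.
  change (al * vact (slot_mx (gc (y k (pi k))) s0) (b j) m +
    (be * vact (slot_mx (gc (y (pi k) k)) s0) (b j) m +
      vact (slot_mx (gc (0 : ginf F t)) s0) (b j) m) =
    (mu k - ep * mu (dl t (pi k))) * b j m).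
  rewrite [X in _ + (_ + X)](vactE _ _ (slot_mx_bounded s0 (n := 0%N) _)) // big_ord0 addr0.
  have -> : (mu k - ep * mu (dl t (pi k))) * b j m =
    mu k * b j m - ep * (mu (dl t (pi k)) * b j m) by ring.
  rewrite -!T !vact_gy kF pkF /ep pi_dl piK.
  have [tSL|tSL] := pselect (t = SL); first by rewrite tSL /= ?mulr0n; ring.
  by rewrite !(if_SL _ _ tSL); ring.
rewrite vact_lin; apply/funext => m.
rewrite -[be *: _]addr0 vact_lin.
change (al * vact (slot_mx (gc (y k (pi k))) s1) (bs j) m +
    (be * vact (slot_mx (gc (y (pi k) k)) s1) (bs j) m +
      vact (slot_mx (gc (0 : ginf F t)) s1) (bs j) m) =
    - (mu k - ep * mu (dl t (pi k))) * bs j m).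
rewrite [X in _ + (_ + X)](vactE _ _ (slot_mx_bounded s1 (n := 0%N) _)) // big_ord0 addr0.
have -> : - (mu k - ep * mu (dl t (pi k))) * bs j m =
  - (mu k * bs j m - ep * (mu (dl t (pi k)) * bs j m)) by ring.
rewrite -!T' !vact_gy_dual kF pkF /ep pi_dl piK.
have [tSL|tSL] := pselect (t = SL); first by rewrite tSL /= ?mulr0n; ring.
by rewrite !(if_SL _ _ tSL); ring.
Qed.

Lemma inv_cartan_diag k : (forall j, c j = 0) -> @inv_cartan F t pi c (y k k).
Proof.
move=> c0 j.
have bE i : b j i = (i == j)%:R by rewrite /b c0 mul0r addr0.
have bsE i : bs j i = (i == j)%:R by rewrite /bs !c0 !mul0r !subr0 invr1 mul1r.
pose mu : F := (j == k)%:R - (if t is SL then (j == z)%:R else (j == dl t k)%:R).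
have del (u v : nat) : (v == u)%:R * (u == j)%:R = (j == u)%:R * (v == j)%:R :> F.
  by have [->|_] := eqVneq u j; rewrite ?mulr1 ?mul1r ?mulr0 ?mul0r.
exists mu; split; apply/funext => m.
  change (vact (slot_mx (gc (y k k)) s0) (b j) m = mu * b j m).
  rewrite vact_gy !bE /mu mulrBl del ?eqxx; congr (_ - _).
  have [tSL|tSL] := pselect (t = SL); first by rewrite tSL mul1r del.
  by rewrite !(if_SL _ _ tSL) sg_sqr mul1r del.
change (vact (slot_mx (gc (y k k)) s1) (bs j) m = - mu * bs j m).
rewrite vact_gy_dual !bsE /mu mulNr mulrBl del ?eqxx; congr (- (_ - _)).
have [tSL|tSL] := pselect (t = SL); first by rewrite tSL mul1r del.
by rewrite !(if_SL _ _ tSL) sg_sqr mul1r del.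
Qed.

End Eigen.

(** * Cartan subalgebras containing prescribed Hermitian elements *)

Section CartanFamilies.
Variables (C : numClosedFieldType) (t : series).
Local Notation sg := (@sg C).
Implicit Types (io : nat -> nat) (si b : bool) (k l z : nat).

(* Hermitian elements of the Lie algebra: their eigenvalues will be real. *)
Definition gh z k l b : ginf C t :=
  if b then gy C t z k l + gy C t z l k else 'i *: (gy C t z k l - gy C t z l k).

(* The lift to matrix indices of an involution of the cells. *)
Definition lift_inv io si k : nat :=
  if t is SP then ((io k./2).*2 + (odd k (+) si))%N else io k.

Definition is_orthogonal := t = Oeven \/ t = Oodd.

Definition fp_free io := involutive io /\ forall j, io j != j.

Let two0 : 2 != 0 :> C.
Proof. by rewrite pnatr_eq0. Qed.

Let half_bit n (b : bool) : (n.*2 + b)./2 = n.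
Proof. by rewrite addnC half_bit_double. Qed.

Let odd_bit n (b : bool) : odd (n.*2 + b) = b.
Proof. by rewrite oddD odd_double oddb. Qed.

Lemma cell_lift io si k : cell t (lift_inv io si k) = io (cell t k).
Proof. by rewrite /lift_inv; case: (t) => //=; rewrite half_bit. Qed.

Lemma lift_invK io si : involutive io -> involutive (lift_inv io si).
Proof.
move=> ioK k; rewrite /lift_inv; case: (t) => //=.
by rewrite half_bit odd_bit ioK addbK addnC odd_double_half.
Qed.

Lemma lift_inv_dl io si j : lift_inv io si (dl t j) = dl t (lift_inv io si j).
Proof.
rewrite /lift_inv /dl; case: (t) => //=.
have -> : (if odd j then j.-1 else j.+1)./2 = j./2 by case: ifP; lia.
have -> : odd (if odd j then j.-1 else j.+1) = ~~ odd j by case: ifP; lia.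
by rewrite odd_bit addNb; case: (odd j (+) si); rewrite /= ?addn0 ?addn1.
Qed.

Lemma lift_inv_neq io si j : fp_free io -> lift_inv io si j != j.
Proof.
move=> [_ ioN]; apply: contraNneq (ioN (cell t j)) => jE.
by rewrite -(cell_lift io si) jE.
Qed.

(** In both cases the coefficients of two paired indices have product [-1], while their squares are
    [1] or [-1], as [inv_cartan_root] requires for [y_kl + y_lk] and for ['i (y_kl - y_lk)]. The
    real sign tells the two cells of a pair apart by their order. *)
Definition cartan_coef io b k : C :=
  if b then (if (cell t k < io (cell t k))%N then 1 else -1) else 'i.

Let coef_dl io b k : cartan_coef io b (dl t k) = cartan_coef io b k.
Proof. by rewrite /cartan_coef cell_dl. Qed.

Let coef_lift io si b k : fp_free io ->
  cartan_coef io b (lift_inv io si k) = (-1) ^+ b * cartan_coef io b k.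
Proof.
move=> [ioK ioN]; rewrite /cartan_coef cell_lift ioK; case: b; last by rewrite mul1r.
have := ioN (cell t k); rewrite expr1 mulN1r.
by case: ltngtP => // _ _; rewrite ?opprK.
Qed.

Let coef_sqr io b k : cartan_coef io b k ^+ 2 = (-1) ^+ (~~ b).
Proof.
rewrite /cartan_coef; case: b => /=; last by rewrite sqrCi.
by case: ifP; rewrite ?sqrrN expr1n.
Qed.

Let coef_mul io si b k : fp_free io ->
  cartan_coef io b k * cartan_coef io b (lift_inv io si k) = -1.
Proof.
move=> ioF; rewrite coef_lift // mulrCA -expr2 coef_sqr -signr_addb addbN addbb.
by rewrite expr1.
Qed.

Let sg_lift io si k : t = SP -> sg t k * sg t (lift_inv io si k) = (-1) ^+ si.
Proof.
move=> tSP; have sgE i : sg t i = (-1) ^+ odd i.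
  by rewrite tSP /sg /=; case oi: (odd i) => /=; [have -> : (i == i.-1.+1) by lia|rewrite eqxx].
rewrite !sgE -signr_addb /lift_inv tSP oddD odd_double /= oddb.
by rewrite addbA addbb.
Qed.

Let not_SL_SP : t <> SL -> t <> SP -> is_orthogonal.
Proof. by rewrite /is_orthogonal; case: (t) => //; [left|right]. Qed.

(** A single Cartan subalgebra holds the Hermitian elements at all pairs of the involution at once;
    the vanishing of weights at infinity rests on this. In the excluded orthogonal case these
    elements are zero. For [SP] the partner of [j] is [dl t j] or [dl t (pi j)], according to
    [b (+) si]. *)
Lemma cartan_family io si b : fp_free io -> ~ (is_orthogonal /\ b) ->
  exists h : set (ginf C t), splitting_cartan h /\
    forall z k, h (gh z k (lift_inv io si k) b).
Proof.
move=> ioF ob; set pi := lift_inv io si; set c := cartan_coef io b.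
have piK : involutive pi by apply: lift_invK; case: ioF.
have pi_neq j : pi j != j by exact: lift_inv_neq.
have pi_dl j : pi (dl t j) = dl t (pi j) by exact: lift_inv_dl.
have cc j : c j * c (pi j) = -1 by exact: coef_mul.
have c1 j : 1 - c j * c (pi j) != 0 by rewrite cc opprK.
exists (@inv_cartan C t pi c); split; last first.
  move=> z k; rewrite /gh.
  have -> : (if b then gy C t z k (pi k) + gy C t z (pi k) k
      else 'i *: (gy C t z k (pi k) - gy C t z (pi k) k)) =
      (if b then 1 else 'i) *: gy C t z k (pi k) + (if b then 1 else - 'i) *: gy C t z (pi k) k.
    by case: (b); rewrite ?scale1r // scalerBr scaleNr.
  apply: inv_cartan_root => // j; rewrite /c coef_sqr; case: (b);
    by rewrite /= ?expr0 ?expr1 ?mulr1 // ?mulrN1 ?opprK.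
have [tSL|tSL] := pselect (t = SL).
  by apply: (@inv_cartan_splitting _ _ pi c piK pi_neq c1 two0 pi pi_neq); left.
have [tSP|tSP] := pselect (t = SP); last first.
  have orth := not_SL_SP tSL tSP.
  have bF : b = false by apply/negbTE/negP => bT; apply: ob.
  have dlE j : dl t j = j by case: orth => ->.
  have sgE j : sg t j = 1 by case: orth => ->; rewrite /sg /= eqxx.
  apply: (@inv_cartan_splitting _ _ pi c piK pi_neq c1 two0 pi pi_neq); right; split=> // j.
  have [||ga ga0 gaE] := @twisted_partner C t pi c piK pi_dl j two0.
  - by [].
  - by move=> i; rewrite dlE !sgE !mul1r /c /cartan_coef bF.
  - by exists ga => // m; rewrite -[pi j]dlE.
have sgi i : sg t i * sg t (pi i) = (-1) ^+ si by exact: sg_lift.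
have [bs|bs] := boolP (b (+) si).
  have dn j : dl t j != j by rewrite tSP /=; case: ifP; lia.
  apply: (@inv_cartan_splitting _ _ pi c piK pi_neq c1 two0 (dl t) dn); right; split=> // j.
  apply: dual_partner => // i; rewrite sgi /c coef_dl coef_lift // mulrA mulNr -signr_addb.
  by rewrite addbC bs expr1 opprK mul1r.
have dn j : dl t (pi j) != j.
  apply/eqP => /(congr1 (cell t)); rewrite cell_dl cell_lift => /eqP.
  by apply/negP; case: ioF.
apply: (@inv_cartan_splitting _ _ pi c piK pi_neq c1 two0 (dl t \o pi) dn); right; split=> // j.
apply: twisted_partner => // i; rewrite sgi /c coef_dl coef_lift //.
by move: bs; case: (b); case: (si).
Qed.

Definition xor1 j := if odd j then j.-1 else j.+1.

Lemma fp_free_xor1 : fp_free xor1.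
Proof. by split; [exact: (dlK SP)|move=> j; rewrite /xor1; case: ifP; lia]. Qed.

(** [xor1] is conjugated by the transposition [ta] of [xor1 i] and [j]. *)
Lemma ex_fp_free i j : i != j -> exists2 io, fp_free io & io i = j.
Proof.
move=> ij; pose x := xor1; have [xK xN] : fp_free x := fp_free_xor1.
pose ta k := if k == x i then j else if k == j then x i else k.
have taK : involutive ta.
  move=> k; rewrite /ta; case: (eqVneq k (x i)) => [->|kx].
    by case: (eqVneq j (x i)) => [->//|_]; rewrite eqxx.
  by case: (eqVneq k j) => [->|kj]; rewrite ?eqxx // (negPf kx) (negPf kj).
exists (ta \o x \o ta).
  split=> [k|k] /=; first by rewrite taK xK taK.
  rewrite -(inj_eq (can_inj taK)) taK; exact: xN.
rewrite /= /ta (negPf ij); have -> : (i == x i) = false by rewrite eq_sym (negPf (xN i)).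
by rewrite eqxx.
Qed.

Lemma gh_self z k : gh z k k false = 0.
Proof. by rewrite /gh subrr scaler0. Qed.

Lemma gy_orthogonal z k l : is_orthogonal -> gy C t z l k = - gy C t z k l.
Proof.
move=> orth; have tSL : t <> SL by case: orth => ->.
have dlE j : dl t j = j by case: orth => ->.
have sgE j : sg t j = 1 by case: orth => ->; rewrite /sg /= eqxx.
by have := gy_dual C z k l tSL; rewrite !dlE !sgE mulr1 scaleN1r.
Qed.

Lemma gh_orthogonal z k l : is_orthogonal -> gh z k l true = 0.
Proof. by move=> orth; rewrite /gh gy_orthogonal // addNr. Qed.

(** Three positions: for distinct cells, an involution exchanging them is lifted to the indices; for
    [k = l], the standard Cartan subalgebra, with [c = 0], contains the diagonal elements; for
    [l = dl t k] in [SP], the involution is [dl t] itself. *)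
Lemma gh_splitting z k l b : exists2 h : set (ginf C t), splitting_cartan h & h (gh z k l b).
Proof.
have zero_case : gh z k l b = 0 -> exists2 h : set (ginf C t), splitting_cartan h & h (gh z k l b).
  move=> ->; have [|h [sh _]] := @cartan_family _ false false fp_free_xor1; first by case.
  by exists h => //; case: sh => [[[[]]]].
have [[orth bT]|ob] := pselect (is_orthogonal /\ b).
  by apply: zero_case; rewrite bT; exact: gh_orthogonal.
have [kl|kl] := eqVneq (cell t k) (cell t l); last first.
  have [io ioF iokl] := ex_fp_free kl.
  have [h [sh hgh]] := @cartan_family io (odd k (+) odd l) b ioF ob.
  exists h => //; have := hgh z k; suff -> : lift_inv io (odd k (+) odd l) k = l by [].
  move: iokl; rewrite /lift_inv; case: (t) => //= ->.
  by rewrite addbA addbb addnC odd_double_half.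
have [lk|[tSP lk]] : k = l \/ t = SP /\ l = dl t k.
  have [|->] := cell_eq kl; first by left.
  by rewrite dlK; case: (t); [left|left|left|right].
  subst l; case: b ob {zero_case} => [ob|_]; last first.
    have [|h [sh _]] := @cartan_family _ false false fp_free_xor1; first by case.
    by exists h => //; rewrite gh_self; case: sh => [[[[]]]].
  pose x := xor1; have [xK xN] : fp_free x := fp_free_xor1.
  have orthF : ~ is_orthogonal by move=> orth; apply: ob.
  have x_dl j : x (dl t j) = dl t (x j).
    by case: (t).
  have c1 j : 1 - (fun=> 0) j * (fun=> 0 : C) (x j) != 0 by rewrite mul0r subr0 oner_neq0.
  have sh : splitting_cartan (@inv_cartan C t x (fun=> 0)).
    have [tSL|tSL] := pselect (t = SL).
      by apply: (@inv_cartan_splitting _ _ x _ xK xN c1 two0 x xN); left.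
    have dn j : dl t j != j.
      have tSP : t = SP by apply: contrapT => /(not_SL_SP tSL).
      by rewrite tSP /=; case: ifP; lia.
    apply: (@inv_cartan_splitting _ _ x _ xK xN c1 two0 (dl t) dn); right; split=> // j.
    by apply: dual_partner => // [|i]; rewrite ?mulr0 ?subr0 ?oner_neq0.
  exists (inv_cartan (t:=t) x (fun=> 0)) => //; rewrite /gh -[X in X + _]scale1r.
  by case: sh => [[[[_ hP _] _] _] _]; apply: (hP); exact: inv_cartan_diag.
subst l; have dn j : dl t j != j by rewrite tSP /=; case: ifP; lia.
pose c j : C := if b then (-1) ^+ odd j else 'i.
have odl j : odd (dl t j) = ~~ odd j by rewrite tSP /=; case: ifP; lia.
have c2 j : c j ^+ 2 = (-1) ^+ (~~ b).
  by rewrite /c; case: (b); rewrite /= ?sqrCi // sqrr_sign.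
have cc j : c j * c (dl t j) = -1.
  rewrite /c odl; case: (b); last by rewrite -expr2 sqrCi.
  by rewrite -signr_addb addbN addbb.
have c1 j : 1 - c j * c (dl t j) != 0 by rewrite cc opprK.
exists (inv_cartan (t:=t) (dl t) c).
  apply: (@inv_cartan_splitting _ _ _ c (dlK t) dn c1 two0 _ dn); right; split=> [|j]; first by rewrite tSP.
  apply: (@dual_partner _ t (dl t) c (dlK t) (fun=> erefl)) => //.
  move=> i.
  by rewrite sg_dl mulrCA sg_sqr mulr1 /form_sign tSP opprK mul1r.
rewrite /gh.
have -> : (if b then gy C t z k (dl t k) + gy C t z (dl t k) k
    else 'i *: (gy C t z k (dl t k) - gy C t z (dl t k) k)) =
    (if b then 1 else 'i) *: gy C t z k (dl t k) + (if b then 1 else - 'i) *: gy C t z (dl t k) k.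
  by case: (b); rewrite ?scale1r // scalerBr scaleNr.
apply: inv_cartan_root => //; [exact: dlK|by move=> j; rewrite c2; case: (b);
    rewrite /= ?expr0 ?expr1 ?mulr1 // ?mulrN1..|].
by move=> j; rewrite c2; case: (b); rewrite /= ?expr0 ?expr1 ?mulr1 // ?mulrN1 opprK.
Qed.

End CartanFamilies.

(** * Reality of the spectra *)

Section PauliTriples.
Variables (C : numClosedFieldType) (X : lmodType C).

(* On the sum [S] of the eigenspaces of [s1] for the eigenvalues [mu + 2 n], [s1] is a
   commutator, hence has trace [0], so that [mu] is rational. *)
Lemma pauli_real (P : set X) (s : seq X) (s1 s2 s3 : X -> X) (mu : C) (v : X) :
  subspace P -> P `<=` lin_span [set` s] ->
  linear s1 -> linear s2 -> linear s3 ->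
  (forall u, P u -> P (s1 u)) -> (forall u, P u -> P (s2 u)) -> (forall u, P u -> P (s3 u)) ->
  (forall u, s1 (s2 u) = s2 (s1 u) + (2 * 'i) *: s3 u) ->
  (forall u, s2 (s3 u) = s3 (s2 u) + (2 * 'i) *: s1 u) ->
  (forall u, s3 (s1 u) = s1 (s3 u) + (2 * 'i) *: s2 u) ->
  P v -> s1 v = mu *: v -> v != 0 -> mu \is Num.real.
Proof.
move=> sP Ps l1 l2 l3 P1 P2 P3 s12 s23 s31 Pv s1v v0.
have i2 : 'i * 'i = -1 :> C by rewrite -expr2 sqrCi.
pose E : set C := [set nu | exists m : int, nu = mu + 2 * m%:~R].
pose S0 := [set u | P u /\ eigenvectors s1 E u].
pose S := lin_span S0; have sS : subspace S by exact: lin_span_subspace.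
have Ss : S `<=` lin_span [set` s].
  by move=> u Su; apply: Ps; apply: lin_span_min Su => // w [].
(* Raising and lowering operators: they shift the eigenvalues of [s1] by [2] and [-2], hence
   preserve [S], and their commutator is [4 *: s1]. *)
pose e u := s2 u + 'i *: s3 u; pose f u := s2 u - 'i *: s3 u.
have [_ D1 N1 Z1] := linear_fun_rules l1.
have [_ D2 N2 Z2] := linear_fun_rules l2.
have [_ D3 N3 Z3] := linear_fun_rules l3.
have le : linear e.
  by move=> a u w; apply: functional_eq => g gD gN gZ g0;
    rewrite /e l2 l3 !(gD, gN, gZ); ring.
have lf : linear f.
  by move=> a u w; apply: functional_eq => g gD gN gZ g0;
    rewrite /f l2 l3 !(gD, gN, gZ); ring.
have s1e u : s1 (e u) = e (s1 u) + 2 *: e u.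
  apply: functional_eq => g gD gN gZ g0.
  rewrite /e D1 Z1 s12 s31 !(gD, gZ).
  transitivity (g (s2 (s1 u)) + 'i * g (s1 (s3 u)) + 2 * 'i * g (s3 u)); first by ring.
  transitivity (g (s2 (s1 u)) + 'i * g (s1 (s3 u)) + 2 * 'i * g (s3 u) +
    2 * (1 + 'i * 'i) * g (s2 u)); first by rewrite i2 subrr mulr0 mul0r addr0.
  ring.
have s1f u : s1 (f u) = f (s1 u) - 2 *: f u.
  apply: functional_eq => g gD gN gZ g0.
  rewrite /f D1 N1 Z1 s12 s31 !(gD, gN, gZ).
  transitivity (g (s2 (s1 u)) - 'i * g (s1 (s3 u)) + 2 * 'i * g (s3 u)); first by ring.
  transitivity (g (s2 (s1 u)) - 'i * g (s1 (s3 u)) + 2 * 'i * g (s3 u) -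
    2 * (1 + 'i * 'i) * g (s2 u)); first by rewrite i2 subrr mulr0 mul0r subr0.
  ring.
have ef u : e (f u) - f (e u) = 4 *: s1 u.
  apply: functional_eq => g gD gN gZ g0.
  rewrite /e /f !(D2, D3, N2, N3, Z2, Z3) s23 !(gD, gN, gZ).
  transitivity (- 4 * ('i * 'i) * g (s1 u)); first by ring.
  by rewrite i2 mulrN1 opprK.
have Pe u : P u -> P (e u).
  by move=> Pu; apply: (subspaceD sP); [exact: P2|apply: (subspaceZ _ sP); exact: P3].
have Pf u : P u -> P (f u).
  by move=> Pu; apply: (subspaceB sP); [exact: P2|apply: (subspaceZ _ sP); exact: P3].
have Sstab a : linear a -> (forall u, S0 u -> S0 (a u)) -> forall u, S u -> S (a u).
  move=> la Sa u Su; apply: lin_spanW (lin_span_image la Su) => _ [w Sw <-].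
  exact: Sa.
have S1 : forall u, S u -> S (s1 u).
  apply: Sstab => // u [Pu [nu Enu unu]]; split; first exact: P1.
  by exists nu => //; rewrite {1}unu Z1.
have Se : forall u, S u -> S (e u).
  apply: Sstab => // u [Pu [_ [m ->] unu]]; split; first exact: Pe.
  exists (mu + 2 * (m + 1)%:~R); first by exists (m + 1).
  have [_ _ _ Ze] := linear_fun_rules le.
  by rewrite s1e unu Ze -scalerDl; congr (_ *: _); rewrite intrD; ring.
have Sf : forall u, S u -> S (f u).
  apply: Sstab => // u [Pu [_ [m ->] unu]]; split; first exact: Pf.
  exists (mu + 2 * (m - 1)%:~R); first by exists (m - 1).
  have [_ _ _ Zf] := linear_fun_rules lf.
  by rewrite s1f unu Zf -scalerBl; congr (_ *: _); rewrite intrB; ring.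
have [d [c [lc injc Sc]]] := subspace_coordinates sS Ss.
have [A cA] := coordinates_matrix lc Sc l1 S1.
have [Be cBe] := coordinates_matrix lc Sc le Se.
have [Bf cBf] := coordinates_matrix lc Sc lf Sf.
have trA : \tr A = 0.
  have : Bf *m Be - Be *m Bf = 4 *: A.
    apply/row_matrixP => i; rewrite !rowE; apply: injc.
    have [_ Dc Nc Zc] := linear_fun_rules lc.
    by rewrite mulmxBr Dc Nc !mulmxA !(cBe, cBf) ef -scalemxAr Zc cA.
  move/(congr1 mxtrace); rewrite raddfB /= mxtrace_mulC subrr mxtraceZ => /esym/eqP.
  by rewrite mulf_eq0 pnatr_eq0 /= => /eqP.
have [|Q [D [Qu QA DE]]] := @diagonalizable_of_span _ d A E.
  apply: (coordinates_eigenspan lc injc sS Sc l1 S1 cA) => u Su.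
  by apply: lin_spanW Su => w [].
have Sv : S v by apply: lin_span_sub; split=> //; exists mu => //; exists 0; rewrite mulr0 addr0.
have d0 : (d%:R : C) != 0.
  rewrite pnatr_eq0; apply: contra_neq v0 => d0; have /Sc[w <-] := Sv.
  have -> : w = 0 by apply/rowP => -[i lti]; exfalso; rewrite d0 in lti.
  by have [-> _ _ _] := linear_fun_rules lc.
have [m mE] := choice DE.
move: trA; rewrite (trace_diagonalized Qu QA).
under eq_bigr do rewrite mE.
rewrite big_split sumr_const card_ord /= -mulr_sumr => sum0.
have -> : mu = (- (2 * \sum_i (m i)%:~R)) / d%:R.
  by apply/(canRL (mulfK d0))/eqP; rewrite mulr_natr -addr_eq0 sum0.
apply: rpredM; last by rewrite rpredV; exact: realn.
rewrite rpredN rpredM ?realn //; apply: rpred_sum => i _; exact: realz.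
Qed.

End PauliTriples.

Section BracketRules.
Variables (K : fieldType) (L : lieAlgType K).
Implicit Types x y z : L.

Lemma bracketDr x y z : bracket x (y + z) = bracket x y + bracket x z.
Proof. by have [_ D _ _] := linear_fun_rules (bracket_linearr x); exact: D. Qed.

Lemma bracketZr a x y : bracket x (a *: y) = a *: bracket x y.
Proof. by have [_ _ _ Z] := linear_fun_rules (bracket_linearr x); exact: Z. Qed.

Lemma bracketNr x y : bracket x (- y) = - bracket x y.
Proof. by have [_ _ N _] := linear_fun_rules (bracket_linearr x); exact: N. Qed.

Lemma bracketDl x y z : bracket (x + y) z = bracket x z + bracket y z.
Proof. by have [_ D _ _] := linear_fun_rules (bracket_linearl z); exact: D. Qed.

Lemma bracketZl a x y : bracket (a *: x) y = a *: bracket x y.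
Proof. by have [_ _ _ Z] := linear_fun_rules (bracket_linearl y); exact: Z. Qed.

Lemma bracketNl x y : bracket (- x) y = - bracket x y.
Proof. by have [_ _ N _] := linear_fun_rules (bracket_linearl y); exact: N. Qed.

Lemma bracketC x y : bracket x y = - bracket y x.
Proof.
have := bracketxx (x + y); rewrite bracketDl !bracketDr !bracketxx add0r addr0.
by move/eqP; rewrite addr_eq0 => /eqP.
Qed.

Definition bracketE := (bracketDl, bracketDr, bracketNl, bracketNr, bracketZl, bracketZr).

End BracketRules.

Section Spectra.
Variables (C : numClosedFieldType) (t : series) (X : lieModType (ginf C t)).
Hypothesis absX : absolute_weight X.
Implicit Types (x e f h : ginf C t) (n z : nat) (b : bool) (u v : X).
Local Notation y z := (gy C t z).

Definition eigen_spanned x := forall v, lin_span (eigenvectors (lact x) setT) v.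
Definition real_spanned x :=
  forall v, lin_span (eigenvectors (lact x) [set mu | mu \is Num.real]) v.

Lemma eigen_gh z (k l : nat) b : eigen_spanned (gh C t z k l b).
Proof.
move=> v; have [h /absX/weight_moduleP wX hg] := gh_splitting C t z k l b.
apply: lin_spanW (wX v) => m [lam lamP].
pose g : h := exist _ (gh C t z k l b) (mem_set hg).
by exists (lam g) => //; have := lamP g.
Qed.

Definition ylevel n z : set (ginf C t) :=
  lin_span [set x | exists k l : 'I_(cell_bound t n), x = y z k l].

Lemma ylevel_subspace n z : subspace (ylevel n z).
Proof. exact: lin_span_subspace. Qed.

Lemma ylevel_gy n z (k l : nat) : (k < cell_bound t n)%N -> (l < cell_bound t n)%N ->
  ylevel n z (y z k l).
Proof. by move=> kN lN; apply: lin_span_sub; exists (Ordinal kN), (Ordinal lN). Qed.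

Definition yact n z (k l : 'I_(cell_bound t n)) : X -> X := lact (y z k l).

Definition yspan n z v : set X :=
  generated (fun kl : 'I_(cell_bound t n) * 'I_(cell_bound t n) => yact z kl.1 kl.2) v.

Lemma ylevel_stable n z (P : set X) x : subspace P ->
  (forall (k l : 'I_(cell_bound t n)) u, P u -> P (yact z k l u)) -> ylevel n z x -> forall u, P u -> P (lact x u).
Proof.
move=> sP Py; elim=> [|a x' x'' [k [l ->]] _ IH] u Pu.
  by rewrite lact0l; case: sP.
by rewrite lact_linearl; apply: (proj2 sP); [exact: Py|exact: IH].
Qed.

Variables n z : nat.
Hypothesis Nz : (cell_bound t n <= z)%N.

Lemma bracket_yact (a b : 'I_(cell_bound t n)) :
  exists Y : 'I_(cell_bound t n) -> 'I_(cell_bound t n) -> C, forall k l v,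
  yact z a b (yact z k l v) - yact z k l (yact z a b v) =
  \sum_m Y m k *: yact z m l v - \sum_m Y l m *: yact z k m v.
Proof.
exists (gc (y z a b)) => k l v; rewrite /yact -lact_bracket.
rewrite (@bracket_gy _ _ n) //; last exact: block_gy.
by rewrite lactBl !lact_suml; congr (_ - _); apply: eq_bigr => m _; rewrite lactZl.
Qed.

Lemma hermitian_gh (k l : 'I_(cell_bound t n)) b v :
  hermitian (@yact n z) (k, l, b) v = lact (gh C t z k l b) v.
Proof. by rewrite /gh /yact /=; case: b; rewrite ?lactDl // lactZl lactBl. Qed.

Lemma eigen_hermitian klb v : lin_span (eigenvectors (hermitian (@yact n z) klb) setT) v.
Proof.
case: klb => [[k l] b]; apply: lin_spanW (@eigen_gh z k l b v) => u [mu _ uE].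
by exists mu => //; rewrite hermitian_gh.
Qed.

Lemma yspan_finite v : exists s : seq X, yspan n z v `<=` lin_span [set` s].
Proof.
apply: casimir_generated_finite; [|exact: bracket_yact|exact: eigen_hermitian].
by move=> k l; exact: lact_linearr.
Qed.

Lemma pauli_spanned s1 s2 s3 : ylevel n z s1 -> ylevel n z s2 -> ylevel n z s3 ->
  bracket s1 s2 = (2 * 'i) *: s3 -> bracket s2 s3 = (2 * 'i) *: s1 ->
  bracket s3 s1 = (2 * 'i) *: s2 -> eigen_spanned s1 -> real_spanned s1.
Proof.
move=> L1 L2 L3 s12 s23 s31 e1 v; elim: (e1 v) => [|a u w [mu _ uE] _ IH].
  exact: lin_span0.
have [->|u0] := eqVneq u 0; first by rewrite scaler0 add0r.
apply: lin_spanS IH; exists mu => //=.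
have [s sE] := yspan_finite u.
have st x : ylevel n z x -> forall w, yspan n z u w -> yspan n z u (lact x w).
  move=> Lx; apply: ylevel_stable Lx; first exact: generated_subspace.
  move=> k l u' gu'; exact: (generated_stable (k, l) gu').
have br x x' x'' w' : bracket x x' = (2 * 'i) *: x'' ->
    lact x (lact x' w') = lact x' (lact x w') + (2 * 'i) *: lact x'' w'.
  by move=> xx; rewrite -lactZl -xx lact_bracket addrC subrK.
apply: (@pauli_real _ _ (yspan n z u) s (lact s1) (lact s2) (lact s3) mu u) => //;
  try exact: lact_linearr; try exact: st; try by move=> w'; exact: br.
exact: generated_subspace.
Qed.

(** [e + f], [- 'i (e - f)] and [h] satisfy the relations of the Pauli matrices, so a cyclic
    rotation brings a chosen one to the first place. For ['i (e - f)] the triple is read in the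
    opposite order. *)
Lemma sl2_spanned e f h : ylevel n z e -> ylevel n z f -> ylevel n z h ->
  bracket e f = h -> bracket h e = 2 *: e -> bracket h f = - (2 *: f) ->
  [/\ eigen_spanned (e + f) -> real_spanned (e + f),
      eigen_spanned ('i *: (e - f)) -> real_spanned ('i *: (e - f))
    & eigen_spanned h -> real_spanned h].
Proof.
move=> Le Lf Lh ef he hf; have sL := ylevel_subspace n z.
have fe : bracket f e = - h by rewrite bracketC ef.
have eh : bracket e h = - (2 *: e) by rewrite bracketC he.
have fh : bracket f h = 2 *: f by rewrite bracketC hf opprK.
have La : ylevel n z (e + f) by exact: subspaceD.
have Lb : ylevel n z ('i *: (e - f)) by apply: subspaceZ => //; exact: subspaceB.
have Lb' : ylevel n z (- 'i *: (e - f)) by apply: subspaceZ => //; exact: subspaceB.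
have i2 : 'i * 'i = -1 :> C by rewrite -expr2 sqrCi.
have ab : bracket (e + f) (- 'i *: (e - f)) = (2 * 'i) *: h.
  rewrite !bracketE ef fe !bracketxx; apply: functional_eq => g gD gN gZ g0.
  by rewrite !(gD, gN, gZ, g0); ring.
have bh : bracket (- 'i *: (e - f)) h = (2 * 'i) *: (e + f).
  rewrite !bracketE eh fh; apply: functional_eq => g gD gN gZ g0.
  by rewrite !(gD, gN, gZ, g0); ring.
have ha : bracket h (e + f) = (2 * 'i) *: (- 'i *: (e - f)).
  rewrite !bracketE he hf scalerA; apply: functional_eq => g gD gN gZ g0.
  by rewrite mulrN -mulrA i2 mulrN1 opprK !(gD, gN, gZ, g0); ring.
have ba : bracket ('i *: (e - f)) (e + f) = (2 * 'i) *: h.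
  rewrite !bracketE ef fe !bracketxx; apply: functional_eq => g gD gN gZ g0.
  by rewrite !(gD, gN, gZ, g0); ring.
have ah : bracket (e + f) h = (2 * 'i) *: ('i *: (e - f)).
  rewrite !bracketE eh fh scalerA; apply: functional_eq => g gD gN gZ g0.
  by rewrite -mulrA i2 mulrN1 !(gD, gN, gZ, g0); ring.
have hb : bracket h ('i *: (e - f)) = (2 * 'i) *: (e + f).
  rewrite !bracketE he hf; apply: functional_eq => g gD gN gZ g0.
  by rewrite !(gD, gN, gZ, g0); ring.
split.
- exact: (pauli_spanned La Lb' Lh).
- exact: (pauli_spanned Lb La Lh).
- exact: (pauli_spanned Lh La Lb').
Qed.

End Spectra.

(** * Real eigenvalues of the Hermitian elements *)

Section RealSpectrum.
Variables (C : numClosedFieldType) (t : series) (X : lieModType (ginf C t)).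
Hypothesis absX : absolute_weight X.
Implicit Types (x e f h : ginf C t) (n z k l : nat) (b : bool) (u v : X).

Lemma eigen_spannedZ c x : eigen_spanned X x -> eigen_spanned X (c *: x).
Proof.
move=> ex v; apply: lin_spanW (ex v) => u [mu _ uE]; exists (c * mu) => //.
by rewrite lactZl uE scalerA.
Qed.

Lemma real_spannedZ c x : c \is Num.real -> real_spanned X x -> real_spanned X (c *: x).
Proof.
move=> cR ex v; apply: lin_spanW (ex v) => u [mu muR uE]; exists (c * mu); first exact: rpredM.
by rewrite lactZl uE scalerA.
Qed.

Lemma real_spanned0 : real_spanned X 0.
Proof.
move=> v; apply: lin_span_sub; exists 0; first exact: rpred0.
by rewrite lact0l scale0r.
Qed.

Lemma gy_independent z z' k l : t <> SL -> gy C t z k l = gy C t z' k l.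
Proof. by move=> tSL; apply: ginf_ext => i j; rewrite !gc_gy !(if_SL _ _ tSL). Qed.

Lemma gh_independent z z' k l b : t <> SL -> gh C t z k l b = gh C t z' k l b.
Proof. by move=> tSL; rewrite /gh !(gy_independent z z'). Qed.

(** Here [y_kl] and [y_lk] are proportional and give no [sl(2)] triple. Instead, [2 'i] times
    [y_kl], [y_ln], [y_kn] is a Pauli triple in the [so(3)] of the indices [k], [l], [n]; the level
    [n.+1] makes room for the third index. *)
Lemma real_gh_orthogonal n z k l b : is_orthogonal t -> (cell_bound t n <= z)%N ->
  (k < cell_bound t n)%N -> (l < cell_bound t n)%N -> real_spanned X (gh C t z k l b).
Proof.
move=> orth Nz kN lN; case: b; first by rewrite gh_orthogonal //; exact: real_spanned0.
have [<-|kl] := eqVneq k l; first by rewrite gh_self; exact: real_spanned0.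
have tSL : t <> SL by case: orth => ->.
have cE m : cell t m = m by case: orth => ->.
have bE m : cell_bound t m = m by case: orth => ->.
move: kN lN Nz; rewrite bE => kN lN Nz.
rewrite (gh_independent z n.+1) //.
have N' : (cell_bound t n.+1 <= n.+1)%N by rewrite bE.
pose y := gy C t n.+1.
have yC i j : y i j = - y j i by exact: gy_orthogonal.
have chain i j r : (i < n.+1)%N -> (j < n.+1)%N -> (r < n.+1)%N ->
    i != j -> r != j -> r != i -> bracket (y i j) (y j r) = y i r.
  move=> iN jN rN ij rj ri; rewrite (bracket_gy_chain C N') ?bE ?cE //.
  by rewrite (negPf ri) scale0r subr0.
have i2 : 'i * 'i = -1 :> C by rewrite -expr2 sqrCi.
have kN' : (k < n.+1)%N by lia.
have lN' : (l < n.+1)%N by lia.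
have kn : k != n by lia.
have ln : l != n by lia.
have LY i j : (i < n.+1)%N -> (j < n.+1)%N -> @ylevel C t n.+1 n.+1 ((2 * 'i) *: y i j).
  move=> iN jN; apply: subspaceZ; first exact: ylevel_subspace.
  by apply: ylevel_gy; rewrite bE.
have BR i j r : (i < n.+1)%N -> (j < n.+1)%N -> (r < n.+1)%N ->
    i != j -> r != j -> r != i ->
    bracket ((2 * 'i) *: y i j) ((2 * 'i) *: y j r) = (2 * 'i) *: ((2 * 'i) *: y i r).
  by move=> iN jN rN ij rj ri; rewrite bracketZl bracketZr chain.
have yN i j : (2 * 'i) *: y i j = - ((2 * 'i) *: y j i) by rewrite yC scalerN.
have -> : gh C t n.+1 k l false = (2 * 'i) *: y k l.
  by rewrite /gh (gy_orthogonal C n.+1 k l orth) opprK -mulr2n -scaler_nat scalerA [_ * 2]mulrC.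
apply: (@pauli_spanned C t X absX n.+1 n.+1 N' _ ((2 * 'i) *: y l n) ((2 * 'i) *: y k n)).
- exact: LY.
- exact: LY.
- exact: LY.
- by apply: BR => //; rewrite eq_sym.
- rewrite (yN k n) bracketNr BR // 1?eq_sym // (yN l k) scalerN opprK.
  by [].
- rewrite (yN k n) bracketNl BR // 1?eq_sym // (yN n l) scalerN opprK.
  by [].
have := @eigen_gh C t X absX n.+1 k l false.
by rewrite /gh (gy_orthogonal C n.+1 k l orth) opprK -mulr2n -scaler_nat scalerA [_ * 2]mulrC.
Qed.

Lemma real_gh_cells n z k l b : t = SL \/ t = SP -> (cell_bound t n <= z)%N ->
  (k < cell_bound t n)%N -> (l < cell_bound t n)%N -> cell t k != cell t l ->
  real_spanned X (gh C t z k l b).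
Proof.
move=> tSS Nz kN lN kl; have lk : cell t l != cell t k by rewrite eq_sym.
have [kkl lkl] := bracket_gy_diag C Nz tSS kN lN kl.
have [llk klk] := bracket_gy_diag C Nz tSS lN kN lk.
pose h := gy C t z k k - gy C t z l l.
have [] := @sl2_spanned C t X absX n z Nz (gy C t z k l) (gy C t z l k) h.
- exact: ylevel_gy.
- exact: ylevel_gy.
- by apply: subspaceB; [exact: ylevel_subspace|exact: ylevel_gy|exact: ylevel_gy].
- by rewrite (bracket_gy_chain C Nz) // eqxx scale1r.
- by rewrite /h bracketDl bracketNl kkl lkl opprK -mulr2n -scaler_nat.
- by rewrite /h bracketDl bracketNl llk klk -opprD -mulr2n -scaler_nat.
move=> r1 r2 _; have := @eigen_gh C t X absX z k l b.
by rewrite /gh; case: (b).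
Qed.

(** [y k k] is [E_kk - E_zz], a coroot once [z] counts as an ordinary index: at the level [z.+1],
    with spare index [z.+1], it is [y k k - y z z]. *)
Lemma real_gh_diag_SL n z k b : t = SL -> (cell_bound t n <= z)%N ->
  (k < cell_bound t n)%N -> real_spanned X (gh C t z k k b).
Proof.
move=> tSL Nz kN; case: b; last by rewrite gh_self; exact: real_spanned0.
have [cE bE] : (forall m, cell t m = m) /\ (forall m, cell_bound t m = m) by rewrite tSL.
have kz : (k < z)%N by lia.
have Nz' : (cell_bound t z.+1 <= z.+1)%N by rewrite bE.
have kN' : (k < cell_bound t z.+1)%N by rewrite bE; lia.
have zN' : (z < cell_bound t z.+1)%N by rewrite bE.
have kzc : cell t k != cell t z by rewrite !cE; lia.
have zkc : cell t z != cell t k by rewrite eq_sym.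
have tSS : t = SL \/ t = SP by left.
pose y := gy C t z.+1; pose h := y k k - y z z.
have [kkl lkl] := bracket_gy_diag C Nz' tSS kN' zN' kzc.
have [llk klk] := bracket_gy_diag C Nz' tSS zN' kN' zkc.
have hE : gy C t z k k = h.
  apply: ginf_ext => i j; rewrite /h gcB !gc_gy tSL !eqxx /=.
  by move: ((i == z.+1) && (j == z.+1)) => w; ring.
have ghE : gh C t z k k true = 2 *: h by rewrite /gh hE -mulr2n -scaler_nat.
have [] := @sl2_spanned C t X absX z.+1 z.+1 Nz' (y k z) (y z k) h.
- exact: ylevel_gy.
- exact: ylevel_gy.
- by apply: subspaceB; [exact: ylevel_subspace|exact: ylevel_gy|exact: ylevel_gy].
- by rewrite (bracket_gy_chain C Nz') // eqxx scale1r.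
- by rewrite /h bracketDl bracketNl kkl lkl opprK -mulr2n -scaler_nat.
- by rewrite /h bracketDl bracketNl llk klk -opprD -mulr2n -scaler_nat.
move=> _ _ r3; rewrite ghE; apply: real_spannedZ; first exact: realn.
apply: r3; have -> : h = 2^-1 *: gh C t z k k true.
  by rewrite ghE scalerA mulVf ?scale1r // pnatr_eq0.
by apply: eigen_spannedZ; exact: eigen_gh.
Qed.

(** The long root of a cell: [y k d] is twice a matrix unit, so the [sl(2)] triple consists of the
    halves of [y k d] and [y d k], and of [y k k]. *)
Lemma real_gh_SP_cell n z k b : t = SP -> (cell_bound t n <= z)%N ->
  (k < cell_bound t n)%N ->
  real_spanned X (gh C t z k k b) /\ real_spanned X (gh C t z k (dl t k) b).
Proof.
move=> tSP Nz kN; set d := dl t k.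
have dN : (d < cell_bound t n)%N by rewrite lt_dl.
have tSL : t <> SL by rewrite tSP.
have dk : d != k by rewrite /d tSP /=; case: ifP; lia.
pose y := gy C t z.
have gkd (i j : nat) : gc (y k d) i j = (2 * (i == k)%:R) * (j == d)%:R.
  rewrite gc_gy tSP !formE -tSP dlK -/d.
  have : sg C t d * sg C t k = -1 by rewrite /d sg_dl -mulrA sg_sqr mulr1 /form_sign tSP.
  set a := sg C t d; set b' := sg C t k => ab.
  transitivity ((i == k)%:R * (j == d)%:R * (1 - a * b') : C); last by rewrite ab; ring.
  by case: (i == k); case: (j == d); rewrite /= ?mulr0n ?mulr1n; ring.
have gkk (i j : nat) : gc (y k k) i j = (i == k)%:R * (j == k)%:R - (i == d)%:R * (j == d)%:R.
  rewrite gc_gy tSP !formE -tSP -/d; have := sg_sqr C t k; set b' := sg C t k => b2.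
  transitivity ((i == k)%:R * (j == k)%:R - (i == d)%:R * (j == d)%:R * (b' * b') : C).
    by case: (i == k); case: (j == k); rewrite /= ?mulr0n ?mulr1n; ring.
  by rewrite b2 mulr1.
have kd : (k == d) = false by rewrite eq_sym (negPf dk).
have sumd (a : nat) c (f : nat -> ginf C t) : (a < cell_bound t n)%N ->
    \sum_(m < cell_bound t n) (c * ((m : nat) == a)%:R) *: f m = c *: f a.
  move=> aN; rewrite -(sum_delta_l f aN) scaler_sumr.
  by apply: eq_bigr => m _; rewrite scalerA.
have ydd : y d d = - y k k.
  by rewrite /y /d (gy_dual C z k k tSL) sg_sqr scaleN1r.
have kdk : bracket (y k d) (y d k) = 4 *: y k k.
  rewrite (@bracket_gy _ _ n) //; last exact: block_gy.
  under eq_bigr do rewrite gkd eqxx mulr1.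
  under [X in _ - X]eq_bigr do rewrite gkd eqxx mulr1.
  rewrite (sumd k _ (fun m => gy C t z m k)) // (sumd d) // -/y ydd scalerN opprK -scalerDl; congr (_ *: _); ring.
have kkd : bracket (y k k) (y k d) = 2 *: y k d.
  rewrite (@bracket_gy _ _ n) //; last exact: block_gy.
  have -> : \sum_(m < cell_bound t n) gc (y k k) m k *: gy C t z m d =
      \sum_(m < cell_bound t n) (1 * ((m : nat) == k)%:R) *: gy C t z m d.
    by apply: eq_bigr => m _; rewrite gkk eqxx kd /= mulr0n mulr0 subr0 mulr1 mul1r.
  have -> : \sum_(m < cell_bound t n) gc (y k k) d m *: gy C t z k m =
      \sum_(m < cell_bound t n) ((-1) * ((m : nat) == d)%:R) *: gy C t z k m.
    by apply: eq_bigr => m _; rewrite gkk eqxx (negPf dk) /= mulr0n mul0r sub0r mulr1n mul1r mulN1r.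
  by rewrite (sumd k _ (fun m => gy C t z m d)) // (sumd d) // -scalerBl opprK.
have kdk' : bracket (y k k) (y d k) = - (2 *: y d k).
  rewrite (@bracket_gy _ _ n) //; last exact: block_gy.
  have -> : \sum_(m < cell_bound t n) gc (y k k) m d *: gy C t z m k =
      \sum_(m < cell_bound t n) ((-1) * ((m : nat) == d)%:R) *: gy C t z m k.
    by apply: eq_bigr => m _; rewrite gkk eqxx (negPf dk) /= mulr0n mulr0 sub0r mulr1n mulr1 mulN1r.
  have -> : \sum_(m < cell_bound t n) gc (y k k) k m *: gy C t z d m =
      \sum_(m < cell_bound t n) (1 * ((m : nat) == k)%:R) *: gy C t z d m.
    by apply: eq_bigr => m _; rewrite gkk eqxx kd /= mulr0n mul0r subr0 mulr1n !mul1r.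
  by rewrite (sumd d _ (fun m => gy C t z m k)) // (sumd k) // -scalerBl -scaleNr; congr (_ *: _); ring.
have half2 : 2^-1 * 2 = 1 :> C by rewrite mulVf // pnatr_eq0.
have ekk : eigen_spanned X (y k k).
  have -> : y k k = 2^-1 *: gh C t z k k true.
    by rewrite /gh -mulr2n -scaler_nat scalerA half2 scale1r.
  by apply: eigen_spannedZ; exact: eigen_gh.
have [] := @sl2_spanned C t X absX n z Nz (2^-1 *: y k d) (2^-1 *: y d k) (y k k).
- by apply: subspaceZ; [exact: ylevel_subspace|exact: ylevel_gy].
- by apply: subspaceZ; [exact: ylevel_subspace|exact: ylevel_gy].
- exact: ylevel_gy.
- by rewrite bracketZl bracketZr kdk !scalerA -[4%N]/(2 * 2)%N natrM mulrACA half2 mulr1 scale1r.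
- by rewrite bracketZr kkd !scalerA mulrC.
- by rewrite bracketZr kdk' scalerN !scalerA mulrC.
have gy_gh b' : (if b' then 2^-1 *: y k d + 2^-1 *: y d k else 'i *: (2^-1 *: y k d - 2^-1 *: y d k))
    = 2^-1 *: gh C t z k d b'.
  by rewrite /gh; case: b'; [rewrite scalerDr|rewrite -scalerBr !scalerA mulrC].
move=> r1 r2 r3; split.
  case: b; last by rewrite gh_self; exact: real_spanned0.
  rewrite /gh -mulr2n -scaler_nat; apply: real_spannedZ; first exact: realn.
  exact: r3.
have -> : gh C t z k d b = 2 *: (2^-1 *: gh C t z k d b) by rewrite scalerA mulrC half2 scale1r.
apply: real_spannedZ; first exact: realn.
rewrite -gy_gh; move: (gy_gh b); case: (b) => E; [apply: r1|apply: r2]; rewrite E;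
by apply: eigen_spannedZ; exact: eigen_gh.
Qed.

Lemma real_gh n z k l b : (cell_bound t n <= z)%N ->
  (k < cell_bound t n)%N -> (l < cell_bound t n)%N -> real_spanned X (gh C t z k l b).
Proof.
move=> Nz kN lN.
have [orth|orthF] := pselect (is_orthogonal t); first exact: (real_gh_orthogonal b orth Nz).
have tSS : t = SL \/ t = SP.
  by move: orthF; rewrite /is_orthogonal; case: (t); [left|case; left|case; right|right].
have [kl|kl] := eqVneq (cell t k) (cell t l); last exact: (real_gh_cells b tSS Nz).
have [<-|kdl] := cell_eq kl.
  by case: tSS => tE; [exact: (real_gh_diag_SL b tE Nz)|have [] := real_gh_SP_cell b tE Nz kN].
case: tSS => tE.
  have -> : l = k by rewrite kdl tE.
  exact: (real_gh_diag_SL b tE Nz).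
have -> : l = dl t k by rewrite kdl dlK.
by have [] := real_gh_SP_cell b tE Nz kN.
Qed.

Section CasimirLevel.
Variables n z : nat.
Hypothesis Nz : (cell_bound t n <= z)%N.

Lemma yspan_decomposition v : exists2 w, yspan n z v w &
  forall k l : 'I_(cell_bound t n),
    lact (gy C t z k l) (v - casimir (@yact C t X n z) w) = 0.
Proof.
have [||||w [gw wE]] := @casimir_decomposition C X _ (@yact C t X n z) _ _ _ _ v.
- by move=> k l; exact: lact_linearr.
- exact: bracket_yact.
- exact: eigen_hermitian.
- move=> [[k l] b] u; apply: lin_spanW (real_gh b Nz (ltn_ord k) (ltn_ord l) u) => x [mu muR xE].
  by exists mu => //; rewrite hermitian_gh.
by exists w.
Qed.

Lemma yspan_invariants v :
  lin_span [set w | exists (k l : 'I_(cell_bound t n)) u, w = lact (gy C t z k l) u] v ->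
  (forall k l : 'I_(cell_bound t n), lact (gy C t z k l) v = 0) -> v = 0.
Proof.
apply: (@casimir_invariants C X _ (@yact C t X n z)).
- by move=> k l; exact: lact_linearr.
- exact: bracket_yact.
- exact: eigen_hermitian.
- move=> [[k l] b] u; apply: lin_spanW (real_gh b Nz (ltn_ord k) (ltn_ord l) u) => x [mu muR xE].
  by exists mu => //; rewrite hermitian_gh.
Qed.

End CasimirLevel.

End RealSpectrum.

(** * Extension of the coordinates *)

Section VectorValuedTensors.
Variables (F : fieldType) (t : series) (p q : nat) (N : lieModType (ginf F t)).
Notation slot := ('I_p + 'I_q)%type.
Notation multi_index := {ffun slot -> nat}.
Implicit Types (x y : ginf F t) (I J : multi_index).

(* [N (x) T] is realized in the space of functions from the multi-indices to [N]. *)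
Definition vfun : Type := multi_index -> N.
HB.instance Definition _ := GRing.Lmodule.on vfun.
Implicit Types f g : vfun.

Definition bound_of x : nat := projT1 (cid (ginf_boundedE x)).

Lemma bound_ofP x : bounded (bound_of x) (gc x).
Proof. exact: projT2 (cid (ginf_boundedE x)). Qed.

Definition slots_act x f : vfun := fun I => \sum_s \sum_(k < bound_of x)
  (slot_mx (gc x) s (I s) k) *: f (upd I s k).

(** Functionals separate the vectors of [N], so identities for [slots_act] reduce to those for
    scalar functions. *)
Lemma slots_act_functional (g : N -> F) x f I : linear_on setT g ->
  g (slots_act x f I) = @tens_act F p q (gc x) (fun J => g (f J)) I.
Proof.
move=> lg; have lg' : linear (g : N -> F^o) by move=> a u v; exact: lg.
have [g0 gD _ gZ] := linear_fun_rules lg'.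
rewrite /slots_act (big_morph g gD g0) /tens_act; apply: eq_bigr => s _.
rewrite (big_morph g gD g0) (slot_actE _ _ _ (@bound_ofP x)).
by apply: eq_bigr => k _; rewrite gZ.
Qed.

Definition vfun_act x f : vfun := fun I => lact x (f I) + slots_act x f I.

Lemma tens_act_bracket x y (h : multi_index -> F) I :
  @tens_act F p q (gc (bracket x y)) h I =
  @tens_act F p q (gc x) (@tens_act F p q (gc y) h) I -
  @tens_act F p q (gc y) (@tens_act F p q (gc x) h) I.
Proof.
have [n [bx by_]] := ginf_bounded x y.
rewrite {2 4}/tens_act.
under [X in X - _]eq_bigr do rewrite (@slot_act_sum _ _ _ n) //.
under [X in _ - X]eq_bigr do rewrite (@slot_act_sum _ _ _ n) //.
rewrite [X in _ - X]exchange_big -sumrB; apply: eq_bigr => s _ /=.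
rewrite -sumrB (bigD1 s) //= big1 => [|s' s's].
  by rewrite addr0 (@slot_act_commutator _ _ _ n).
by rewrite (@slot_act_comm _ _ _ n) // ?subrr // eq_sym.
Qed.

Lemma tens_act_lin n X a (h h' : multi_index -> F) I : bounded n X ->
  @tens_act F p q X (fun J => a * h J + h' J) I =
  a * @tens_act F p q X h I + @tens_act F p q X h' I.
Proof.
move=> bX; rewrite /tens_act mulr_sumr -big_split; apply: eq_bigr => s _ /=.
rewrite !(slot_actE _ _ _ bX) mulr_sumr -big_split; apply: eq_bigr => k _ /=; ring.
Qed.

Lemma tens_act_linl a x y (h : multi_index -> F) I :
  @tens_act F p q (gc (a *: x + y)) h I =
  a * @tens_act F p q (gc x) h I + @tens_act F p q (gc y) h I.
Proof.
have [n [bx by_]] := ginf_bounded x y.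
have bxy : bounded n (gc (a *: x + y)).
  by move=> i j ij; rewrite gc_lin [gc x i j]bx // [gc y i j]by_ // mulr0 addr0.
rewrite /tens_act mulr_sumr -big_split; apply: eq_bigr => s _ /=.
rewrite (slot_actE _ _ _ bxy) (@slot_actE _ _ _ n (gc x)) // (@slot_actE _ _ _ n (gc y)) //.
rewrite mulr_sumr -big_split; apply: eq_bigr => l _ /=.
transitivity ((a * slot_mx (gc x) s (I s) l + slot_mx (gc y) s (I s) l) * h (upd I s l));
  last by ring.
congr (_ * _); case: s => s; first by [].
change (- gc (a *: x + y) l (I (inr s)) = a * - gc x l (I (inr s)) - gc y l (I (inr s))).
by rewrite gc_lin; ring.
Qed.

Lemma functional_ext (u w : N) : (forall g : N -> F, linear_on setT g -> g u = g w) -> u = w.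
Proof.
move=> guw; apply: functional_eq => g gD gN gZ g0; apply: guw => a v v' _ _.
by rewrite gD gZ.
Qed.

Lemma slots_actD x f g I :
  slots_act x (fun J => f J + g J) I = slots_act x f I + slots_act x g I.
Proof.
rewrite /slots_act -big_split; apply: eq_bigr => s _; rewrite -big_split.
by apply: eq_bigr => k _; rewrite scalerDr.
Qed.

Lemma lact_slots_act x y f I :
  lact x (slots_act y f I) = slots_act y (fun J => lact x (f J)) I.
Proof.
rewrite lact_sum; apply: eq_bigr => s _; rewrite lact_sum.
by apply: eq_bigr => k _; rewrite lactZ.
Qed.

Fact vfun_act_linearl f : linear (vfun_act^~ f).
Proof.
move=> a x y; apply/funext => I.
change (lact (a *: x + y) (f I) + slots_act (a *: x + y) f I =
  a *: (lact x (f I) + slots_act x f I) + (lact y (f I) + slots_act y f I)).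
have -> : slots_act (a *: x + y) f I = a *: slots_act x f I + slots_act y f I.
  apply: functional_ext => g lg; rewrite lg // !slots_act_functional //.
  exact: tens_act_linl.
by rewrite lact_linearl scalerDr addrACA.
Qed.

Fact vfun_act_linearr x : linear (vfun_act x).
Proof.
move=> a f g; apply/funext => I.
change (lact x (a *: f I + g I) + slots_act x (fun J => a *: f J + g J) I =
  a *: (lact x (f I) + slots_act x f I) + (lact x (g I) + slots_act x g I)).
have -> : slots_act x (fun J => a *: f J + g J) I = a *: slots_act x f I + slots_act x g I.
  rewrite slots_actD; congr (_ + _); rewrite /slots_act scaler_sumr; apply: eq_bigr => s _.
  by rewrite scaler_sumr; apply: eq_bigr => k _; rewrite !scalerA mulrC.
by rewrite lact_linearr scalerDr addrACA.
Qed.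

Fact vfun_act_bracket x y f :
  vfun_act (bracket x y) f = vfun_act x (vfun_act y f) - vfun_act y (vfun_act x f).
Proof.
apply/funext => I.
change (lact (bracket x y) (f I) + slots_act (bracket x y) f I =
  (lact x (lact y (f I) + slots_act y f I) +
    slots_act x (fun J => lact y (f J) + slots_act y f J) I) -
  (lact y (lact x (f I) + slots_act x f I) +
    slots_act y (fun J => lact x (f J) + slots_act x f J) I)).
have -> : slots_act (bracket x y) f I =
    slots_act x (slots_act y f) I - slots_act y (slots_act x f) I.
  apply: functional_ext => g lg; have lg' : linear (g : N -> F^o) by move=> a u v; exact: lg.
  have [g0 gD gN gZ] := linear_fun_rules lg'.
  rewrite gD gN !slots_act_functional // tens_act_bracket.
  have E z : (fun J => g (slots_act z f J)) = @tens_act F p q (gc z) (fun J => g (f J)).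
    by apply/funext => J; rewrite slots_act_functional.
  by rewrite !E.
rewrite lact_bracket !lactD !lact_slots_act !slots_actD.
apply: functional_eq => g gD gN gZ g0; rewrite !(gD, gN); ring.
Qed.

HB.instance Definition _ := isLieModule.Build F (ginf F t) vfun
  vfun_act_linearl vfun_act_linearr vfun_act_bracket.

Definition prodt (m : N) (s : tensor F p q) : vfun := fun I => (tval s I : F) *: m.

Lemma prodt_linearl s : linear (prodt^~ s).
Proof.
move=> a m m'; apply/funext => I.
change ((tval s I : F) *: (a *: m + m') = a *: ((tval s I : F) *: m) + (tval s I : F) *: m').
by rewrite scalerDr !scalerA mulrC.
Qed.

Lemma prodt_linearr m : linear (prodt m).
Proof.
move=> a s s'; apply/funext => I.
change ((a * tval s I + tval s' I : F) *: m =
  a *: ((tval s I : F) *: m) + (tval s' I : F) *: m).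
by rewrite scalerDl scalerA.
Qed.

Lemma lact_prodt x m s : lact x (prodt m s) = prodt (lact x m) s + prodt m (lact x s).
Proof.
apply/funext => I.
change (lact x ((tval s I : F) *: m) + slots_act x (prodt m s) I =
  (tval s I : F) *: lact x m + (@tens_act F p q (gc x) (tval s) I : F) *: m).
rewrite lactZ; congr (_ + _); apply: functional_ext => g lg.
have lg' : linear (g : N -> F^o) by move=> a u v; exact: lg.
have [_ _ _ gZ'] := linear_fun_rules lg'; have gZ a u : g (a *: u) = a * g u := gZ' a u.
rewrite slots_act_functional // gZ /tens_act mulr_suml; apply: eq_bigr => l _.
rewrite (slot_actE _ _ _ (@bound_ofP x)) [in RHS](slot_actE _ _ _ (@bound_ofP x)).
rewrite mulr_suml; apply: eq_bigr => k _.
by rewrite /prodt gZ; exact: mulrA.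
Qed.

Definition prod_span : set vfun := lin_span [set w | exists m s, w = prodt m s].

Lemma prod_span_submodule : submodule prod_span.
Proof.
have [s0 sP] := lin_span_subspace [set w | exists m s, w = prodt m s].
split=> // x u; elim=> [|a w v [m [s ->]] _ IH]; first by rewrite lact0r.
rewrite lactD lactZ lact_prodt; apply: (subspaceD (conj s0 sP)) => //.
apply: (subspaceZ _ (conj s0 sP)); apply: (subspaceD (conj s0 sP));
by apply: lin_span_sub; do 2!eexists.
Qed.

Definition tensor_product : lieModType (ginf F t) := submod_type prod_span_submodule.

Lemma prod_spanP (m : N) s : prodt m s \in submod_pred prod_span_submodule.
Proof. by apply/asboolP/lin_span_sub; exists m, s. Qed.

Definition tprod m s : tensor_product := SubmodType (prod_spanP m s).

Lemma tprod_linearl s : linear (tprod^~ s).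
Proof. by move=> a m m'; apply: val_inj; exact: prodt_linearl. Qed.

Lemma tprod_linearr m : linear (tprod m).
Proof. by move=> a s s'; apply: val_inj; exact: prodt_linearr. Qed.

Lemma lact_tprod x m s : lact x (tprod m s) = tprod (lact x m) s + tprod m (lact x s).
Proof. by apply: val_inj; exact: lact_prodt. Qed.

Lemma tprod_span (w : tensor_product) : lin_span [set w | exists m s, w = tprod m s] w.
Proof.
case: w => w wP; have /asboolP Ww := wP.
elim: Ww wP => [|a u v [m [s ->]] Wv IH] wP.
  rewrite (_ : SubmodType wP = 0); first exact: lin_span0.
  exact: val_inj.
have /asboolP vP := Wv.
rewrite (_ : SubmodType wP = a *: tprod m s + SubmodType vP); last exact: val_inj.
by apply: lin_spanS; [exists m, s|exact: IH].
Qed.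

Lemma tprod_weight_spanned (h : set (ginf F t)) : weight_spanned h N ->
  weight_spanned h (tensor F p q) -> weight_spanned h tensor_product.
Proof.
move=> wN wS w; set W := lin_span _.
have sW : subspace W by exact: lin_span_subspace.
apply: (lin_span_min sW) (tprod_span w) => _ [m [s ->]].
elim: (wN m) => [|a u v [lam uE] _ IH].
  by have [-> _ _ _] := linear_fun_rules (tprod_linearl s); case: sW.
rewrite (tprod_linearl s); apply: (proj2 sW) => //.
elim: (wS s) => [|b r r' [mu rE] _ IH'].
  by have [-> _ _ _] := linear_fun_rules (tprod_linearr u); case: sW.
rewrite (tprod_linearr u); apply: (proj2 sW) => //.
apply: lin_span_sub; exists (fun z => lam z + mu z) => z.
have [_ _ _ Zl] := linear_fun_rules (tprod_linearl r).
have [_ _ _ Zr] := linear_fun_rules (tprod_linearr u).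
by rewrite lact_tprod uE rE Zl Zr scalerDl.
Qed.

End VectorValuedTensors.

(** Matches the slots of a tensor module with those of its dual, where vectors and covectors are
    exchanged. *)
Definition swap_slot (p q : nat) (s : 'I_p + 'I_q) : 'I_q + 'I_p :=
  match s with inl i => inr i | inr j => inl j end.

Lemma swap_slotK p q : cancel (@swap_slot p q) (@swap_slot q p).
Proof. by case. Qed.

Definition swap_index (p q : nat) (I : {ffun 'I_p + 'I_q -> nat}) :
  {ffun 'I_q + 'I_p -> nat} := [ffun s => I (swap_slot s)].

Lemma swap_indexK p q : cancel (@swap_index p q) (@swap_index q p).
Proof. by move=> I; apply/ffunP => s; rewrite !ffunE swap_slotK. Qed.

Section Contragredient.
Variables (F : fieldType) (t : series) (p q : nat).
Implicit Types (x : ginf F t).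

Lemma lact_basis x n (J : {ffun 'I_p + 'I_q -> nat}) : bounded n (gc x) ->
  lact x (@basis_tensor F p q J) = \sum_s \sum_(k < n)
    slot_mx (gc x) s k (J s) *: @basis_tensor F p q (upd J s k).
Proof.
move=> bx; apply: tensor_ext => I; rewrite tensor_sum_fun.
change (\sum_s slot_act (gc x) s (tval (@basis_tensor F p q J)) I =
  \sum_s (tval (\sum_(k < n) slot_mx (gc x) s k (J s) *: @basis_tensor F p q (upd J s k)) I : F)).
apply: eq_bigr => s _; rewrite tensor_sum_fun (slot_actE _ _ _ bx).
have bs : bounded n (slot_mx (gc x) s) by exact: slot_mx_bounded.
pose e := [forall r, (r == s) || (I r == J r)].
have eP (k l : nat) (K L : {ffun 'I_p + 'I_q -> nat}) :
    (upd K s l == L) = (l == L s) && [forall r, (r == s) || (K r == L r)].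
  apply/eqP/andP => [<-|[/eqP lE /forallP KL]].
    rewrite upd_same eqxx; split=> //; apply/forallP => r.
    by case: eqVneq => //= rs; rewrite upd_other.
  by apply/ffunP => r; rewrite ffunE; have := KL r; case: eqVneq => [->|_ /= /eqP].
transitivity (slot_mx (gc x) s (I s) (J s) * e%:R).
  rewrite (@ord_single _ _ (fun l => slot_mx (gc x) s (I s) l *
    tval (@basis_tensor F p q J) (upd I s l)) (J s)).
  - by rewrite basis_tensorE eP // eqxx.
  - by move=> l _ lJ; rewrite basis_tensorE eP // (negPf lJ) mulr0.
  - by move=> nJ; rewrite bs ?nJ ?orbT // mul0r.
rewrite (@ord_single _ _ (fun k => slot_mx (gc x) s k (J s) *
    tval (@basis_tensor F p q (upd J s k)) I : F) (I s)).
- rewrite basis_tensorE eq_sym eP // eqxx; congr (_ * _%:R); congr (nat_of_bool _).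
  by apply: eq_forallb => r; rewrite [J r == _]eq_sym.
- by move=> l _ lI; rewrite basis_tensorE eq_sym eP // (negPf lI) mulr0.
- by move=> nI; rewrite bs ?nI // mul0r.
Qed.

(** Each slot matrix is minus the transpose of the one at the swapped slot. This is what turns the
    invariance of a functional into the equivariance of its coordinates. *)
Lemma tens_act_contragredient x n (h : {ffun 'I_p + 'I_q -> nat} -> F) I : bounded n (gc x) ->
  @tens_act F p q (gc x) h I = - \sum_s \sum_(k < n)
    slot_mx (gc x) s k (swap_index I s) * h (swap_index (upd (swap_index I) s k)).
Proof.
move=> bx; rewrite /tens_act (reindex (@swap_slot q p)) /=; last first.
  by exists (@swap_slot p q) => s _; exact: swap_slotK.
rewrite -sumrN; apply: eq_bigr => s _; rewrite (slot_actE _ _ _ bx) -sumrN.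
apply: eq_bigr => k _; rewrite [swap_index I s]ffunE.
have -> : slot_mx (gc x) (swap_slot s) (I (swap_slot s)) k =
    - slot_mx (gc x) s k (I (swap_slot s)) by case: s => s /=; rewrite /dualinf ?opprK.
rewrite mulNr; congr (- (_ * h _)); apply/ffunP => r; rewrite !ffunE swap_slotK.
by rewrite (can2_eq (@swap_slotK p q) (@swap_slotK q p)).
Qed.

Lemma tensor_absolute_weight : absolute_weight (tensor F p q : lieModType (ginf F t)).
Proof.
move=> h sh; apply/weight_moduleP/tensor_weight_spanned => s k.
exact: splitting_natural_weight.
Qed.

End Contragredient.

(** * Extension of the invariant functional *)

Section ExtendCoordinates.
Variables (C : numClosedFieldType) (t : series) (p q : nat).
Variables (M N : lieModType (ginf C t)) (f : lie_hom M N).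
Variable u : lie_hom M (tensor C p q : lieModType (ginf C t)).
Hypothesis absN : absolute_weight N.
Hypothesis inj_f : injective f.
Local Notation X := (@tensor_product C t q p N).
Local Notation basis J := (@basis_tensor C q p J).

Let absX : absolute_weight X.
Proof.
move=> h sh; apply/weight_moduleP/tprod_weight_spanned; first exact/weight_moduleP/absN.
by apply/weight_moduleP; exact: tensor_absolute_weight.
Qed.

Let level n (w : X) := lin_span
  [set v | exists (k l : 'I_(cell_bound t n)) v', v = lact (gy C t (cell_bound t n) k l) v'] w.

Let action_span : set X := lin_span [set v | exists x v', v = lact x v'].

(** By [ginf_expansion], an element supported in a finite level is a combination of the [gy] of
    every larger level. *)
Let action_level w : action_span w -> exists n, forall n', (n <= n')%N -> level n' w.
Proof.
elim=> [|a _ v [x [v' ->]] _ [n nv]]; first by exists 0%N => n' _; exact: lin_span0.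
have [b bx] := ginf_boundedE x; exists (maxn b n) => n'; rewrite geq_max => /andP[bn nn].
have sL : subspace (level n') by exact: lin_span_subspace.
apply: (proj2 sL); last exact: nv.
have c0 : (if t is SL then 1 else 2 : C) != 0.
  by case: (t); rewrite ?oner_eq0 // pnatr_eq0.
have bN : bounded (cell_bound t n') (gc x).
  by apply: boundedW bx; apply: leq_trans bn _; case: (t) => //=; lia.
apply: (subspaceZr sL c0); rewrite -lactZl -(ginf_expansion (leqnn _) bN) lact_suml.
apply: subspace_sum => // k _; rewrite lact_suml; apply: subspace_sum => // l _.
by rewrite lactZl; apply: subspaceZ => //; apply: lin_span_sub; exists k, l, v'.
Qed.

(* On [f M (x) S] every vector that is a sum of vectors [x w] is already a sum of
   vectors [x w] with [w] in [f M (x) S]: by the Casimir decomposition of [X]. *)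
Let action_span_sub (Y : set X) w : submodule Y -> Y w -> action_span w ->
  lin_span [set v | exists x v', Y v' /\ v = lact x v'] w.
Proof.
move=> [Y0 YP Yact] Yw /action_level[n /(_ n (leqnn n)) nw].
set z := cell_bound t n in nw.
have [w' gw' w'E] := yspan_decomposition absX (leqnn z) w.
have sY : subspace Y by [].
have Yw' : Y w' by apply: gw' => // -[k l] v Yv; exact: Yact.
have /eqP : w - casimir (@yact C t X n z) w' = 0.
  apply: (yspan_invariants absX (leqnn z)) => //.
  have sL : subspace (level n) by exact: lin_span_subspace.
  apply: (subspaceB sL nw); apply: subspace_sum => // k _; apply: subspace_sum => // l _.
  by apply: lin_span_sub; exists k, l; eexists.
rewrite subr_eq0 => /eqP ->; apply: subspace_sum => [|k _]; first exact: lin_span_subspace.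
apply: subspace_sum => [|l _]; first exact: lin_span_subspace.
by apply: lin_span_sub; eexists; eexists; split; last reflexivity; exact: Yact.
Qed.

Let Y : set X := lin_span [set w | exists m s, w = tprod (f m) s].

Let Y_submodule : submodule Y.
Proof.
have sY : subspace Y by exact: lin_span_subspace.
split; [by case: sY|by case: sY|move=> x w; elim=> [|a _ v [m [s ->]] _ IH]].
  by rewrite lact0r; case: sY.
rewrite lactD lactZ lact_tprod -lie_homP; apply: (subspaceD sY) => //.
by apply: (subspaceZ _ sY); apply: (subspaceD sY); apply: lin_span_sub; do 2!eexists.
Qed.

Let xc (w : X) : {ffun 'I_q + 'I_p -> nat} -> N := (submod_val w : vfun q p N).

(** The preimage under [f] is unique; [0] is the default off the image of [f], which the components
    of elements of [Y] never leave. *)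
Let coef (J : {ffun 'I_q + 'I_p -> nat}) (v : N) : C :=
  if pselect (exists m, f m = v) is left e
  then tval (u (projT1 (cid e))) (swap_index J) else 0.

Let coef_f J m : coef J (f m) = tval (u m) (swap_index J).
Proof.
rewrite /coef; case: pselect => [e|]; last by case; exists m.
by case: (cid e) => m' /= /inj_f ->.
Qed.

Let coef0 J : coef J 0 = 0.
Proof. by rewrite -[0 in LHS](linear0 f) coef_f linear0. Qed.

(** The pairing of [u m] with [s], for [w] the product of [f m] and [s], written on components
    because [X] is realized by functions. *)
Let phi0 (w : X) : C := \sum_(J \in [set: {ffun 'I_q + 'I_p -> nat}]) coef J (xc w J).

Let Yok (w : X) := (forall J, exists m, f m = xc w J) /\
  exists r : seq {ffun 'I_q + 'I_p -> nat}, uniq r /\ forall J, J \notin r -> xc w J = 0.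

Let Y_ok w : Y w -> Yok w.
Proof.
elim=> [|a _ v [m [s ->]] _ [vf [r [ur rv]]]].
  by split=> [J|]; [exists 0; rewrite linear0|exists [::]].
split=> [J|].
  have [m' m'E] := vf J; exists (a *: ((tval s J : C) *: m) + m').
  by rewrite linearP linearZ /= m'E.
have [r' [ur' rs]] := tensor_support s; exists (undup (r ++ r')).
split; first exact: undup_uniq.
move=> J; rewrite mem_undup mem_cat negb_or => /andP[Jr Jr'].
change (a *: ((tval s J : C) *: f m) + xc v J = 0).
by rewrite rs // rv // scale0r scaler0 addr0.
Qed.

Let phi0E w (r : seq {ffun 'I_q + 'I_p -> nat}) : uniq r ->
  (forall J, J \notin r -> xc w J = 0) -> phi0 w = \sum_(J <- r) coef J (xc w J).
Proof.
by move=> ur r0; rewrite /phi0 (@fsbig_uniq_seq _ _ _ r) // => J Jr; rewrite r0 ?coef0.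
Qed.

Let phi0_linear : linear_on Y phi0.
Proof.
move=> a v w /Y_ok[vf [r [ur rv]]] /Y_ok[wf [r' [ur' rw]]].
pose R := undup (r ++ r'); have uR : uniq R by exact: undup_uniq.
have inR J : J \notin R -> J \notin r /\ J \notin r'.
  by rewrite mem_undup mem_cat negb_or => /andP.
rewrite !(@phi0E _ R) //; first last.
- by move=> J /inR[Jr Jr']; change (a *: xc v J + xc w J = 0);
    rewrite rv // rw // scaler0 addr0.
- by move=> J /inR[]; move/rv.
- by move=> J /inR[_]; move/rw.
rewrite mulr_sumr -big_split; apply: eq_bigr => J _ /=.
change (coef J (a *: xc v J + xc w J) = a * coef J (xc v J) +
  coef J (xc w J)).
by have [m <-] := vf J; have [m' <-] := wf J; rewrite -linearP !coef_f linearP.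
Qed.

Let phi0_basis m J : phi0 (tprod (f m) (basis J)) = tval (u m) (swap_index J).
Proof.
rewrite (@phi0E _ [:: J]) // => [|K].
  rewrite big_seq1; change (coef J ((tval (basis J) J : C) *: f m) = tval (u m) (swap_index J)).
  by rewrite basis_tensorE eqxx scale1r coef_f.
rewrite inE => KJ; change ((tval (basis J) K : C) *: f m = 0).
by rewrite basis_tensorE (negPf KJ) scale0r.
Qed.

(** This is the equivariance of [u]: by linearity it is tested on basis tensors, where the two terms
    of the Leibniz rule cancel by [tens_act_contragredient]. *)
Let phi0_invariant w x : Y w -> phi0 (lact x w) = 0.
Proof.
have sY : subspace Y by exact: lin_span_subspace.
have Yx v : Y v -> Y (lact x v) by case: Y_submodule => _ _; exact.
have p0 : phi0 0 = 0.
  have := phi0_linear (-1) (proj1 sY) (proj1 sY).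
  by rewrite scaler0 addr0 mulN1r addNr.
have pD v v' : Y v -> Y v' -> phi0 (v + v') = phi0 v + phi0 v'.
  by move=> Yv Yv'; have := phi0_linear 1 Yv Yv'; rewrite scale1r mul1r.
have pZ a v : Y v -> phi0 (a *: v) = a * phi0 v.
  by move=> Yv; have := phi0_linear a Yv (proj1 sY); rewrite p0 !addr0.
have psum (T : finType) (g : T -> X) : (forall i, Y (g i)) ->
    phi0 (\sum_i g i) = \sum_i phi0 (g i).
  move=> Yg; suff [] : Y (\sum_i g i) /\ phi0 (\sum_i g i) = \sum_i phi0 (g i) by [].
  elim/big_rec2: _ => [|i c v _ [Yv <-]]; first by split=> //; case: sY.
  by split; [exact: subspaceD|rewrite pD].
have Yt m s : Y (tprod (f m) s) by apply: lin_span_sub; exists m, s.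
elim=> [|a _ v [m [s ->]] Yv IH]; first by rewrite lact0r.
rewrite lactD lactZ phi0_linear ?IH; [|exact/Yx/Yt|exact/Yx].
rewrite addr0; apply/eqP; rewrite mulf_eq0; apply/orP; right; apply/eqP.
have [r [ur rs]] := tensor_support s.
have [T0 TD _ TZ] := linear_fun_rules (@tprod_linearr C t q p N (f m)).
rewrite (tensor_basis_sum ur rs) (big_morph _ TD T0) lact_sum.
have : forall J, phi0 (lact x (tprod (f m) (basis J))) = 0.
  move=> J; have [n bx] := ginf_boundedE x.
  rewrite lact_tprod -lie_homP pD // phi0_basis lie_homP (lact_basis J bx).
  rewrite (big_morph _ TD T0) psum //.
  change (@tens_act C p q (gc x) (tval (u m)) (swap_index J) + \sum_(i : 'I_q + 'I_p)
    phi0 (tprod (f m) (\sum_(k < n) slot_mx (gc x) i k (J i) *: basis (upd J i k))) = 0 :> C).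
  rewrite (tens_act_contragredient _ _ bx) swap_indexK addrC; apply/eqP; rewrite subr_eq0.
  apply/eqP/eq_bigr => j _; rewrite (big_morph _ TD T0) psum //.
  by apply: eq_bigr => k _; rewrite TZ pZ // phi0_basis.
elim: r {ur rs} => [|J r IHr] pJ; first by rewrite big_nil.
rewrite big_cons TZ lactZ phi0_linear ?pJ ?IHr ?mulr0 ?addr0 //; first exact/Yx/Yt.
by apply: subspace_sum => // K _; exact/Yx/Yt.
Qed.

(** On [Y + action_span] the functional [g] is [phi0] on the first summand and [0] on the second.
    This is consistent: by [action_span_sub] a vector in both is a sum of [lact x v] with [v] in
    [Y], where [phi0] vanishes. Any linear extension is invariant, because it vanishes on
    [action_span]. *)
Lemma extend_coordinates : exists psi : N -> {ffun 'I_p + 'I_q -> nat} -> C,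
  [/\ forall a v v' I, psi (a *: v + v') I = a * psi v I + psi v' I,
      forall x v I, psi (lact x v) I = @tens_act C p q (gc x) (psi v) I
    & forall m I, psi (f m) I = tval (u m) I].
Proof.
have sY : subspace Y by exact: lin_span_subspace.
have sA : subspace action_span by exact: lin_span_subspace.
have Yx x v : Y v -> Y (lact x v) by case: Y_submodule => _ _; exact.
have disj w : Y w -> action_span w -> phi0 w = 0.
  move=> Yw Aw; have := action_span_sub Y_submodule Yw Aw.
  suff Z : subspace [set v | Y v /\ phi0 v = 0].
    by move=> Sw; apply: (proj2 (lin_span_min Z _ Sw)) => _ [x [v [Yv ->]]]; split;
      [exact: Yx|exact: phi0_invariant].
  split=> [|a v v' [Yv v0] [Yv' v0']].
    split; [by case: sY|have := phi0_linear (-1) (proj1 sY) (proj1 sY)].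
    by rewrite scaler0 addr0 mulN1r addNr.
  by split; [apply: (proj2 sY)|rewrite phi0_linear // v0 v0' mulr0 addr0].
pose P w := exists v, Y v /\ action_span (w - v).
have sP : subspace P.
  split; first by exists 0; rewrite subr0; split; [case: sY|case: sA].
  move=> a w w' [v [Yv wv]] [v' [Yv' wv']]; exists (a *: v + v').
  split; first exact: (proj2 sY).
  by rewrite opprD addrACA -scalerBr; apply: (proj2 sA).
pose g w := phi0 (xget 0 [set v | Y v /\ action_span (w - v)]).
have gE w v : Y v -> action_span (w - v) -> g w = phi0 v.
  move=> Yv wv; rewrite /g; case: xgetP => [v' _ /= [Yv' wv']|/(_ v)]; last by case.
  apply/eqP; rewrite -subr_eq0; apply/eqP.
  have -> : phi0 v' - phi0 v = phi0 (- 1 *: v + v').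
    by rewrite phi0_linear // mulN1r addrC.
  apply: disj; first exact: (proj2 sY).
  rewrite (_ : - 1 *: v + v' = (w - v) - (w - v')); first exact: subspaceB.
  by apply: functional_eq => h hD hN hZ _; rewrite !(hD, hN, hZ); ring.
have lin_g : linear_on P g.
  move=> a w w' [v [Yv wv]] [v' [Yv' wv']].
  rewrite (@gE _ (a *: v + v')); first last.
  - by rewrite opprD addrACA -scalerBr; apply: (proj2 sA).
  - exact: (proj2 sY).
  by rewrite phi0_linear // (gE w v) // (gE w' v').
have [phi [lphi phiE]] := extend_functional sP lin_g.
have lphi' : linear (phi : X -> C^o) by move=> a v v'; exact: lphi.
have [p0 pD pN pZ'] := linear_fun_rules lphi'.
have pZ a v : phi (a *: v) = a * phi v by exact: pZ'.
have phiA w : action_span w -> phi w = 0.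
  move=> Aw; rewrite phiE; last by exists 0; rewrite subr0; split=> //; case: sY.
  rewrite (@gE w 0) ?subr0 //; last by case: sY.
  by apply: disj; [case: sY|case: sA].
have phiY w : Y w -> phi w = phi0 w.
  move=> Yw; have Aw : action_span (w - w) by rewrite subrr; case: sA.
  by rewrite phiE; [exact: gE|exists w].
exists (fun v I => phi (tprod v (basis (swap_index I)))); split.
- by move=> a v v' I; rewrite (tprod_linearl (basis (swap_index I))) lphi.
- move=> x v I; have [n bx] := ginf_boundedE x.
  have /eqP : phi (lact x (tprod v (basis (swap_index I)))) = 0.
    by apply: phiA; apply: lin_span_sub; exists x; eexists.
  have [T0 TD _ TZ] := linear_fun_rules (@tprod_linearr C t q p N v).
  rewrite lact_tprod pD addr_eq0 => /eqP ->; rewrite (tens_act_contragredient _ _ bx).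
  congr (- _); rewrite (lact_basis _ bx) (big_morph _ TD T0) (big_morph phi pD p0).
  apply: eq_bigr => s _; rewrite (big_morph _ TD T0) (big_morph phi pD p0).
  by apply: eq_bigr => k _; rewrite TZ pZ swap_indexK.
- move=> m I; rewrite phiY; last by apply: lin_span_sub; do 2!eexists.
  by rewrite phi0_basis swap_indexK.
Qed.

End ExtendCoordinates.

(** * Asymptotic invariance and contractions *)

Section AsymptoticInvariance.
Variables (C : numClosedFieldType) (t : series) (p q : nat).
Notation multi_index := {ffun 'I_p + 'I_q -> nat}.
Implicit Types (x : ginf C t) (n z k l : nat) (b si : bool) (h : multi_index -> C)
  (I J : multi_index).
Local Notation act x h := (@tens_act C p q (gc x) h).
Local Notation y z := (gy C t z).

Definition kills h x := forall I, act x h I = 0.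

Lemma tens_act_row0 X h I : (forall s l, @slot_mx C p q X s (I s) l = 0) ->
  @tens_act C p q X h I = 0.
Proof.
move=> X0; rewrite /tens_act big1 // => s _; rewrite /slot_act /vact.
by rewrite fsbig1 // => l _; rewrite X0 mul0r.
Qed.

Lemma kills_subspace h : subspace (kills h).
Proof.
split=> [I|a x x' hx hx' I]; last by rewrite tens_act_linl hx hx' mulr0 addr0.
by apply: tens_act_row0 => -[] s l //=; rewrite /dualinf; exact: oppr0.
Qed.

Lemma kills_bracket h x x' : kills h x -> kills h x' -> kills h (bracket x x').
Proof.
move=> hx hx' I; rewrite tens_act_bracket.
have act0 v g : (forall J, g J = 0) -> act v g I = 0.
  move=> g0; have [b bv] := ginf_boundedE v.
  rewrite /tens_act big1 // => s _; rewrite (slot_actE _ _ _ bv) big1 // => l _.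
  by rewrite g0 mulr0.
by rewrite !act0 // subrr.
Qed.

Lemma gy_row0 z k l i j : cell t k != cell t l -> cell t i != cell t k -> cell t i != cell t l ->
  gc (y z k l) i j = 0 /\ gc (y z k l) j i = 0.
Proof.
move=> kl ik il; have [klF _] := cell_neq C kl; have [ikF fki] := cell_neq C ik.
have [ilF _] := cell_neq C il.
have li : cell t l != cell t i by rewrite eq_sym.
have ki : cell t k != cell t i by rewrite eq_sym.
have [_ fli] := cell_neq C li; have [_ fki'] := cell_neq C ki.
by rewrite !gc_gy ikF ilF fli fki' klF /= andbF mulr0 mul0r if_same_SL subrr.
Qed.

Lemma gy_cells z z' k l : cell t k != cell t l -> y z k l = y z' k l.
Proof.
move=> kl; have [klF _] := cell_neq C kl.
by apply: ginf_ext => i j; rewrite !gc_gy klF.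
Qed.

Lemma gy_gh z k l : y z k l = 2^-1 *: gh C t z k l true - ('i / 2) *: gh C t z k l false.
Proof.
have i2 : 'i * 'i = -1 :> C by rewrite -expr2 sqrCi.
have h2 : 2^-1 + 2^-1 = 1 :> C.
  by rewrite -mulr2n -[LHS]mulr_natr mulVf // pnatr_eq0.
rewrite /gh scalerA mulrAC i2; apply: functional_eq => g gD gN gZ _.
rewrite !(gD, gN, gZ); transitivity ((2^-1 + 2^-1) * g (y z k l)); first by rewrite h2 mul1r.
ring.
Qed.

Definition rep c : nat := if t is SP then c.*2 else c.

Lemma cell_rep c : cell t (rep c) = c.
Proof. by rewrite /rep; case: (t) => //=; exact: doubleK. Qed.

Lemma sg_rep c : sg C t (rep c) = 1.
Proof. by rewrite /sg /rep; case: (t); rewrite /= ?eqxx ?odd_double //= eqxx. Qed.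

Lemma gy_chain z (a b l : nat) : cell t a != cell t b -> cell t b != cell t l ->
  cell t a != cell t l -> bracket (y z a b) (y z b l) = y z a l.
Proof.
move=> ab bl al; have lb : cell t l != cell t b by rewrite eq_sym.
have [alF _] := cell_neq C al.
pose n := (cell t a + cell t b + cell t l).+1; pose z' := cell_bound t n.
rewrite !(@gy_cells z z') // (@bracket_gy_chain C t n z') ?lt_cell_bound //; try lia.
by rewrite eq_sym alF scale0r subr0.
Qed.

Variables (N : lieModType (ginf C t)) (psi : N -> multi_index -> C).
Hypothesis absN : absolute_weight N.
Hypothesis psi_lin : forall a v v' I, psi (a *: v + v') I = a * psi v I + psi v' I.
Hypothesis psi_act : forall x v I, psi (lact x v) I = act x (psi v) I.

Let psi0 I : psi 0 I = 0.
Proof.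
by have := psi_lin (-1) 0 0 I; rewrite scaler0 addr0 mulN1r addNr.
Qed.

Let psiZ a v I : psi (a *: v) I = a * psi v I.
Proof. by rewrite -[a *: v]addr0 psi_lin psi0 addr0. Qed.

Lemma kills_lin a v v' x : kills (psi v) x -> kills (psi v') x -> kills (psi (a *: v + v')) x.
Proof.
move=> vx v'x I; rewrite -psi_act lactD lactZ psi_lin !psi_act.
by rewrite vx v'x mulr0 addr0.
Qed.

(** Let [w] be a weight vector for a Cartan subalgebra containing all these elements, with
    [psi w I0] nonzero. An element living in cells that avoid [I0] acts by zero at the index [I0],
    so its eigenvalue on [w] is zero and it kills [psi w] everywhere. A vector of [N] is a finite
    sum of weight vectors. *)
Lemma family_kills io si b v : fp_free io -> exists n, forall z k,
  (n <= cell t k)%N -> (n <= io (cell t k))%N -> kills (psi v) (gh C t z k (lift_inv t io si k) b).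
Proof.
move=> ioF.
have [[orth bT]|ob] := pselect (is_orthogonal t /\ b).
  by exists 0%N => z k _ _; rewrite bT gh_orthogonal //; case: (kills_subspace (psi v)).
have [h [sh hg]] := @cartan_family C t io si b ioF ob.
have /weight_moduleP wN := absN sh.
elim: (wN v) => [|a w v' [lam wE] _ [n nP]].
  exists 0%N => z k _ _ I; rewrite -psi_act lact0r; exact: psi0.
suff [n' n'P] : exists n, forall z k, (n <= cell t k)%N -> (n <= io (cell t k))%N ->
    kills (psi w) (gh C t z k (lift_inv t io si k) b).
  exists (maxn n n') => z k; rewrite !geq_max => /andP[nk n'k] /andP[nk' n'k'].
  by apply: kills_lin; [exact: n'P|exact: nP].
have [psiw0|] := pselect (forall I, psi w I = 0).
  exists 0%N => z k _ _ I; pose g : h := exist _ (gh C t z k (lift_inv t io si k) b) (mem_set (hg z k)).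
  by rewrite -psi_act (wE g) psiZ psiw0 mulr0.
move=> /existsNP[I0 wI0]; exists (\max_s (cell t (I0 s)).+1) => z k nk nk' I.
set k' := lift_inv t io si k; pose g : h := exist _ (gh C t z k (lift_inv t io si k) b) (mem_set (hg z k)).
have cs s : (cell t (I0 s) < \max_s (cell t (I0 s)).+1)%N by exact: (leq_bigmax s).
have kk' : cell t k != cell t k' by rewrite /k' cell_lift eq_sym; case: ioF.
have k'k : cell t k' != cell t k by rewrite eq_sym.
have row s l : gc (gh C t z k k' b) (I0 s) l = 0 /\ gc (gh C t z k k' b) l (I0 s) = 0.
  have Ik : cell t (I0 s) != cell t k by have := leq_trans (cs s) nk; lia.
  have Ik' : cell t (I0 s) != cell t k'.
    by rewrite /k' cell_lift; have := leq_trans (cs s) nk'; lia.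
  have [r1 r2] := gy_row0 z l kk' Ik Ik'; have [r3 r4] := gy_row0 z l k'k Ik' Ik.
  rewrite /gh; case: (b); last by rewrite !gcZ !gcB r1 r2 r3 r4 subrr mulr0.
  by rewrite -[y z k k']scale1r !gc_lin r1 r2 r3 r4 mulr0 addr0.
have : act (gh C t z k k' b) (psi w) I0 = 0.
  apply: tens_act_row0 => -[] s l; first by have [r1 _] := row (inl s) l.
  by have [_ r2] := row (inr s) l; rewrite /= /dualinf r2 oppr0.
have gE : lact (gh C t z k k' b) w = lam g *: w by exact: (wE g).
rewrite -!psi_act gE !psiZ => /eqP; rewrite mulf_eq0 => /orP[/eqP ->|/eqP //].
by rewrite mul0r.
Qed.

Lemma family_gy_kills io v : fp_free io -> exists n, forall z k l,
  (n <= cell t k)%N -> (n <= cell t l)%N -> io (cell t k) = cell t l -> kills (psi v) (y z k l).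
Proof.
move=> ioF; have ex si b := family_kills si b v ioF.
have [n nP] := choice (fun sb : bool * bool => ex sb.1 sb.2).
exists (\max_sb n sb) => z k l nk nl kl.
have [si ->] : exists si, l = lift_inv t io si k.
  move: kl; rewrite /lift_inv; case: (t) => /= [->|->|->|kl]; try by exists false.
  exists (odd k (+) odd l); rewrite kl addbA addbb addnC.
  by rewrite -[LHS]odd_double_half.
have nb b : (n (si, b) <= \max_sb n sb)%N by exact: (leq_bigmax (si, b)).
have hk b : kills (psi v) (gh C t z k (lift_inv t io si k) b).
  by apply: (nP (si, b)); [exact: leq_trans nk|rewrite kl; exact: leq_trans nl].
rewrite gy_gh; have sK := kills_subspace (psi v).
by apply: (subspaceB sK); apply: (subspaceZ _ sK); exact: hk.
Qed.

(** [flip4] reverses the blocks from [4m] to [4m + 3], and [shift flip4] does so two places further.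
    With [xor1] they join every number to its successor: [xor1] from even numbers, [flip4] from
    [4m + 1], [shift flip4] from [4m + 3]. *)
Let shift (io : nat -> nat) (j : nat) : nat := if (j < 2)%N then xor1 j else (io (j - 2)%N).+2.
Let flip4 (j : nat) : nat := (j - j %% 4 + (3 - j %% 4))%N.

Let fp_free_flip4 : fp_free flip4.
Proof. by split=> j; rewrite /flip4; lia. Qed.

Let fp_free_shift io : fp_free io -> fp_free (shift io).
Proof.
move=> [ioK ioN]; have [xK xN] : fp_free xor1 := fp_free_xor1 C.
have x2 j : (j < 2)%N -> (xor1 j < 2)%N by rewrite /xor1; case: ifP; lia.
split=> j; rewrite /shift; case: (ltnP j 2) => j2.
- by rewrite x2 // xK.
- by rewrite /= ?subn2 /= ?ioK; lia.
- exact: xN.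
- by have := ioN (j - 2)%N; lia.
Qed.

Let consecutive i : [\/ xor1 i = i.+1 /\ xor1 i.+1 = i, flip4 i = i.+1 /\ flip4 i.+1 = i
  | shift flip4 i = i.+1 /\ shift flip4 i.+1 = i].
Proof.
have : (i %% 4 = 1 \/ i %% 4 = 3 \/ ~~ odd i)%N by lia.
case=> [i1|[i3|oi]].
- by constructor 2; rewrite /flip4; lia.
- constructor 3; rewrite /shift.
  have -> : (i < 2)%N = false by lia.
  have -> : (i.+1 < 2)%N = false by lia.
  by rewrite /flip4; lia.
- by constructor 1; rewrite /xor1 (negPf oi) /= oi.
Qed.

(** Three involutions handle all pairs of consecutive cells with a common bound [n]. The elements
    killing [psi v] are closed under brackets, so [gy_chain] reaches pairs of cells at any distance
    with the same bound. *)
Lemma gy_kills v : exists n, forall z k l, (n <= cell t k)%N -> (n <= cell t l)%N ->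
  cell t k != cell t l -> kills (psi v) (y z k l).
Proof.
have [n0 P0] := family_gy_kills v (fp_free_xor1 C).
have [n1 P1] := family_gy_kills v fp_free_flip4.
have [n2 P2] := family_gy_kills v (fp_free_shift fp_free_flip4).
pose n := maxn n0 (maxn n1 n2); exists n.
have near k l : (n <= cell t k)%N -> cell t l = (cell t k).+1 ->
    forall z, kills (psi v) (y z k l) /\ kills (psi v) (y z l k).
  rewrite !geq_max => /and3P[a0 a1 a2] kl z.
  have [b0 b1 b2] : [/\ (n0 <= cell t l)%N, (n1 <= cell t l)%N & (n2 <= cell t l)%N].
    by rewrite kl !leqW.
  by case: (consecutive (cell t k)) => -[]; rewrite -kl => E E';
    split; [exact: P0|exact: P0|exact: P1|exact: P1|exact: P2|exact: P2].
suff main d z k l : (n <= cell t k)%N -> cell t l = (cell t k + d.+1)%N ->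
    kills (psi v) (y z k l) /\ kills (psi v) (y z l k).
  move=> z k l nk nl kl; case: (ltngtP (cell t k) (cell t l)) => [lt|lt|]; last first.
  - by move=> E; rewrite E eqxx in kl.
  - have [] := main (cell t k - (cell t l).+1)%N z l k nl; first by lia.
    by [].
  - by have [] := main (cell t l - (cell t k).+1)%N z k l nk; first by lia.
elim: d z k l => [|d IH] z k l nk lk; first by apply: near => //; rewrite lk addn1.
pose b := rep (cell t k).+1; have cb : cell t b = (cell t k).+1 by exact: cell_rep.
have [kb bk] := near k b nk cb z.
have [||bl lb] := IH z b l; [by rewrite cb; lia|by rewrite cb; lia|].
split.
  by rewrite -(@gy_chain z k b l) ?cb; [exact: kills_bracket|lia..].
by rewrite -(@gy_chain z l b k) ?cb; [exact: kills_bracket|lia..].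
Qed.

End AsymptoticInvariance.

(** * Contractions of functions of multi-indices *)

Section Contractions.
Variables (C : numClosedFieldType) (t : series) (p q : nat).
Notation slot := ('I_p + 'I_q)%type.
Notation multi_index := {ffun slot -> nat}.
Hypothesis q0 : t <> SL -> q = 0%N.
Implicit Types (x : ginf C t) (n z k l i j c : nat) (h : multi_index -> C).
Implicit Types (I J P : multi_index) (a b r s : slot).
Local Notation act x h := (@tens_act C p q (gc x) h).
Local Notation y z := (gy C t z).
Local Notation rep := (rep t).

Definition invariant_on (A : pred nat) h := forall z k l, A (cell t k) -> A (cell t l) ->
  cell t k != cell t l -> kills h (y z k l).

Definition invariant_from n := invariant_on (leq n).

Definition opposite a b := match a, b with inl _, inr _ | inr _, inl _ => true | _, _ => false end.

Definition pairable a b := (a != b) && (if t is SL then opposite a b else true).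

(** The invariant pairing of two slots: evaluation for a vector and a covector, the form for two
    vectors. *)
Definition beta a b i j : C :=
  if t is SL then (opposite a b && (i == j))%:R else form C t i j.

(** For pairable slots the inserted indices have pairing [1], by [beta_rep]. *)
Definition pairup I a b c : multi_index := upd (upd I a (rep c)) b (dl t (rep c)).

Lemma beta_rep a b c : pairable a b -> beta a b (rep c) (dl t (rep c)) = 1.
Proof.
rewrite /pairable /beta => /andP[_].
have := sg_rep C t c; rewrite /sg; case: (t) => //= _ ->.
by rewrite eqxx.
Qed.

Lemma beta_dl_neq0 a b c : pairable a b -> beta b a (dl t (rep c)) (rep c) != 0.
Proof.
rewrite /pairable /beta => /andP[_ ab].
have [tSL|tSL] := pselect (t = SL).
  move: ab; rewrite tSL => ab; rewrite eqxx andbT.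
  by move: ab; case: a; case: b => //= *; rewrite oner_eq0.
rewrite if_SL // -{2}[rep c](dlK t) formD; exact: sg_neq0.
Qed.

Lemma beta_cell a b i j : cell t i != cell t j -> beta a b i j = 0.
Proof.
by move=> /(cell_neq C)[ij fij]; rewrite /beta fij ij andbF; case: (t).
Qed.

Lemma beta_unpairable a b i j : a != b -> ~~ pairable a b -> beta a b i j = 0.
Proof. by rewrite /pairable /beta => -> /=; case: (t) => //= /negPf ->. Qed.

Lemma no_inr (s : 'I_q) : t = SL.
Proof.
by apply: contrapT => /q0 q0'; case: s => m; rewrite q0' ltn0.
Qed.

Let slot_mxl (X : nat -> nat -> C) (a0 : 'I_p) i j : slot_mx X (inl a0 : slot) i j = X i j.
Proof. by []. Qed.

Let slot_mxr (X : nat -> nat -> C) (a0 : 'I_q) i j : slot_mx X (inr a0 : slot) i j = - X j i.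
Proof. by []. Qed.

Lemma slot_act_delta X s h J (e : C) j : (forall l, slot_mx X s (J s) l = e * (l == j)%:R) ->
  slot_act X s h J = e * h (upd J s j).
Proof.
move=> XE; rewrite /slot_act /vact (@fsum_single C _ j) => [|l lj].
  by rewrite XE eqxx mulr1.
by rewrite XE (negPf lj) mulr0 mul0r.
Qed.

(* An index in a cell of [A] can only survive by being contracted with another one. *)
Lemma contraction_expansion A h a I c : invariant_on A h -> A (cell t (I a)) -> A c -> (forall r, cell t (I r) != c) ->
  h I = \sum_(r | r != a) beta a r (I a) (I r) * h (pairup I a r c).
Proof.
move=> hn na nc fresh; set k := I a; set k' := rep c; set J := upd I a k'.
have ck' : cell t k' = c by exact: cell_rep.
have sk' : sg C t k' = 1 by exact: sg_rep.
have kk' : cell t k != cell t k' by rewrite ck'; exact: fresh.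
have k'k : cell t k' != cell t k by rewrite eq_sym.
have [kkF fkk'] := cell_neq C kk'; have [kkF' fk'k] := cell_neq C k'k.
have Jr r : r != a -> (J r == k') = false /\ J r = I r.
  move=> ra; rewrite /J upd_other //; split=> //; apply: contra_neqF (fresh r) => /eqP ->.
  exact: ck'.
(* The action of an element joining [k] and the fresh index [k'] is evaluated at [J]: the slot [a]
   gives back [h I], and another slot contributes only if its index pairs with [k]. *)
have key x (e : C) : kills h x -> e != 0 ->
    (forall l, slot_mx (gc x) a k' l = e * (l == k)%:R) ->
    (forall r, r != a -> forall l,
       slot_mx (gc x) r (I r) l = - e * beta a r k (I r) * (l == dl t k')%:R) ->
    h I = \sum_(r | r != a) beta a r k (I r) * h (pairup I a r c).
  move=> hx e0 xa xr; have := hx J; rewrite /tens_act (bigD1 a) //=.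
  rewrite (@slot_act_delta _ _ _ _ e k) => [|l]; last by rewrite /J upd_same xa.
  have -> : upd J a k = I by rewrite /J upd_upd upd_id.
  rewrite (eq_bigr (fun r => - e * (beta a r k (I r) * h (pairup I a r c)))) => [|r ra].
    rewrite -mulr_sumr mulNr => /eqP; rewrite subr_eq0 => /eqP.
    exact: (mulfI e0).
  rewrite mulrA (@slot_act_delta _ _ _ _ (- e * beta a r k (I r)) (dl t k')) // => l.
  by have [_ ->] := Jr r ra; exact: xr.
have formk' l : form C t k' l = (l == dl t k')%:R by rewrite formE sk' mulr1.
case aE: a => [a0|a0]; rewrite -aE.
  apply: (key (y 0%N k' k) 1); [by apply: hn => //; rewrite ck'|exact: oner_neq0|move=> l|move=> r ra l].
    rewrite aE slot_mxl gc_gy eqxx kkF' fkk' mul0r /= if_same_SL subr0 mul1r.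
    by [].
  have [JF JE] := Jr r ra; rewrite JE in JF.
  case rE: r => [r0|r0]; rewrite -rE.
    rewrite [X in slot_mx _ X]rE slot_mxl gc_gy JF kkF' formk' /= sub0r mulN1r /beta.
    have [tSL|tSL] := pselect (t = SL); last by rewrite !(if_SL _ _ tSL) mulNr.
    by rewrite tSL aE rE /= mulr0n oppr0 mul0r.
  have tSL := no_inr r0.
  rewrite [X in slot_mx _ X]rE slot_mxr gc_gy kkF' /= {1}tSL subr0 mulN1r /beta {1}tSL aE rE -rE /=.
  rewrite [I r == k]eq_sym -mulnb natrM mulNr mulrC; congr (- (_ * _%:R)).
    by rewrite rE.
  by rewrite tSL.
have tSL := no_inr a0.
apply: (key (y 0%N k k') (-1)); [by apply: hn => //; rewrite ck'|by rewrite oppr_eq0 oner_neq0|move=> l|move=> r ra l].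
  rewrite aE slot_mxr gc_gy kkF eqxx andbT /= {1}tSL subr0 mulN1r.
  by [].
have [JF JE] := Jr r ra; rewrite JE in JF.
have dlE : dl t k' = k' by rewrite tSL.
case rE: r => [r0|r0]; rewrite -rE.
  have op : opposite a r by rewrite aE rE.
  rewrite [X in slot_mx _ X]rE slot_mxl gc_gy kkF /= {1}tSL subr0 opprK mul1r /beta {1}tSL op dlE.
  by rewrite [I r == k]eq_sym -mulnb natrM.
rewrite [X in slot_mx _ X]rE slot_mxr gc_gy kkF JF andbF /= {1}tSL subr0 oppr0 /beta {1}tSL aE rE /=.
by rewrite mulr0n mulr0 mul0r.
Qed.

(* The eventual value of [g], and [0] if [g] is not eventually constant. *)
Definition eventual (g : nat -> C) : C :=
  xget 0 [set v | exists n, forall c, (n <= c)%N -> g c = v].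

Lemma eventualE g v n : (forall c, (n <= c)%N -> g c = v) -> eventual g = v.
Proof.
move=> gv; rewrite /eventual; case: xgetP => [w _ /= [m gw]|/(_ v) []]; last by exists n.
by rewrite -(gv (maxn n m)) ?leq_maxl // gw ?leq_maxr.
Qed.

Lemma pairup_a I a b c : a != b -> pairup I a b c a = rep c.
Proof. by move=> ab; rewrite /pairup upd_other // upd_same. Qed.

Lemma pairup_b I a b c : pairup I a b c b = dl t (rep c).
Proof. by rewrite /pairup upd_same. Qed.

Lemma pairup_r I a b c r : r != a -> r != b -> pairup I a b c r = I r.
Proof. by move=> ra rb; rewrite /pairup !upd_other. Qed.

Lemma pairup_eq I J a b c : (forall r, r != a -> r != b -> I r = J r) ->
  pairup I a b c = pairup J a b c.
Proof.
move=> IJ; apply/ffunP => r; rewrite !ffunE; case: eqVneq => // rb.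
by case: eqVneq => // ra; exact: IJ.
Qed.

(** In the expansion at the slot [d] only [e] has an index in the same cell, so a single term
    survives and the fresh cell can be changed. For [(d, e) = (b, a)] the inserted pair is also
    reversed, which costs a sign for [SP]. *)
Lemma pairup_move n h a b I c d e : invariant_from n h -> pairable a b ->
  (d, e) = (a, b) \/ (d, e) = (b, a) -> (n <= c)%N ->
  (forall r, r != a -> r != b -> cell t (I r) != c) ->
  forall c', (n <= c')%N -> c' != c -> (forall r, r != a -> r != b -> cell t (I r) != c') ->
  h (pairup I a b c) = beta d e (pairup I a b c d) (pairup I a b c e) * h (pairup I d e c').
Proof.
move=> hn pab de nc fresh c' nc' cc' fresh'; have /andP[ab _] := pab.
have ba : b != a by rewrite eq_sym.
set P := pairup I a b c.
have cP r : cell t (P r) = if (r == a) || (r == b) then c else cell t (I r).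
  rewrite /P; case: eqVneq => [->|ra] /=; first by rewrite pairup_a // cell_rep.
  case: eqVneq => [->|rb] /=; first by rewrite pairup_b cell_dl cell_rep.
  by rewrite pairup_r.
have inE' : [/\ d != e, (d == a) || (d == b) & (forall r, r != d -> r != e -> r != a /\ r != b)].
  by case: de => -[-> ->]; split; rewrite ?eqxx ?orbT.
have [dn dab rn] := inE'.
rewrite [LHS](@contraction_expansion (leq n) h d P c') //; first last.
- move=> r; rewrite cP; case: ifP => [_|/negbT]; first by rewrite eq_sym.
  by rewrite negb_or => /andP[ra rb]; exact: fresh'.
- by rewrite cP dab.
rewrite (bigD1 e) 1?eq_sym //= big1 ?addr0 => [|r /andP[rd re]].
  congr (_ * h _); apply: pairup_eq => r rd re; have [ra rb] := rn r rd re.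
  by rewrite /P pairup_r.
have [ra rb] := rn r rd re.
by rewrite beta_cell ?mul0r // !cP dab (negPf ra) (negPf rb) eq_sym; exact: fresh.
Qed.

Lemma ex_fresh n I : exists c, (n <= c)%N /\ forall c' s, (c <= c')%N -> cell t (I s) != c'.
Proof.
exists (maxn n (\max_s (cell t (I s)).+1)); split=> [|c' s]; first exact: leq_maxl.
rewrite geq_max => /andP[_ cc]; have : (cell t (I s) < c')%N.
  by apply: leq_trans cc; exact: (leq_bigmax s).
by move=> lt; rewrite neq_ltn lt.
Qed.

Lemma eventual_pair n h a b I c : invariant_from n h -> pairable a b -> (n <= c)%N ->
  (forall r, r != a -> r != b -> cell t (I r) != c) ->
  eventual (fun c' => h (pairup I a b c')) = h (pairup I a b c).
Proof.
move=> hn pab nc fresh; have [c0 [nc0 c0P]] := ex_fresh n I.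
have /andP[ab _] := pab.
apply: (@eventualE _ _ (maxn c0 c.+1)) => c'; rewrite geq_max => /andP[c0c' cc'].
rewrite [RHS](@pairup_move n h a b I c a b hn pab _ nc fresh c') //; [|by left|lia|lia|].
  by rewrite pairup_a // pairup_b beta_rep // mul1r.
by move=> r _ _; exact: c0P.
Qed.

(** A sum over all inserted pairs makes no sense for infinite support; the value at one far pair
    replaces it. The result vanishes on finitely supported [h] and returns a product of [beta] with
    a function of the other slots. *)
Definition contraction a b h : multi_index -> C := fun I =>
  beta a b (I a) (I b) * eventual (fun c => h (pairup I a b c)).

End Contractions.

Section Retraction.
Variables (C : numClosedFieldType) (t : series) (p q : nat).
Notation slot := ('I_p + 'I_q)%type.
Notation multi_index := {ffun slot -> nat}.
Hypothesis q0 : t <> SL -> q = 0%N.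
Implicit Types (x : ginf C t) (n z k l i j c : nat) (h : multi_index -> C).
Implicit Types (I J P : multi_index) (a b r s : slot).
Local Notation act x h := (@tens_act C p q (gc x) h).
Local Notation y z := (gy C t z).
Local Notation rep := (rep t).
Local Notation beta := (@beta C t p q).
Local Notation pairup := (@pairup t p q).
Local Notation pairable := (@pairable t p q).
Local Notation contraction := (@contraction C t p q).
Local Notation invariant_from := (@invariant_from C t p q).

Lemma slot_mxl (X : nat -> nat -> C) (a0 : 'I_p) i j : slot_mx X (inl a0 : slot) i j = X i j.
Proof. by []. Qed.

Lemma beta_invariant x n a b i j : pairable a b -> bounded n (gc x) ->
  \sum_(l < n) slot_mx (gc x) a i l * beta a b l j +
  \sum_(l < n) slot_mx (gc x) b j l * beta a b i l = 0.
Proof.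
move=> pab bx; have ba := slot_mx_bounded a bx; have bb := slot_mx_bounded b bx.
have [tSL|tSL] := pselect (t = SL).
  have op : opposite a b by move: pab; rewrite /pairable tSL => /andP[].
  have bE u v : beta a b u v = (u == v)%:R by rewrite /beta tSL op.
  under eq_bigr do rewrite bE.
  under [X in _ + X]eq_bigr do rewrite bE.
  rewrite (@ord_single _ _ (fun l => slot_mx (gc x) a i l * (l == j)%:R) j); first last.
  - by move=> nj; rewrite ba ?nj ?orbT // mul0r.
  - by move=> l _ /negPf ->; rewrite mulr0.
  rewrite (@ord_single _ _ (fun l => slot_mx (gc x) b j l * (i == l)%:R) i); first last.
  - by move=> ni; rewrite bb ?ni ?orbT // mul0r.
  - by move=> l _; rewrite eq_sym => /negPf ->; rewrite mulr0.
  rewrite !eqxx !mulr1; case: a b op {pab ba bb bE} => [a|a] [b|b] //= _; rewrite /dualinf.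
    exact: subrr.
  exact: addNr.
case: a {pab} ba => [a|a] ba; last by have := no_inr q0 a.
case: b bb => [b|b] bb; last by have := no_inr q0 b.
have bE u v : beta (inl a) (inl b) u v = form C t u v by exact: if_SL.
under eq_bigr do rewrite bE.
under [X in _ + X]eq_bigr do rewrite bE.
rewrite (@ord_single _ _ (fun l => slot_mx (gc x) (inl a : slot) i l * form C t l j) (dl t j)); first last.
- by move=> nj; rewrite ba ?nj ?orbT // mul0r.
- by move=> l _ lj; rewrite form_neq ?mulr0 // eq_dl.
rewrite (@ord_single _ _ (fun l => slot_mx (gc x) (inl b : slot) j l * form C t i l) (dl t i)); first last.
- by move=> ni; rewrite bb ?ni ?orbT // mul0r.
- by move=> l _ lj; rewrite form_neq ?mulr0.
have xij : gc x j (dl t i) * sg C t j + sg C t (dl t i) * gc x i (dl t j) = 0.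
  by have := ginf_form x (dl t i) (dl t j) tSL; rewrite !dlK.
have := sg_dl C t j; rewrite {1}/sg dlK => fj; rewrite formD fj !slot_mxl.
move: xij; rewrite sg_dl; set si := sg C t i; set sj := sg C t j; set e := form_sign C t => xij.
have si2 : si * si = 1 by exact: sg_sqr.
have sj2 : sj * sj = 1 by exact: sg_sqr.
set U := gc x i _ in xij *; set W := gc x j _ in xij *.
transitivity (U * (e * sj) * (si * si) + W * si * (sj * sj)); first by rewrite si2 sj2 !mulr1.
transitivity (si * sj * (W * sj + e * si * U)); first by ring.
by rewrite xij mulr0.
Qed.

(** For [c] beyond [I] and beyond the support of [x], the inserted pair is killed by [x]; on the
    other side the terms at [a] and [b] cancel by [beta_invariant], and the remaining slots agree
    term by term. *)
Lemma contraction_act x n n' a b h I : pairable a b ->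
  invariant_from n h -> invariant_from n' (act x h) ->
  act x (contraction a b h) I = contraction a b (act x h) I.
Proof.
move=> pab hn hn'; have /andP[ab _] := pab.
have [B bx] := ginf_boundedE x.
have [c1 [nc1 c1P]] := ex_fresh t (maxn n (maxn n' B)) I.
pose c := c1.
have [nc n'c Bc] : [/\ n <= c, n' <= c & B <= c]%N.
  by have := nc1; rewrite !geq_max => /and3P.
have repc : (c <= rep c)%N by rewrite /rep; case: (t) => //=; lia.
have dlc : (c <= dl t (rep c))%N by rewrite /rep /dl; case: (t) => //=; case: ifP; lia.
have cl l : (l < B)%N -> cell t l != c.
  have : (cell t l <= l)%N by rewrite /cell; case: (t) => //=; lia.
  lia.
have fr J s l : (forall r, cell t (J r) != c) -> (l < B)%N ->
    forall r, r != a -> r != b -> cell t (upd J s l r) != c.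
  by move=> Jc lB r _ _; rewrite ffunE; case: (eqVneq r s) => _; [exact: cl|exact: Jc].
have Ic r : cell t (I r) != c by exact: c1P.
rewrite /contraction (@eventual_pair _ _ _ _ q0 n' _ a b I c) //.
set P := pairup I a b c.
have PE s l : s != a -> s != b -> upd P s l = pairup (upd I s l) a b c.
  move=> sa sb; apply/ffunP => r; rewrite /P !ffunE; case: eqVneq => [->|//].
  by rewrite (negPf sa) (negPf sb).
have LE s l : (l < B)%N -> contraction a b h (upd I s l) =
    beta a b (upd I s l a) (upd I s l b) * h (pairup (upd I s l) a b c).
  move=> lB; rewrite /contraction (@eventual_pair _ _ _ _ q0 n _ a b _ c) //.
  exact: fr.
have sumE s : slot_act (gc x) s (contraction a b h) I = \sum_(l < B)
    slot_mx (gc x) s (I s) l * (beta a b (upd I s l a) (upd I s l b) * h (pairup (upd I s l) a b c)).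
  rewrite (slot_actE _ _ _ bx); apply: eq_bigr => l _; congr (_ * _); exact: LE.
have ba : b != a by rewrite eq_sym.
rewrite /tens_act (bigD1 a) //= (bigD1 b) //= addrA [in RHS](bigD1 a) //= [in RHS](bigD1 b) //=.
have -> : slot_act (gc x) a h P = 0.
  rewrite (slot_actE _ _ _ bx) big1 // => l _; rewrite /P pairup_a //.
  by rewrite (slot_mx_bounded a bx) ?mul0r // (leq_trans Bc repc).
have -> : slot_act (gc x) b h P = 0.
  rewrite (slot_actE _ _ _ bx) big1 // => l _; rewrite /P pairup_b //.
  by rewrite (slot_mx_bounded b bx) ?mul0r // (leq_trans Bc dlc).
have -> : slot_act (gc x) a (contraction a b h) I + slot_act (gc x) b (contraction a b h) I = 0.
  transitivity ((\sum_(l < B) slot_mx (gc x) a (I a) l * beta a b l (I b) +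
      \sum_(l < B) slot_mx (gc x) b (I b) l * beta a b (I a) l) * h P); last first.
    by rewrite beta_invariant // mul0r.
  rewrite !sumE mulrDl !mulr_suml.
  congr (_ + _); apply: eq_bigr => l _; rewrite upd_same upd_other // mulrA; congr (_ * h _).
    by apply: pairup_eq => r ra rb; rewrite upd_other.
  by apply: pairup_eq => r ra rb; rewrite upd_other.
rewrite !add0r mulr_sumr; apply: eq_bigr => s /andP[sa sb].
rewrite sumE (slot_actE _ _ _ bx) mulr_sumr; apply: eq_bigr => l _.
by rewrite PE // /P pairup_r // !upd_other 1?eq_sym // mulrCA.
Qed.

End Retraction.

(** * Removal of the contractions *)

Section Extension.
Variables (C : numClosedFieldType) (t : series) (p q : nat).
Notation slot := ('I_p + 'I_q)%type.
Notation multi_index := {ffun slot -> nat}.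
Hypothesis q0 : t <> SL -> q = 0%N.
Variables (M N : lieModType (ginf C t)) (f : lie_hom M N).
Variable u : lie_hom M (tensor C p q : lieModType (ginf C t)).
Hypothesis absN : absolute_weight N.
Hypothesis inj_f : injective f.
Implicit Types (x : ginf C t) (n c : nat) (h : multi_index -> C).
Implicit Types (I J P : multi_index) (a b d e r s : slot) (psi : N -> multi_index -> C).
Local Notation act x h := (@tens_act C p q (gc x) h).
Local Notation rep := (rep t).
Local Notation beta := (@beta C t p q).
Local Notation pairup := (@pairup t p q).
Local Notation pairable := (@pairable t p q).
Local Notation contraction := (@contraction C t p q).
Local Notation invariant_from := (@invariant_from C t p q).

Definition coordinate_map psi :=
  [/\ forall (k : C) v v' I, psi (k *: v + v') I = k * psi v I + psi v' I,
      forall x v I, psi (lact x v) I = act x (psi v) I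
    & forall m I, psi (f m) I = tval (u m) I].

Definition uncontracted a b psi :=
  forall v I, eventual (fun c => psi v (pairup I a b c)) = 0.

Lemma coordinate_map_invariant psi v : coordinate_map psi -> exists n, invariant_from n (psi v).
Proof. by case=> lin_psi psi_act _; have [n nP] := gy_kills absN lin_psi psi_act v; exists n. Qed.

Lemma contraction_fin_supp a b h I : a != b ->
  (exists r : seq multi_index, forall J, J \notin r -> h J = 0) -> contraction a b h I = 0.
Proof.
move=> ab [r rh]; rewrite /contraction (@eventualE _ _ 0 (\max_(J <- r) (cell t (J a)).+1)) ?mulr0 //.
move=> c rc; apply: rh; apply/negP => Jr.
have : ((cell t (pairup I a b c a)).+1 <= \max_(J <- r) (cell t (J a)).+1)%N.
  by rewrite (big_rem _ Jr) /= leq_maxl.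
by rewrite pairup_a // cell_rep; lia.
Qed.

Lemma uncontracted_fresh psi n a b v I c : uncontracted a b psi -> invariant_from n (psi v) ->
  pairable a b -> (n <= c)%N -> (forall r, r != a -> r != b -> cell t (I r) != c) ->
  psi v (pairup I a b c) = 0.
Proof.
by move=> un nv pab nc fresh; rewrite -(eventual_pair q0 nv pab nc fresh); exact: un.
Qed.

Section Step.
Variables (psi : N -> multi_index -> C) (a b : slot).
Hypothesis cpsi : coordinate_map psi.
Hypothesis pab : pairable a b.

Let psi' v : multi_index -> C := fun I => psi v I - contraction a b (psi v) I.

Let ab : a != b. Proof. by case/andP: pab. Qed.

Let contractionE v n I c : invariant_from n (psi v) -> (n <= c)%N ->
  (forall r, r != a -> r != b -> cell t (I r) != c) ->
  contraction a b (psi v) I = beta a b (I a) (I b) * psi v (pairup I a b c).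
Proof. by move=> nv nc fresh; rewrite /contraction (eventual_pair q0 nv pab nc fresh). Qed.

Let psi'_map : coordinate_map psi'.
Proof.
have [lin_psi psi_act psi_u] := cpsi; split.
- move=> e v v' I; rewrite /psi'.
  have [n nv] := coordinate_map_invariant v cpsi.
  have [n' nv'] := coordinate_map_invariant v' cpsi.
  have [m mv] := coordinate_map_invariant (e *: v + v') cpsi.
  have [c [nc cP]] := ex_fresh t (maxn n (maxn n' m)) I.
  move: nc; rewrite !geq_max => /and3P[nc n'c mc].
  have fr r : r != a -> r != b -> cell t (I r) != c by move=> _ _; exact: cP.
  rewrite (contractionE mv mc fr) (contractionE nv nc fr) (contractionE nv' n'c fr).
  rewrite !lin_psi; ring.
- move=> x v I; rewrite /psi'.
  have [n nv] := coordinate_map_invariant v cpsi.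
  have [n' nv'] := coordinate_map_invariant (lact x v) cpsi.
  have E : psi (lact x v) = act x (psi v) by apply/funext => J; exact: psi_act.
  rewrite E in nv' *; rewrite -(contraction_act q0 I pab nv nv').
  have [B bx] := ginf_boundedE x.
  have := tens_act_lin (-1) (contraction a b (psi v)) (psi v) I bx.
  rewrite mulN1r addrC => <-; congr (tens_act _ _ _); apply/funext => J.
  by rewrite mulN1r addrC.
- move=> m I; rewrite /psi' psi_u contraction_fin_supp ?subr0 //.
  have [r [_ rP]] := tensor_support (u m); exists r => J Jr.
  by rewrite psi_u; exact: rP.
Qed.

Let psi'_ab : uncontracted a b psi'.
Proof.
move=> v I; have [n nv] := coordinate_map_invariant v cpsi.
have [c0 [nc0 c0P]] := ex_fresh t n I; apply: (@eventualE _ _ _ c0) => c cc0.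
have nc : (n <= c)%N by exact: leq_trans cc0.
have fr r : r != a -> r != b -> cell t (I r) != c by move=> _ _; exact: c0P.
rewrite /psi' (@contractionE v n (pairup I a b c) c nv nc) => [|r ra rb]; last first.
  by rewrite pairup_r //; exact: fr.
rewrite pairup_a // pairup_b beta_rep // mul1r.
rewrite (@pairup_eq _ _ _ (pairup I a b c) I) ?subrr // => r ra rb.
by rewrite pairup_r.
Qed.

(** Three cases. If the pairs agree up to order, the subtracted term is again a value at a fresh
    pair in [d], [e], hence zero. If they share one slot, [beta] pairs a fresh index with an old one
    and vanishes. If they are disjoint, the two insertions commute. *)
Let psi'_de d e : pairable d e -> uncontracted d e psi -> uncontracted d e psi'.
Proof.
move=> pde un v I; have [n nv] := coordinate_map_invariant v cpsi.
have /andP[de _] := pde.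
have [c0 [nc0 c0P]] := ex_fresh t n I; apply: (@eventualE _ _ _ c0) => c cc0.
have nc : (n <= c)%N by exact: leq_trans cc0.
have fr r : r != d -> r != e -> cell t (I r) != c by move=> _ _; exact: c0P.
have psi0 := uncontracted_fresh un nv pde nc fr.
rewrite /psi' psi0 sub0r; set P := pairup I d e c.
have cP r : cell t (P r) = if (r == d) || (r == e) then c else cell t (I r).
  rewrite /P; case: eqVneq => [->|rd] /=; first by rewrite pairup_a // cell_rep.
  case: eqVneq => [->|re] /=; first by rewrite pairup_b cell_dl cell_rep.
  by rewrite pairup_r.
have [c' [cc' c'P]] := ex_fresh t (maxn n c.+1) P.
move: cc'; rewrite geq_max => /andP[nc' cc'].
have fr' r : cell t (P r) != c' by exact: c'P.
rewrite (@contractionE v n P c' nv nc') => [|r _ _]; last exact: fr'.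
have [aD|aD] := boolP ((a == d) || (a == e)); have [bD|bD] := boolP ((b == d) || (b == e)).
- suff -> : psi v (pairup P a b c') = 0 by rewrite mulr0 oppr0.
  have [[-> ->]|[-> ->]] : (a, b) = (d, e) \/ (a, b) = (e, d).
    by move: ab; case/orP: aD => /eqP ->; case/orP: bD => /eqP ->; rewrite ?eqxx //; [left|right].
  - by apply: (uncontracted_fresh un nv pde nc') => r _ _; exact: fr'.
  - have cc : c' != c by lia.
  have frI r : r != d -> r != e -> cell t (I r) != c'.
    by move=> rd re; have := fr' r; rewrite /P pairup_r.
  have := pairup_move q0 nv pde (or_intror erefl) nc fr nc' cc frI.
  rewrite psi0 pairup_b pairup_a // => /esym/eqP; rewrite mulf_eq0.
  rewrite (negPf (beta_dl_neq0 _ _ pde)) /= => /eqP <-; congr (psi v _).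
  by apply: pairup_eq => r re rd; rewrite /P pairup_r.
- by rewrite beta_cell ?mul0r ?oppr0 // !cP aD (negPf bD) eq_sym; exact: c0P.
- by rewrite beta_cell ?mul0r ?oppr0 // !cP bD (negPf aD); exact: c0P.
have -> : pairup P a b c' = pairup (pairup I a b c') d e c.
  apply/ffunP => r; rewrite !ffunE.
  move: aD bD; rewrite !negb_or => /andP[ad ae] /andP[bd be].
  case: (eqVneq r b) => [->|rb]; first by rewrite (negPf bd) (negPf be).
  case: (eqVneq r a) => [->|ra]; first by rewrite (negPf ad) (negPf ae).
  by [].
rewrite (uncontracted_fresh un nv pde nc) ?mulr0 ?oppr0 // => r rd re.
rewrite !ffunE; case: (eqVneq r b) => _; first by rewrite cell_dl cell_rep gtn_eqF.
by case: (eqVneq r a) => _; [rewrite cell_rep gtn_eqF|exact: c0P].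
Qed.

Lemma contraction_step ps : (forall de, de \in ps -> pairable de.1 de.2) ->
  (forall de, de \in ps -> uncontracted de.1 de.2 psi) ->
  exists psi', coordinate_map psi' /\
    forall de, de \in (a, b) :: ps -> uncontracted de.1 de.2 psi'.
Proof.
move=> pps ups; exists psi'; split=> // de; rewrite inE => /orP[/eqP -> //|dps].
by apply: psi'_de; [exact: pps|exact: ups].
Qed.

End Step.

Lemma uncontracted_map : exists psi, coordinate_map psi /\
  forall a b, pairable a b -> uncontracted a b psi.
Proof.
suff [psi [cpsi un]] : exists psi, coordinate_map psi /\
    forall de, de \in [seq de <- enum {: slot * slot} | pairable de.1 de.2] ->
      uncontracted de.1 de.2 psi.
  exists psi; split=> // a b pab; apply: (un (a, b)).
  by rewrite mem_filter mem_enum pab.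
elim: (enum _) => [|[a b] ps [psi [cpsi un]]] /=.
  by have [psi cpsi] := extend_coordinates u absN inj_f; exists psi.
case: ifP => [pab|_]; last by exists psi.
by apply: (contraction_step cpsi pab) => // de; rewrite mem_filter => /andP[].
Qed.

Lemma extend_to_tensor : exists v : lie_hom N (tensor C p q : lieModType (ginf C t)),
  forall m, v (f m) = u m.
Proof.
have [psi [cpsi un]] := uncontracted_map; have [lin_psi psi_act psi_u] := cpsi.
have supp v : (psi v : multi_index -> C^o) \in @fin_supp C p q.
  have [n nv] := coordinate_map_invariant v cpsi.
  apply: (@fin_supp_boxed _ _ _ _ (cell_bound t n)) => I s; rewrite leqNgt lt_cell_bound -leqNgt => ns.
  have [c [nc cP]] := ex_fresh t n I.
  have fr r : cell t (I r) != c by exact: cP.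
  rewrite (contraction_expansion q0 nv ns nc fr) big1 // => r rs.
  have [pr|pr] := boolP (pairable s r); last by rewrite beta_unpairable ?mul0r // eq_sym.
  by rewrite (uncontracted_fresh (un s r pr) nv pr nc) ?mulr0 // => r' _ _; exact: fr.
pose g v : tensor C p q := Tensor (supp v).
have lin_g : linear g by move=> a v v'; apply: tensor_ext => I; exact: lin_psi.
pose G : {linear N -> tensor C p q} := HB.pack g (GRing.isLinear.Build _ _ _ _ g lin_g).
have GP x v : G (lact x v) = lact x (G v) by apply: tensor_ext => I; exact: psi_act.
by exists (LieHom GP) => m; apply: tensor_ext => I; exact: psi_u.
Qed.

End Extension.

(** * Finite length of the tensor modules *)

Section FreshCells.
Variables (C : numClosedFieldType) (t : series) (p q : nat).
Notation slot := ('I_p + 'I_q)%type.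
Notation multi_index := {ffun slot -> nat}.
Notation T := (tensor C p q : lieModType (ginf C t)).
Implicit Types (x : ginf C t) (n k l i j c d : nat) (I J : multi_index) (s : slot).
Variable m0 : nat.
Local Notation z := (cell_bound t m0).
Local Notation y := (gy C t z).
Local Notation rep := (rep t).
Local Notation r := (p + q)%N.

(** Off the diagonal [gy] does not depend on the spare index, so the bracket is computed with a
    larger one; for [l = a] the corrections of the two diagonal terms cancel. *)
Lemma gy_chain_full z' a b l : cell t a != cell t b -> cell t l != cell t b ->
  bracket (gy C t z' a b) (gy C t z' b l) = gy C t z' a l - (l == a)%:R *: gy C t z' b b.
Proof.
move=> ab lb; have bl : cell t b != cell t l by rewrite eq_sym.
pose n := (cell t a + cell t b + cell t l).+1; pose z'' := cell_bound t n.
rewrite (@gy_cells C t z' z'' a b) // (@gy_cells C t z' z'' b l) // (@bracket_gy_chain C t n z'') ?lt_cell_bound //; try lia.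
apply: ginf_ext => i j; rewrite !gcB !gcZ !gc_gy.
have [->|la] := eqVneq l a; last by rewrite !mul0r.
by rewrite !mul1r !eqxx; case: (t) => /=; ring.
Qed.

Let cell_z : cell t z = m0.
Proof. by case: (t) => //=; exact: doubleK. Qed.

Lemma gy_entry_cells k l i j : gc (y k l) i j != 0 ->
  [\/ cell t i = cell t k /\ cell t j = cell t l, cell t i = cell t l /\ cell t j = cell t k
    | [/\ k = l, cell t i = m0 & cell t j = m0]].
Proof.
rewrite gc_gy; case kij: ((i == k) && (j == l)).
  by case/andP: kij => /eqP -> /eqP ->; constructor 1.
rewrite /= sub0r oppr_eq0; have [tSL|tSL] := pselect (t = SL).
  rewrite {1}tSL pnatr_eq0 eqb0 negbK => /and3P[/eqP -> /eqP -> /eqP ->].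
  by constructor 3.
rewrite if_SL // !formE => H.
have iE : i = dl t l by apply/eqP; apply: contraNT H => /negPf ->; rewrite !mul0r.
have jE : j = dl t k by apply/eqP; apply: contraNT H => /negPf ->; rewrite mul0r mulr0.
by rewrite iE jE !cell_dl; constructor 2.
Qed.

Lemma lact_gy_support k l (v : T) I : tval (lact (y k l) v) I != 0 ->
  exists s i, tval v (upd I s i) != 0 /\
    [\/ cell t (I s) = cell t k /\ cell t i = cell t l,
        cell t (I s) = cell t l /\ cell t i = cell t k
      | [/\ k = l, cell t (I s) = m0 & cell t i = m0]].
Proof.
move=> vI; apply: contrapT => nex; move/eqP: vI; apply.
have [n bx] := ginf_boundedE (y k l).
change (@tens_act C p q (gc (y k l)) (tval v) I = 0).
rewrite /tens_act big1 // => s _; rewrite (slot_actE _ _ _ bx) big1 // => i _.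
have [->|vn] := eqVneq (tval v (upd I s i) : C) 0; first by rewrite mulr0.
have [->|xn] := eqVneq (slot_mx (gc (y k l)) s (I s) i) 0; first by rewrite mul0r.
case: nex; exists s, (i : nat); split=> //.
case: s xn {vn} => s; last rewrite /= /dualinf oppr_eq0; move=> /gy_entry_cells.
  by [].
by case=> [[a b]|[a b]|[a b c]]; [constructor 2|constructor 1|constructor 3].
Qed.

Definition in_R I := #|[pred s | (cell t (I s) < m0)%N]|.

(* All but at least [j] of the indices lie in cells below [m0], the others in the [j] cells
   following [m0]; the cell [m0] of [z] stays unused. *)
Definition spread j (v : T) := forall I, tval v I != 0 ->
  (forall s, (cell t (I s) <= m0 + j)%N /\ cell t (I s) != m0) /\ (in_R I + j <= r)%N.

Lemma spread_subspace j : subspace (spread j).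
Proof.
split=> [I|a v w sv sw I]; first by rewrite eqxx.
move=> vw; have {vw}H : a * tval v I + tval w I != 0 :> C by exact: vw.
have [v0|v0] := eqVneq (tval v I : C) 0; last exact: sv.
have [w0|w0] := eqVneq (tval w I : C) 0; last exact: sw.
by move: H; rewrite v0 w0 mulr0 addr0 eqxx.
Qed.

Let in_R_upd I s i : (cell t (I s) < m0)%N -> (cell t i < m0)%N -> in_R (upd I s i) = in_R I.
Proof.
move=> Is ilt; apply: eq_card => s'; rewrite !inE ffunE.
by case: eqVneq => [->|//]; rewrite Is ilt.
Qed.

Lemma spread_gy j k l (v : T) : (k < z)%N -> (l < z)%N -> spread j v -> spread j (lact (y k l) v).
Proof.
rewrite !lt_cell_bound => kz lz sv I /lact_gy_support[s [i [vI sE]]].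
have [cI rI] := sv _ vI.
have [ci ci'] := cI s; rewrite upd_same in ci ci'.
have [ilt slt] : (cell t i < m0)%N /\ (cell t (I s) < m0)%N.
  by case: sE => [[-> ->]|[-> ->]|[_ _ iE]] //; rewrite iE eqxx in ci'.
split=> [s'|]; last by rewrite -(in_R_upd slt ilt).
have [->|ss] := eqVneq s' s; first by split; [lia|rewrite neq_ltn slt].
by have := cI s'; rewrite upd_other.
Qed.

(** The element joins a cell below [m0] to the cell [(m0 + j).+1], which [v] does not reach; so it
    can only carry an index from below [m0] into that cell. *)
Lemma spread_fresh j k l (v : T) : spread j v ->
  (cell t k = (m0 + j).+1 /\ (cell t l < m0)%N) \/ (cell t l = (m0 + j).+1 /\ (cell t k < m0)%N) ->
  spread j.+1 (lact (y k l) v).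
Proof.
move=> sv kl I /lact_gy_support[s [i [vI sE]]].
have [cI rI] := sv _ vI.
have [ci ci'] := cI s; rewrite upd_same in ci ci'.
have [ilt sE'] : (cell t i < m0)%N /\ cell t (I s) = (m0 + j).+1.
  case: kl => -[E lt]; case: sE => [[a b]|[a b]|[a b c]].
  - by rewrite a b E.
  - by rewrite b E in ci; lia.
  - by rewrite c eqxx in ci'.
  - by rewrite b E in ci; lia.
  - by rewrite a b E.
  - by rewrite c eqxx in ci'.
split=> [s'|].
  have [->|ss] := eqVneq s' s; first by rewrite sE'; split; lia.
  by have := cI s'; rewrite upd_other // => -[c1 c2]; split=> //; lia.
suff E : in_R (upd I s i) = (in_R I).+1 by rewrite E in rI; lia.
rewrite /in_R (cardD1 s) !inE upd_same ilt add1n; congr (_.+1).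
apply: eq_card => s'; rewrite !inE ffunE; case: eqVneq => [->|//].
by rewrite sE'; lia.
Qed.

Lemma spread_fresh_diag j c (v : T) : spread j v -> cell t c = (m0 + j).+1 -> lact (y c c) v = 0.
Proof.
move=> sv cE; apply: tensor_ext => I; apply/eqP; apply: contraT => /lact_gy_support[s [i [vI sE]]].
have [cI _] := sv _ vI; have [ci ci'] := cI s; rewrite upd_same in ci ci'.
by case: sE => [[_ iE]|[_ iE]|[_ _ iE]]; rewrite iE ?cE ?eqxx in ci ci' *; lia.
Qed.

Definition R_invariant (v : T) := forall k l, (k < z)%N -> (l < z)%N -> lact (y k l) v = 0.

(** If the invariant part [u - cw] is outside [W], it will do. Otherwise some [y k l] applied to
    [w'] is outside. For a fresh cell [c], [y k l] is the bracket of [y k c] and [y c l] up to a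
    term killing [w'], so [y c l] or [y k c] takes [w'] outside [W], with one more index moved out.
    More than [r] such moves are impossible. *)
Lemma ex_invariant (W W' : set T) v : submodule W -> submodule W' -> W' v -> ~ W v ->
  (forall I, tval v I != 0 -> forall s, (cell t (I s) < m0)%N) ->
  exists w, [/\ W' w, ~ W w, R_invariant w
    & forall I, tval w I != 0 -> forall s, (cell t (I s) <= m0 + r)%N /\ cell t (I s) != m0].
Proof.
move=> sW sW' W'v nWv sv.
have [W0 WP Wx] := sW; have [W'0 W'P W'x] := sW'.
have subW : subspace W by []. have subW' : subspace W' by [].
have sv0 : spread 0 v.
  move=> I vI; split=> [s|]; first by have := sv I vI s; rewrite addn0; split; lia.
  rewrite addn0 /in_R; apply: leq_trans (max_card _) _.
  by rewrite card_sum !card_ord.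
suff main d j u : (r < j + d)%N -> spread j u -> W' u -> ~ W u ->
    exists w, [/\ W' w, ~ W w, R_invariant w
    & forall I, tval w I != 0 -> forall s, (cell t (I s) <= m0 + r)%N /\ cell t (I s) != m0].
  by apply: (main r.+1 0%N v) => //; lia.
elim: d j u => [|d IH] j u rjd su W'u nWu.
  case: nWu; suff -> : u = 0 by [].
  apply: tensor_ext => I; apply/eqP; apply: contraT => uI.
  by have [_] := su I uI; lia.
have absT : absolute_weight T := (@tensor_absolute_weight C t p q).
have [w gw wE] := yspan_decomposition absT (leqnn z) u.
have stable (P : set T) : subspace P -> (forall k l u', (k < z)%N -> (l < z)%N -> P u' -> P (lact (y k l) u')) ->
    P u -> P w.
  by move=> sP Px Pu; apply: gw => // -[k l] u' Pu' /=; apply: Px.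
have W'w : W' w by apply: stable => // k l u' _ _; exact: W'x.
have sw : spread j w.
  by apply: stable => //; [exact: spread_subspace|move=> k l u' kz lz; exact: spread_gy].
set cw := casimir _ w in wE.
have W'c : W' cw by apply: subspace_sum => // k _; apply: subspace_sum => // l _; do 2!apply: (W'x).
have sc : spread j cw.
  apply: subspace_sum => [|k _]; first exact: spread_subspace.
  apply: subspace_sum => [|l _]; first exact: spread_subspace.
  by do 2!apply: spread_gy => //.
have [Wv0|nWv0] := pselect (W (u - cw)); last first.
  exists (u - cw); split=> //; [exact: (subspaceB subW')| |].
    by move=> k l kz lz; exact: (wE (Ordinal kz) (Ordinal lz)).
  move=> I vI; have sP := spread_subspace j.
  have [cI rI] := subspaceB sP su sc I vI.
  by move=> s; have [c1 c2] := cI s; split=> //; lia.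
have [k [l nW]] : exists k l : 'I_z, ~ W (lact (y k l) (lact (y l k) w)).
  apply: contrapT => nex; apply: nWu; rewrite -[u](subrK cw); apply: (subspaceD subW) => //.
  apply: subspace_sum => // k _; apply: subspace_sum => // l _.
  by apply: contrapT => nW; apply: nex; exists k, l.
set w' := lact (y l k) w in nW *.
have W'w' : W' w' by exact: W'x.
have sw' : spread j w' by exact: spread_gy.
pose c := rep (m0 + j).+1; have cE : cell t c = (m0 + j).+1 by exact: cell_rep.
have [ck cl] : (cell t k < m0)%N /\ (cell t l < m0)%N by rewrite -!lt_cell_bound.
have := @gy_chain_full z k c l; rewrite cE => /(_ _ _)/(congr1 (fun x => lact x w')).
rewrite lact_bracket lactBl lactZl (spread_fresh_diag sw' cE) scaler0 subr0 => E.
have [Wc|nWc] := pselect (W (lact (y c l) w')); last first.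
  apply: (IH j.+1 (lact (y c l) w')) => //; [lia| |exact: W'x].
  by apply: spread_fresh => //; left.
apply: (IH j.+1 (lact (y k c) w')) => //; [lia| |exact: W'x|].
  by apply: spread_fresh => //; right.
move=> Wkc; apply: nW; rewrite -E; [apply: (subspaceB subW); exact: Wx|lia|lia].
Qed.

End FreshCells.

(** * A bound for chains of submodules *)

Section TensorFiniteLength.
Variables (C : numClosedFieldType) (t : series) (p q : nat).
Notation slot := ('I_p + 'I_q)%type.
Notation multi_index := {ffun slot -> nat}.
Notation T := (tensor C p q : lieModType (ginf C t)).
Hypothesis q0 : t <> SL -> q = 0%N.
Implicit Types (I : multi_index) (s : slot).
Local Notation r := (p + q)%N.

Definition spread_below m0 (w : T) := forall I, tval w I != 0 ->
  forall s, (cell t (I s) <= m0 + r)%N /\ cell t (I s) != m0.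

(** Pigeonhole: there are [r] slots, and [a] uses none of the first [r] cells. *)
Lemma fresh_small_cell I a : (r <= cell t (I a))%N ->
  exists2 c, (c < r)%N & forall s, cell t (I s) != c.
Proof.
move=> ra; apply: contrapT => nex.
have ex (c : 'I_r) : exists s, cell t (I s) = c.
  apply: contrapT => ns; apply: nex; exists c => // s; apply/eqP => sc.
  by apply: ns; exists s.
have [g gE] := choice ex.
have inj_g : injective g by move=> c c' cc; apply: val_inj; rewrite /= -!gE cc.
have [|g' _ g'K] := inj_card_bij inj_g; first by rewrite card_sum !card_ord.
by have := gE (g' a); rewrite g'K => E; move: ra; rewrite E leqNgt ltn_ord.
Qed.

(** An index in a cell from [r] to [m0] is traded by [contraction_expansion] for pairs in a free
    cell below [r]. Each term has fewer such indices, and indices avoiding this range are covered by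
    the assumption; the cell [m0] itself is excluded by [spread_below]. *)
Lemma R_invariant_determined m0 (w : T) : (r <= m0)%N -> R_invariant m0 w ->
  spread_below m0 w ->
  (forall I, (forall s, (cell t (I s) < r)%N || (m0 < cell t (I s))%N) -> tval w I = 0) -> w = 0.
Proof.
move=> rm inv sw w0; apply: tensor_ext => I; rewrite -[RHS]/(0 : C).
have invA : @invariant_on C t p q (fun c => c < m0)%N (tval w).
  move=> z k l kA lA kl J; rewrite (@gy_cells C t z (cell_bound t m0)) //.
  have := inv k l; rewrite !lt_cell_bound => /(_ kA lA) E.
  by change (tval (lact (gy C t (cell_bound t m0) k l) w) J = 0); rewrite E.
pose bad I := [pred s | (r <= cell t (I s) <= m0)%N].
have [n] := ubnP #|bad I|; elim: n I => // n IHn I.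
have [[a ra]|nbad] := pselect (exists s, s \in bad I); last first.
  move=> _; apply: w0 => s; apply: contraT => ns; case: nbad; exists s.
  by rewrite inE; lia.
rewrite ltnS => badn; move: (ra); rewrite inE => /andP[ra1 ra2].
have [am|am] := eqVneq (cell t (I a)) m0.
  by apply/eqP; apply: contraT => /sw/(_ a)[_]; rewrite am eqxx.
have [c cr fresh] := fresh_small_cell ra1.
rewrite (@contraction_expansion C t p q q0 (fun c => c < m0)%N _ a I c) //; [|lia|lia].
apply: big1 => s sa; rewrite IHn ?mulr0 //; apply: leq_trans badn.
apply: proper_card; apply/fintype.properP; split; last first.
  by exists a => //; rewrite inE pairup_a 1?eq_sym // cell_rep; lia.
apply/fintype.subsetP => s'; rewrite !inE /pairup !ffunE.
case: (eqVneq s' s) => _; first by rewrite cell_dl cell_rep; lia.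
by case: (eqVneq s' a) => // _; rewrite cell_rep; lia.
Qed.

(** A cell holds at most two indices, so the cells below [r] and the [r] cells after [m0] hold at
    most [4 * r] of them, whatever [m0] is. *)
Let index_bound := #|{ffun slot -> 'I_(4 * r)}|.

Lemma ex_support_bound (v : T) : exists m, forall I, tval v I != 0 -> forall s, (cell t (I s) < m)%N.
Proof.
have [R [_ RP]] := tensor_support v; exists (\max_(J <- R) \max_s (cell t (J s)).+1) => I vI s.
have IR : I \in R by apply: contraNT vI => /RP ->.
rewrite (big_rem _ IR) /= leq_max; apply/orP; left; exact: (leq_bigmax s).
Qed.

(** Each step of the chain provides an invariant [w i] outside the previous submodule, with one [m0]
    for all steps. The chain makes the [w i] independent, and by [R_invariant_determined] their
    combinations are determined by [index_bound] coordinates. *)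
Lemma chain_bound n (f : nat -> set T) : (forall i, (i <= n)%N -> submodule (f i)) ->
  (forall i, (i < n)%N -> f i `<` f i.+1) -> (n <= index_bound)%N.
Proof.
move=> sf ff.
have ex_v (i : 'I_n) : exists v, f i.+1 v /\ ~ f i v.
  have [_ nsub] := ff i (ltn_ord i); apply: contrapT => nex; apply: nsub => v fv.
  by apply: contrapT => nfv; apply: nex; exists v.
have [v vP] := choice ex_v.
have [b bP] := choice (fun i : 'I_n => ex_support_bound (v i)).
pose m0 := maxn r (\max_i b i); have rm : (r <= m0)%N by exact: leq_maxl.
have ex_w (i : 'I_n) : exists w, [/\ f i.+1 w, ~ f i w, R_invariant m0 w & spread_below m0 w].
  have [fv nfv] := vP i.
  apply: (ex_invariant (sf _ (ltnW (ltn_ord i))) (sf _ (ltn_ord i)) fv nfv) => I vI s.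
  apply: leq_trans (bP i I vI s) _; rewrite leq_max; apply/orP; right; exact: (leq_bigmax i).
have [w wP] := choice ex_w.
rewrite leqNgt; apply/negP => ltn.
(* Codes below [2 * r] are indices themselves; the others count from the first index of the cell
   [m0.+1]. *)
pose dec e := if (e < 2 * r)%N then e else (cell_bound t m0.+1 + (e - 2 * r))%N.
pose decode (J : {ffun slot -> 'I_(4 * r)}) : multi_index := [ffun s => dec (J s)].
have ex_code I : (forall s, (cell t (I s) < r)%N || (m0 < cell t (I s))%N) ->
    (forall s, (cell t (I s) <= m0 + r)%N) -> exists J, decode J = I.
  move=> Ir Ib; pose e s := if (cell t (I s) < r)%N then I s else (2 * r + (I s - cell_bound t m0.+1))%N.
  have eP s : (e s < 4 * r)%N /\ dec (e s) = I s.
    have := Ir s; have := Ib s; rewrite /e /dec /cell /cell_bound; case: (t) => /=;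
    by case: ifP; case: ifP; lia.
  exists [ffun s => Ordinal (proj1 (eP s))]; apply/ffunP => s; rewrite !ffunE /=.
  exact: (proj2 (eP s)).
pose A : 'M[C]_(n, index_bound) := \matrix_(i, j) (tval (w i) (decode (enum_val j)) : C).
have kA : kermx A != 0.
  by rewrite -mxrank_eq0 mxrank_ker -lt0n subn_gt0; apply: leq_ltn_trans ltn; exact: rank_leq_col.
have [/= c /submxP[Dm cE] c0] := rowV0Pn kA.
have cA : c *m A = 0 by rewrite cE -mulmxA mulmx_ker mulmx0.
pose u : T := \sum_i c 0 i *: w i.
have uE I : tval u I = \sum_i c 0 i * tval (w i) I :> C by rewrite /u tensor_sum_fun.
have sb : spread_below m0 u.
  move=> I uI; apply: contrapT => ns; move/eqP: uI; apply; rewrite uE big1 // => i _.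
  have [->|wI] := eqVneq (tval (w i) I : C) 0; first by rewrite mulr0.
  by case: ns; have [_ _ _ sw] := wP i; exact: sw.
have u0 : u = 0.
  apply: (R_invariant_determined rm) => // [k l kz lz|I Ir].
    rewrite /u lact_sum big1 // => i _; rewrite lactZ.
    by have [_ _ iw _] := wP i; rewrite iw // scaler0.
  apply/eqP; apply: contraT => uI; have Ib s := proj1 (sb I uI s).
  have [J JI] := ex_code I Ir Ib; have /rowP/(_ (enum_rank J)) := cA.
  rewrite !mxE => sum0; move: uI; rewrite uE (eq_bigr (fun i => c 0 i * A i (enum_rank J))).
    by rewrite sum0 eqxx.
  by move=> i _; rewrite mxE enum_rankK JI.
have [i1 ci1] : exists i, c 0 i != 0.
  by apply: contrapT => nex; move/eqP: c0; apply; apply/rowP => i; rewrite mxE;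
    apply/eqP; apply: contraT => ci; case: nex; exists i.
(* The last [w i] occurring in the relation is a combination of earlier ones, which all lie in
   [f i0]. *)
case: (@arg_maxnP _ i1 (fun i => c 0 i != 0) (fun i => val i) ci1) => i0 ci0 max_i0.
have mono k l : (k <= l)%N -> (l <= n)%N -> f k `<=` f l.
  elim: l => [|l IH]; first by rewrite leqn0 => /eqP -> _ x.
  rewrite leq_eqVlt ltnS => /orP[/eqP -> _ x //|kl] ln.
  by apply: (subset_trans (IH kl (ltnW ln))); have [] := ff l ln.
have [fw nfw _ _] := wP i0; apply: nfw.
have sf0 : subspace (f i0) by have [s0 sP _] := sf i0 (ltnW (ltn_ord i0)).
apply: (subspaceZr sf0 ci0).
have -> : c 0 i0 *: w i0 = - \sum_(i | i != i0) c 0 i *: w i.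
  by apply/eqP; rewrite -addr_eq0; move: u0; rewrite /u (bigD1 i0) //= => ->.
apply: subspaceN => //; apply: subspace_sum => // i ii0.
have [->|ci] := eqVneq (c 0 i) 0; first by rewrite scale0r; case: sf0.
apply: subspaceZ => //; have [fwi _ _ _] := wP i; apply: mono fwi; last exact/ltnW/ltn_ord.
by have le_i : (i <= i0)%N := max_i0 i ci; rewrite ltn_neqAle le_i andbT.
Qed.

(** [rho U] is the largest length of a strict chain of submodules ending at [U]: bounded by
    [chain_bound], and strictly increasing since a chain ending at [U] is prolonged by [U']. *)
Lemma tensor_finite_length : finite_length T.
Proof.
pose P (U : set T) k := `[< exists f : nat -> set T, [/\ forall i, (i <= k)%N -> submodule (f i),
  forall i, (i < k)%N -> f i `<` f i.+1 & f k = U] >].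
pose rho U := (\max_(k < index_bound.+1 | P U k) k)%N.
apply: (@finite_length_of_rank _ _ T index_bound rho); split=> [U _|U U' sU sU' UU'].
  by apply/bigmax_leqP => k _; rewrite -ltnS.
have P0 : P U 0%N by apply/asboolP; exists (fun=> U); split.
have [|k /asboolP[f [sf ff fk]] kE] := @eq_bigmax_cond _ [pred k : 'I_index_bound.+1 | P U k] val.
  by apply/card_gt0P; exists ord0; exact: P0.
have P1 : P U' k.+1.
  apply/asboolP; exists (fun i => if (i <= k)%N then f i else U'); split=> [i ik|i ik|].
  - by case: leqP => // ik'; exact: sf.
  - have ik' : (i <= k)%N by rewrite -ltnS.
    rewrite ik'; have [ik''|ki] := ltnP i k; first exact: ff.
    suff -> : i = k by rewrite fk.
    by apply/eqP; rewrite eqn_leq ik'.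
  - by rewrite ltnn.
have kb : (k.+1 < index_bound.+1)%N.
  rewrite ltnS; have /asboolP[g [sg gg _]] := P1; exact: (chain_bound sg gg).
rewrite /rho; apply: (@leq_trans k.+1); first by rewrite ltnS -kE.
exact: (@leq_bigmax_cond _ [pred k : 'I_index_bound.+1 | P U' k] val (Ordinal kb)).
Qed.

End TensorFiniteLength.

(** * Injectivity *)

Section FiniteDirectSums.
Variables (K : fieldType) (L : lieAlgType K) (I : finType) (M : I -> lieModType L).

Definition dsum_inj i (m : M i) : dsum M := fun j =>
  if i =P j is ReflectT e then eq_rect i (fun k => M k : Type) m j e else 0.

Lemma dsum_injE i (m : M i) : dsum_inj m i = m.
Proof. by rewrite /dsum_inj; case: eqP => // e; rewrite (eq_axiomK e). Qed.

Lemma dsum_inj_neq i j (m : M i) : i != j -> dsum_inj m j = 0.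
Proof. by rewrite /dsum_inj; case: eqP => // ->; rewrite eqxx. Qed.

Lemma dsum_inj_linear i : linear (@dsum_inj i).
Proof.
move=> a u v; apply: functional_extensionality_dep => j.
change (dsum_inj (a *: u + v) j = a *: dsum_inj u j + dsum_inj v j).
have [<-|ij] := eqVneq i j; first by rewrite !dsum_injE.
by rewrite !dsum_inj_neq // scaler0 addr0.
Qed.

Lemma lact_dsum_inj i x (m : M i) : lact x (dsum_inj m) = dsum_inj (lact x m).
Proof.
apply: functional_extensionality_dep => j.
change (lact x (dsum_inj m j) = dsum_inj (lact x m) j).
have [<-|ij] := eqVneq i j; first by rewrite !dsum_injE.
by rewrite !dsum_inj_neq // lact0r.
Qed.

Lemma dsum_sum_fun (T : Type) (r : seq T) (g : T -> dsum M) j :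
  (\sum_(i <- r) g i) j = \sum_(i <- r) g i j.
Proof. by elim: r => [|i r IH]; rewrite ?big_nil // !big_cons -IH. Qed.

Lemma dsum_weight_spanned (h : set L) : (forall i, weight_spanned h (M i)) ->
  weight_spanned h (dsum M).
Proof.
move=> wM u; have -> : u = \sum_i dsum_inj (u i).
  apply: functional_extensionality_dep => j; rewrite dsum_sum_fun (bigD1 j) //= dsum_injE.
  by rewrite big1 ?addr0 // => i ij; exact: dsum_inj_neq.
apply: subspace_sum => [|i _]; first exact: lin_span_subspace.
apply: lin_spanW (lin_span_image (@dsum_inj_linear i) (wM i (u i))) => _ [m [lam wm] <-].
by exists lam => x; rewrite lact_dsum_inj wm; have [_ _ _ ->] := linear_fun_rules (@dsum_inj_linear i).
Qed.

Lemma dsum_extension (A B : lieModType L) (f : lie_hom A B) :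
  (forall i (u : lie_hom A (M i)), exists v : lie_hom B (M i), forall a, v (f a) = u a) ->
  forall u : lie_hom A (dsum M), exists v : lie_hom B (dsum M), forall a, v (f a) = u a.
Proof.
move=> ext u.
have comp i : exists v : lie_hom B (M i), forall a, v (f a) = u a i.
  pose g (a : A) : M i := u a i.
  have lin_g : linear g by move=> c a b; rewrite /g linearP.
  pose G : {linear A -> M i} := HB.pack g (GRing.isLinear.Build _ _ _ _ g lin_g).
  have GP x a : G (lact x a) = lact x (G a) by rewrite /G /= /g lie_homP.
  by have [v vE] := ext i (LieHom GP); exists v.
pose w i := projT1 (cid (comp i)); have wE i a : w i (f a) = u a i := projT2 (cid (comp i)) a.
pose g (b : B) : dsum M := fun i => w i b.
have lin_g : linear g.
  by move=> c a b; apply: functional_extensionality_dep => i; rewrite /g linearP.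
pose G : {linear B -> dsum M} := HB.pack g (GRing.isLinear.Build _ _ _ _ g lin_g).
have GP x b : G (lact x b) = lact x (G b).
  by apply: functional_extensionality_dep => i; rewrite /G /= /g lie_homP.
by exists (LieHom GP) => a; apply: functional_extensionality_dep => i; exact: wE.
Qed.

End FiniteDirectSums.

Section Main.
Variables (C : numClosedFieldType) (t : series).

Lemma absolute_weight_submod (M : lieModType (ginf C t)) (W : set M) (sW : submodule W) :
  absolute_weight M -> absolute_weight (submod_type sW).
Proof.
move=> absM h sh; apply/weight_moduleP.
by apply: (@weight_spanned_sub _ _ h _ M (@submod_val _ _ _ _ sW)); [|exact: val_inj| |exact/weight_moduleP/absM].
Qed.

Lemma in_TT_submod (M : lieModType (ginf C t)) (W : set M) (sW : submodule W) :
  in_TT M -> in_TT (submod_type sW).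
Proof.
move=> [absM flM]; split; first exact: absolute_weight_submod.
by apply: (@finite_length_sub _ _ _ M (@submod_val _ _ _ _ sW)); [|exact: val_inj| |].
Qed.

(** Both categories are closed under submodules, so monomorphisms are injective and the same
    extension serves both; finite length makes [T] an object of the second. *)
Lemma dsum_injective (I : finType) (p q : I -> nat) :
  (forall i, t <> SL -> q i = 0%N) ->
  let T : lieModType (ginf C t) := dsum (fun i => tensor C (p i) (q i) : lieModType (ginf C t)) in
  injective_object_in (@absolute_weight C t) T /\ injective_object_in (@in_TT C t) T.
Proof.
move=> q0 T.
have absT : absolute_weight T.
  move=> h sh; apply/weight_moduleP/dsum_weight_spanned => i.
  by apply/weight_moduleP; exact: tensor_absolute_weight.
have ext (M N : lieModType (ginf C t)) (f : lie_hom M N) : absolute_weight N -> injective f ->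
    forall u : lie_hom M T, exists v : lie_hom N T, forall m, v (f m) = u m.
  by move=> absN inj_f; apply: dsum_extension => i u; exact: (extend_to_tensor (q0 i) u absN inj_f).
have flT : finite_length T.
  apply: finite_length_dsum => i; exact: (@tensor_finite_length C t (p i) (q i) (q0 i)).
split; split; first exact: absT.
- move=> M N f absM absN monof u; apply: ext => //.
  by apply: monomorphism_injective monof => // W sW; exact: absolute_weight_submod.
- by split.
- move=> M N f TM TN monof u; apply: ext => //; first by case: TN.
  by apply: monomorphism_injective monof => // W sW; exact: in_TT_submod.
Qed.

End Main.

Theorem proposition4p5 (R : realType) (t : series) (r : nat) :
  injective_object_in (@absolute_weight R[i] t) (T_le R[i] t r) /\
  injective_object_in (@in_TT R[i] t) (T_le R[i] t r).
Proof.
(* [T_le] unfolds to a finite direct sum in each series; outside [SL] there are no covector slots,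
   which is the condition on [q]. *)
case: t; [exact: (@dsum_injective R[i] SL)|exact: (@dsum_injective R[i] Oeven)
  |exact: (@dsum_injective R[i] Oodd)|exact: (@dsum_injective R[i] SP)].
Qed.
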